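(* Let $\mathbf{P}$ be the category of Polish groups and continuous group homomorphisms, and let $\mathbf{PC}$ be the category whose objects are groups with a Polish cover and whose morphisms are Borel-definable group homomorphisms. Then there is an equivalence of categories $$\mathrm{Ex}(\mathbf{P})\simeq \mathbf{PC}$$ between the exact completion $\mathrm{Ex}(\mathbf{P})$ of $\mathbf{P}$ as a regular category and $\mathbf{PC}$, mapping each Polish group $G$ (regarded as the object $(G,\Delta_G)$ of $\mathrm{Ex}(\mathbf{P})$) to the group with a Polish cover $G/N$ where $N=\{1\}$ is the trivial subgroup of $G$.
   Context: A subgroup $N$ of a Polish group $G$ is a Polish subgroup if it carries a (necessarily unique) Polish group topology for which the inclusion $N\to G$ is continuous. A group with a Polish cover is a quotient group $G/N$ where $G$ is a Polish group and $N$ is a normal Polish subgroup of $G$ (the pair $(G,N)$ is part of the data). A lift of a group homomorphism $f:G/N\to H/M$ between groups with a Polish cover is a function $\tilde f:G\to H$ with $f(gN)=\tilde f(g)M$ for all $g\in G$; $f$ is Borel-definable if it has a Borel lift. Composition in $\mathbf{PC}$ is composition of homomorphisms. Exact completion (ex/reg completion). Let $\mathcal C$ be a regular category. A relation from $X$ to $Y$ is a subobject $R\hookrightarrow X\times Y$. The composite $SR$ of a relation $R$ from $X$ to $Y$ with a relation $S$ from $Y$ to $Z$ is the regular image of $R\times_Y S\to X\times Z$; $R^\circ$ denotes the opposite relation, $\Delta_X$ the diagonal relation, and $\leq$ the inclusion of subobjects. The objects of $\mathrm{Ex}(\mathcal C)$ are pairs $(X,R)$ with $R$ an internal equivalence relation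 on the object $X$ of $\mathcal C$. A morphism $(X,R)\to (Y,S)$ is a relation $T$ from $X$ to $Y$ such that $TR=T=ST$, $R\leq T^\circ T$, and $TT^\circ\leq S$. Composition is composition of relations, and the identity of $(X,R)$ is $R$. The canonical embedding $\mathcal C\to\mathrm{Ex}(\mathcal C)$ sends $X$ to $(X,\Delta_X)$ and a morphism to its graph. The category $\mathbf{P}$ is regular, and its regular epimorphisms are the surjective continuous homomorphisms. *)

(* Defs.v *)
From HB Require Import structures.
From mathcomp Require Import all_boot all_order all_algebra.
From mathcomp Require Import all_classical reals topology measure.

Set Implicit Arguments.
Unset Strict Implicit.
Unset Printing Implicit Defensive.

Declare Scope cat_scope.
Delimit Scope cat_scope with cat.
Local Open Scope cat_scope.

Record category := Category {
  obj :> Type;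
  hom : obj -> obj -> Type;
  idc : forall A, hom A A;
  comp : forall A B C, hom B C -> hom A B -> hom A C;
  comp1c : forall A B (f : hom A B), comp (idc B) f = f;
  compc1 : forall A B (f : hom A B), comp f (idc A) = f;
  compA : forall A B C D (h : hom C D) (g : hom B C) (f : hom A B),
    comp h (comp g f) = comp (comp h g) f
}.
Arguments hom {c} A B.
Arguments idc {c} A.
Arguments comp {c A B C} g f.
Notation "g ∘ f" := (comp g f) (at level 40, left associativity) : cat_scope.

Record functor (C D : category) := Functor {
  fobj :> C -> D;
  fmap : forall A B, hom A B -> hom (fobj A) (fobj B);
  fmap1 : forall A, fmap (idc A) = idc (fobj A);
  fmapM : forall A B E (g : hom B E) (f : hom A B),
    fmap (g ∘ f) = fmap g ∘ fmap f
}.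
Arguments fmap {C D} _ {A B} _.

Definition functor_id (C : category) : functor C C :=
  @Functor C C id (fun _ _ f => f) (fun _ => erefl) (fun _ _ _ _ _ => erefl).

Lemma functor_comp1 (C D E : category) (G : functor D E) (F : functor C D) A :
  fmap G (fmap F (idc A)) = idc (G (F A)).
Proof. by rewrite !fmap1. Qed.

Lemma functor_compM (C D E : category) (G : functor D E) (F : functor C D)
    (X Y Z : C) (g : hom Y Z) (f : hom X Y) :
  fmap G (fmap F (g ∘ f)) = fmap G (fmap F g) ∘ fmap G (fmap F f).
Proof. by rewrite !fmapM. Qed.

Definition functor_comp (C D E : category) (G : functor D E) (F : functor C D) :
    functor C E :=
  @Functor C E (fun A => G (F A)) (fun _ _ f => fmap G (fmap F f))
    (functor_comp1 G F) (@functor_compM C D E G F).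

Definition is_iso (C : category) (A B : C) (f : hom A B) : Prop :=
  exists g : hom B A, g ∘ f = idc A /\ f ∘ g = idc B.

Definition naturally_isomorphic (C D : category) (F G : functor C D) : Prop :=
  exists eta : forall A, hom (F A) (G A),
    (forall A B (f : hom A B), eta B ∘ fmap F f = fmap G f ∘ eta A) /\
    (forall A, is_iso (eta A)).

Definition is_equivalence (C D : category) (F : functor C D) : Prop :=
  exists G : functor D C,
    naturally_isomorphic (functor_comp G F) (functor_id C) /\
    naturally_isomorphic (functor_comp F G) (functor_id D).

Section RegularCategory.
Variable C : category.
Implicit Types A B X Y Z T : C.

Definition mono A B (m : hom A B) : Prop :=
  forall T (u v : hom T A), m ∘ u = m ∘ v -> u = v.

Definition regular_epi A B (e : hom A B) : Prop :=
  exists K (u v : hom K A), e ∘ u = e ∘ v /\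
    forall T (f : hom A T), f ∘ u = f ∘ v -> exists! h : hom B T, h ∘ e = f.

Definition terminal A : Prop := forall T, exists! f : hom T A, True.

Record span A B := Span {
  apex : C; leg1 : hom apex A; leg2 : hom apex B
}.

Definition is_product A B (P : span A B) : Prop :=
  forall T (f : hom T A) (g : hom T B),
    exists! h : hom T (apex P), leg1 P ∘ h = f /\ leg2 P ∘ h = g.

Definition is_pullback A B Z (f : hom A Z) (g : hom B Z) (P : span A B) : Prop :=
  f ∘ leg1 P = g ∘ leg2 P /\
  forall T (u : hom T A) (v : hom T B), f ∘ u = g ∘ v ->
    exists! h : hom T (apex P), leg1 P ∘ h = u /\ leg2 P ∘ h = v.

Record mono_to Z := MonoTo {
  mdom : C; marr : hom mdom Z; marr_mono : mono marr
}.

Definition is_image A Z (f : hom A Z) (m : mono_to Z) : Prop :=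
  exists e : hom A (mdom m), regular_epi e /\ f = marr m ∘ e.

Record is_regular : Prop := IsRegular {
  has_terminal : exists A, terminal A;
  has_products : forall A B, exists P : span A B, is_product P;
  has_pullbacks : forall A B Z (f : hom A Z) (g : hom B Z),
    exists P : span A B, is_pullback f g P;
  has_images : forall A Z (f : hom A Z), exists m : mono_to Z, is_image f m;
  regular_epi_stable : forall A B Z (f : hom A Z) (g : hom B Z) (P : span A B),
    is_pullback f g P -> regular_epi f -> regular_epi (leg2 P)
}.

Definition mono_le Z (m n : mono_to Z) : Prop :=
  exists h : hom (mdom m) (mdom n), marr n ∘ h = marr m.

(* A subobject is an equivalence class of monomorphisms, so that equality of
   subobjects is [=].
   [T -> Prop] rather than [set T]: the universe of [set] is the one of the
   carriers of the MathComp structures, which lies below that of [C]. *)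
Definition subobj_class Z (m : mono_to Z) : mono_to Z -> Prop :=
  fun n => mono_le m n /\ mono_le n m.

Record subobject Z := Subobject {
  sub_monos : mono_to Z -> Prop;
  sub_monosP : exists m, sub_monos = subobj_class m
}.

Definition subobj_of Z (m : mono_to Z) : subobject Z :=
  @Subobject Z (subobj_class m) (ex_intro _ m erefl).

Definition sub_mono Z (S : subobject Z) : mono_to Z := sval (cid (sub_monosP S)).

Definition sub_le Z (S S' : subobject Z) : Prop :=
  mono_le (sub_mono S) (sub_mono S').

Lemma mono_le_refl Z (m : mono_to Z) : mono_le m m.
Proof. by exists (idc _); rewrite compc1. Qed.

Lemma mono_le_trans Z (n m p : mono_to Z) :
  mono_le m n -> mono_le n p -> mono_le m p.
Proof. by case=> h eh [k ek]; exists (k ∘ h); rewrite compA ek. Qed.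

Lemma sub_monosE Z (S : subobject Z) : sub_monos S = subobj_class (sub_mono S).
Proof. by rewrite /sub_mono; case: cid. Qed.

Lemma sub_mono_of Z (m : mono_to Z) :
  mono_le m (sub_mono (subobj_of m)) /\ mono_le (sub_mono (subobj_of m)) m.
Proof.
have /= E := sub_monosE (subobj_of m).
have : subobj_class m m by split; exact: mono_le_refl.
by rewrite E => -[? ?].
Qed.

Lemma sub_le_refl Z (S : subobject Z) : sub_le S S.
Proof. exact: mono_le_refl. Qed.

Lemma sub_le_trans Z (S' S S'' : subobject Z) :
  sub_le S S' -> sub_le S' S'' -> sub_le S S''.
Proof. exact: mono_le_trans. Qed.

Lemma sub_le_anti Z (S S' : subobject Z) : sub_le S S' -> sub_le S' S -> S = S'.
Proof.
move=> le1 le2; have : sub_monos S = sub_monos S'.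
  rewrite !sub_monosE; apply/funext => n; apply/propext; split=> -[? ?].
    by split; [exact: mono_le_trans le2 _|exact: mono_le_trans le1].
  by split; [exact: mono_le_trans le1 _|exact: mono_le_trans le2].
move: S S' {le1 le2} => [S PS] [S' PS'] /= E.
by move: PS'; rewrite -E => PS'; congr Subobject; exact: Prop_irrelevance.
Qed.

Lemma regular_epi_epi A B (e : hom A B) T (u v : hom B T) :
  regular_epi e -> u ∘ e = v ∘ e -> u = v.
Proof.
move=> [K [a [b [eab univ]]]] uv.
have [|h [_ hU]] := univ T (u ∘ e); first by rewrite -!compA eab.
by rewrite -(hU u)// -(hU v).
Qed.

Lemma regular_epi_lift A B (e : hom A B) I Z (m : hom I Z)
    (f : hom A I) (g : hom B Z) :
  regular_epi e -> mono m -> m ∘ f = g ∘ e -> exists d : hom B I, m ∘ d = g.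
Proof.
move=> re mm mf; have [K [a [b [eab univ]]]] := re.
have [|d [df _]] := univ I f; first by apply: mm; rewrite !compA mf -!compA eab.
by exists d; apply: (regular_epi_epi re); rewrite -compA df.
Qed.

Lemma regular_epi_id A : regular_epi (idc A).
Proof.
exists A, (idc A), (idc A); split=> // T f _; exists f; split; rewrite ?compc1//.
by move=> h <-; rewrite compc1.
Qed.

Lemma regular_epi_iso A B D (e : hom A B) (i : hom B D) :
  regular_epi e -> is_iso i -> regular_epi (i ∘ e).
Proof.
move=> [K [a [b [eab univ]]]] [j [ji ij]]; exists K, a, b; split.
  by rewrite -!compA eab.
move=> T f /univ[h [hf hU]]; exists (h ∘ j); split.
  by rewrite -compA (compA j) ji comp1c.
move=> k kf; rewrite (hU (k ∘ i)); last by rewrite -compA.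
by rewrite -compA ij compc1.
Qed.

End RegularCategory.
Arguments span {C} A B.
Arguments mono_to {C} Z.
Arguments subobject {C} Z.

Section Relations.
Variables (C : category) (HC : is_regular C).
Implicit Types A B X Y Z W T : C.

(* [is_regular] being a proposition, products, pullbacks and images are chosen
   with [cid]; they are only determined up to isomorphism. *)
Definition product_span X Y : span X Y := sval (cid (has_products HC X Y)).
Definition prodc X Y : C := apex (product_span X Y).
Definition pr1 X Y : hom (prodc X Y) X := leg1 (product_span X Y).
Definition pr2 X Y : hom (prodc X Y) Y := leg2 (product_span X Y).

Lemma product_spanP X Y : is_product (product_span X Y).
Proof. by rewrite /product_span; case: cid. Qed.

Definition pairc T X Y (x : hom T X) (y : hom T Y) : hom T (prodc X Y) :=
  sval (cid (@product_spanP X Y T x y)).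

Lemma pairc1 T X Y (x : hom T X) (y : hom T Y) : pr1 X Y ∘ pairc x y = x.
Proof. by rewrite /pairc; case: cid => h [[]]. Qed.

Lemma pairc2 T X Y (x : hom T X) (y : hom T Y) : pr2 X Y ∘ pairc x y = y.
Proof. by rewrite /pairc; case: cid => h [[]]. Qed.

Lemma prodc_ext T X Y (h k : hom T (prodc X Y)) :
  pr1 X Y ∘ h = pr1 X Y ∘ k -> pr2 X Y ∘ h = pr2 X Y ∘ k -> h = k.
Proof.
move=> e1 e2; have [l [_ lU]] := product_spanP (pr1 X Y ∘ h) (pr2 X Y ∘ h).
by rewrite -(lU h)// -(lU k).
Qed.

Lemma pairc_comp S T X Y (x : hom T X) (y : hom T Y) (t : hom S T) :
  pairc x y ∘ t = pairc (x ∘ t) (y ∘ t).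
Proof. by apply: prodc_ext; rewrite compA ?pairc1 ?pairc2. Qed.

Lemma pairc_inj T X Y (x x' : hom T X) (y y' : hom T Y) :
  pairc x y = pairc x' y' -> x = x' /\ y = y'.
Proof.
by move=> e; split; [rewrite -(pairc1 x y) e pairc1|rewrite -(pairc2 x y) e pairc2].
Qed.

Definition pullback_span A B Z (f : hom A Z) (g : hom B Z) : span A B :=
  sval (cid (has_pullbacks HC f g)).

Lemma pullback_spanP A B Z (f : hom A Z) (g : hom B Z) :
  is_pullback f g (pullback_span f g).
Proof. by rewrite /pullback_span; case: cid. Qed.

Definition image_mono A Z (f : hom A Z) : mono_to Z := sval (cid (has_images HC f)).

Lemma image_monoP A Z (f : hom A Z) : is_image f (image_mono f).
Proof. by rewrite /image_mono; case: cid. Qed.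

Definition relation X Y := subobject (prodc X Y).

Definition rel_dom X Y (R : relation X Y) : C := mdom (sub_mono R).
Definition rel_fst X Y (R : relation X Y) : hom (rel_dom R) X :=
  pr1 X Y ∘ marr (sub_mono R).
Definition rel_snd X Y (R : relation X Y) : hom (rel_dom R) Y :=
  pr2 X Y ∘ marr (sub_mono R).

Definition rel_at X Y (R : relation X Y) T (x : hom T X) (y : hom T Y) : Prop :=
  exists h : hom T (rel_dom R), marr (sub_mono R) ∘ h = pairc x y.

Lemma diag_mono X : mono (pairc (idc X) (idc X)).
Proof. by move=> T u v; rewrite !pairc_comp !comp1c => /pairc_inj[]. Qed.

Definition rel_diag X : relation X X := subobj_of (MonoTo (@diag_mono X)).

Lemma opp_mono X Y (R : relation X Y) : mono (pairc (rel_snd R) (rel_fst R)).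
Proof.
move=> T u v; rewrite !pairc_comp => /pairc_inj[e2 e1].
by apply: (marr_mono (m := sub_mono R)); apply: prodc_ext; rewrite !compA.
Qed.

Definition rel_opp X Y (R : relation X Y) : relation Y X :=
  subobj_of (MonoTo (@opp_mono X Y R)).

(* [rel_comp S R] is the regular image of [R ×_Y S -> X × Z]. *)
Definition rel_comp X Y Z (S : relation Y Z) (R : relation X Y) : relation X Z :=
  let P := pullback_span (rel_snd R) (rel_fst S) in
  subobj_of (image_mono (pairc (rel_fst R ∘ leg1 P) (rel_snd S ∘ leg2 P))).

(* Internal equivalence relations, in representable form: each [hom T -]
   carries an equivalence relation. *)
Definition equivalence_rel X (R : relation X X) : Prop :=
  forall T : C,
    [/\ forall x : hom T X, rel_at R x x,
        forall x y : hom T X, rel_at R x y -> rel_at R y x &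
        forall x y z : hom T X, rel_at R x y -> rel_at R y z -> rel_at R x z].

Lemma rel_at_comp X Y (R : relation X Y) T T' (x : hom T X) (y : hom T Y)
    (t : hom T' T) : rel_at R x y -> rel_at R (x ∘ t) (y ∘ t).
Proof. by case=> h eh; exists (h ∘ t); rewrite compA eh pairc_comp. Qed.

Lemma rel_at_dom X Y (R : relation X Y) : rel_at R (rel_fst R) (rel_snd R).
Proof.
by exists (idc _); rewrite compc1; apply: prodc_ext; rewrite ?pairc1 ?pairc2.
Qed.

Lemma rel_leP X Y (R R' : relation X Y) :
  sub_le R R' <-> forall T (x : hom T X) (y : hom T Y), rel_at R x y -> rel_at R' x y.
Proof.
split=> [[k ek] T x y [h eh]|RR'].
  by exists (k ∘ h); rewrite compA ek.
have [h eh] := RR' _ _ _ (rel_at_dom R).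
by exists h; rewrite eh; apply: prodc_ext; rewrite ?pairc1 ?pairc2.
Qed.

Lemma rel_ext X Y (R R' : relation X Y) :
  (forall T (x : hom T X) (y : hom T Y), rel_at R x y <-> rel_at R' x y) -> R = R'.
Proof.
by move=> E; apply: sub_le_anti; apply/rel_leP => T x y; rewrite E.
Qed.

Lemma rel_at_of X Y (m : mono_to (prodc X Y)) T (x : hom T X) (y : hom T Y) :
  rel_at (subobj_of m : relation X Y) x y <->
  exists h : hom T (mdom m), marr m ∘ h = pairc x y.
Proof.
have [[a ea] [b eb]] := sub_mono_of m.
split=> -[h eh].
  by exists (b ∘ h); rewrite compA eb.
by exists (a ∘ h); rewrite compA ea.
Qed.

Lemma rel_at_diag X T (x y : hom T X) : rel_at (rel_diag X) x y <-> x = y.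
Proof.
rewrite rel_at_of; split=> [[h]|<-].
  by rewrite /= pairc_comp comp1c => /pairc_inj[<- <-].
by exists x; rewrite /= pairc_comp comp1c.
Qed.

Lemma rel_at_opp X Y (R : relation X Y) T (y : hom T Y) (x : hom T X) :
  rel_at (rel_opp R) y x <-> rel_at R x y.
Proof.
rewrite rel_at_of; split=> -[h /= eh]; exists h.
  move: eh; rewrite pairc_comp => /pairc_inj[e2 e1].
  by apply: prodc_ext; rewrite ?pairc1 ?pairc2 compA.
have [e1 e2] : rel_fst R ∘ h = x /\ rel_snd R ∘ h = y.
  by rewrite /rel_fst /rel_snd -!compA eh pairc1 pairc2.
by rewrite pairc_comp e1 e2.
Qed.

Lemma regular_epi_pullback A B Z (e : hom A Z) (g : hom B Z) : regular_epi e ->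
  exists T (t : hom T B) (s : hom T A), regular_epi t /\ e ∘ s = g ∘ t.
Proof.
move=> re; have pb := pullback_spanP e g.
exists _, (leg2 (pullback_span e g)), (leg1 (pullback_span e g)).
by split; [exact: (regular_epi_stable HC pb)|case: pb].
Qed.

Lemma regular_epi_comp A B D (f : hom B D) (e : hom A B) :
  regular_epi f -> regular_epi e -> regular_epi (f ∘ e).
Proof.
move=> rf re; have [q [rq fe]] := image_monoP (f ∘ e).
set m := image_mono (f ∘ e) in q rq fe *.
have [|d md] := regular_epi_lift (f := q) (g := f) re (marr_mono (m := m)).
  by rewrite fe.
have [|d' md'] := regular_epi_lift (f := d) (g := idc D) rf (marr_mono (m := m)).
  by rewrite comp1c.
rewrite fe; apply: regular_epi_iso => //; exists d'; split=> //.
by apply: (marr_mono (m := m)); rewrite compA md' comp1c compc1.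
Qed.

Lemma rel_at_local X Y (R : relation X Y) T T' (e : hom T' T)
    (x : hom T X) (y : hom T Y) :
  regular_epi e -> rel_at R (x ∘ e) (y ∘ e) -> rel_at R x y.
Proof.
move=> re [h eh].
apply: (regular_epi_lift (f := h) re (marr_mono (m := sub_mono R))).
by rewrite eh pairc_comp.
Qed.

Lemma rel_at_rel_comp X Y Z (S : relation Y Z) (R : relation X Y) T
    (x : hom T X) (z : hom T Z) :
  rel_at (rel_comp S R) x z <->
  exists T' (e : hom T' T) (y : hom T' Y),
    [/\ regular_epi e, rel_at R (x ∘ e) y & rel_at S y (z ∘ e)].
Proof.
rewrite /rel_comp; set P := pullback_span _ _.
have [comm univ] : is_pullback (rel_snd R) (rel_fst S) P by exact: pullback_spanP.
set f := pairc _ _; have [q [rq fq]] := image_monoP f.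
rewrite rel_at_of; split=> [[h eh]|[T' [e [y [re Rxy Syz]]]]].
  have [T' [t [s [rt st]]]] := regular_epi_pullback h rq.
  exists T', t, (rel_snd R ∘ leg1 P ∘ s).
  have : f ∘ s = pairc (x ∘ t) (z ∘ t) by rewrite fq -compA st compA eh pairc_comp.
  rewrite /f pairc_comp => /pairc_inj[<- <-]; split=> //.
    by do 2!apply: rel_at_comp; exact: rel_at_dom.
  by rewrite comm; do 2!apply: rel_at_comp; exact: rel_at_dom.
have [h eh] := Rxy; have [k ek] := Syz.
have [|l [[el1 el2] _]] := univ _ h k.
  by rewrite /rel_snd /rel_fst -!compA eh ek pairc1 pairc2.
apply: (regular_epi_lift (f := q ∘ l) re (marr_mono (m := image_mono f))).
rewrite compA -fq /f pairc_comp -(compA (rel_fst R)) -(compA (rel_snd S)) el1 el2.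
by rewrite /rel_fst /rel_snd -!compA eh ek pairc1 pairc2 pairc_comp.
Qed.

Lemma rel_compA X Y Z W (U : relation Z W) (S : relation Y Z) (R : relation X Y) :
  rel_comp U (rel_comp S R) = rel_comp (rel_comp U S) R.
Proof.
apply: rel_ext => T x w; rewrite !rel_at_rel_comp; split.
  move=> [T' [e [z [re /rel_at_rel_comp[T'' [e' [y [re' Rxy Syz]]]] Uzw]]]].
  exists T'', (e ∘ e'), y; split; rewrite ?compA//; first exact: regular_epi_comp.
  apply/rel_at_rel_comp; exists T'', (idc _), (z ∘ e'); rewrite !compc1.
  by split=> //; [exact: regular_epi_id|exact: rel_at_comp].
move=> [T' [e [y [re Rxy /rel_at_rel_comp[T'' [e' [z [re' Syz Uzw]]]]]]]].
exists T'', (e ∘ e'), z; split; rewrite ?compA//; first exact: regular_epi_comp.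
apply/rel_at_rel_comp; exists T'', (idc _), (y ∘ e'); rewrite !compc1.
by split=> //; [exact: regular_epi_id|exact: rel_at_comp].
Qed.

Lemma rel_comp_le X Y Z (S S' : relation Y Z) (R R' : relation X Y) :
  sub_le S S' -> sub_le R R' -> sub_le (rel_comp S R) (rel_comp S' R').
Proof.
move=> /rel_leP SS' /rel_leP RR'; apply/rel_leP => T x z.
rewrite !rel_at_rel_comp => -[T' [e [y [re Rxy Syz]]]].
by exists T', e, y; split=> //; [exact: RR'|exact: SS'].
Qed.

Lemma rel_opp_comp X Y Z (S : relation Y Z) (R : relation X Y) :
  rel_opp (rel_comp S R) = rel_comp (rel_opp R) (rel_opp S).
Proof.
apply: rel_ext => T z x; rewrite rel_at_opp !rel_at_rel_comp.
by split=> -[T' [e [y [re r1 r2]]]]; exists T', e, y; split=> //;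
   move: r1 r2; rewrite ?rel_at_opp.
Qed.

Lemma rel_comp_diag X Y (R : relation X Y) : rel_comp R (rel_diag X) = R.
Proof.
apply: rel_ext => T x y; rewrite rel_at_rel_comp; split.
  by move=> [T' [e [x' [re /rel_at_diag<- Rxy]]]]; exact: rel_at_local Rxy.
move=> Rxy; exists T, (idc T), x; rewrite !compc1; split=> //.
  exact: regular_epi_id.
exact/rel_at_diag.
Qed.

Lemma rel_diag_comp X Y (R : relation X Y) : rel_comp (rel_diag Y) R = R.
Proof.
apply: rel_ext => T x y; rewrite rel_at_rel_comp; split.
  by move=> [T' [e [y' [re Rxy /rel_at_diag eq_y]]]]; rewrite eq_y in Rxy;
     exact: rel_at_local Rxy.
move=> Rxy; exists T, (idc T), y; rewrite !compc1; split=> //.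
  exact: regular_epi_id.
exact/rel_at_diag.
Qed.

Lemma equivalence_rel_diag X : equivalence_rel (rel_diag X).
Proof. by split=> [x|x y|x y z]; rewrite !rel_at_diag// => ->. Qed.

Lemma equivalence_rel_opp X (R : relation X X) : equivalence_rel R -> rel_opp R = R.
Proof.
move=> eR; apply: rel_ext => T x y; rewrite rel_at_opp.
by split; have [_ sym _] := eR T; exact: sym.
Qed.

Lemma equivalence_rel_comp X (R : relation X X) :
  equivalence_rel R -> rel_comp R R = R.
Proof.
move=> eR; apply: rel_ext => T x y; rewrite rel_at_rel_comp; split.
  move=> [T' [e [z [re Rxz Rzy]]]]; apply: (rel_at_local re).
  by have [_ _ trans] := eR T'; exact: trans Rxz Rzy.
move=> Rxy; exists T, (idc T), x; rewrite !compc1.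
by split=> //; [exact: regular_epi_id|have [rfl _ _] := eR T].
Qed.

End Relations.

Section ExactCompletion.
Variables (C : category) (HC : is_regular C).

Record ex_obj := ExObj {
  ex_carrier : C;
  ex_rel : relation HC ex_carrier ex_carrier;
  ex_relP : equivalence_rel ex_rel
}.

Definition is_ex_hom (X Y : ex_obj)
    (T : relation HC (ex_carrier X) (ex_carrier Y)) : Prop :=
  [/\ rel_comp T (ex_rel X) = T, T = rel_comp (ex_rel Y) T,
      sub_le (ex_rel X) (rel_comp (rel_opp T) T) &
      sub_le (rel_comp T (rel_opp T)) (ex_rel Y)].

Record ex_hom (X Y : ex_obj) := ExHom {
  ex_hom_rel : relation HC (ex_carrier X) (ex_carrier Y);
  ex_homP : is_ex_hom ex_hom_rel
}.

Lemma ex_hom_ext X Y (S T : ex_hom X Y) : ex_hom_rel S = ex_hom_rel T -> S = T.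
Proof.
move: S T => [S PS] [T PT] /= E; move: PT; rewrite -E => PT.
by congr ExHom; exact: Prop_irrelevance.
Qed.

Lemma is_ex_hom_id X : is_ex_hom (X := X) (Y := X) (ex_rel X).
Proof.
have eX := ex_relP X; split; rewrite ?(equivalence_rel_opp eX) ?equivalence_rel_comp//;
  exact: sub_le_refl.
Qed.

Definition ex_id X : ex_hom X X := ExHom (is_ex_hom_id X).

Lemma is_ex_hom_comp X Y Z (U : ex_hom Y Z) (T : ex_hom X Y) :
  is_ex_hom (X := X) (Y := Z) (rel_comp (ex_hom_rel U) (ex_hom_rel T)).
Proof.
have [TX YT XT TY] := ex_homP T; have [UY ZU YU UZ] := ex_homP U.
split; rewrite ?rel_opp_comp.
- by rewrite -rel_compA TX.
- by rewrite rel_compA -ZU.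
- have -> : rel_comp (rel_comp (rel_opp (ex_hom_rel T)) (rel_opp (ex_hom_rel U)))
        (rel_comp (ex_hom_rel U) (ex_hom_rel T)) =
      rel_comp (rel_opp (ex_hom_rel T))
        (rel_comp (rel_comp (rel_opp (ex_hom_rel U)) (ex_hom_rel U)) (ex_hom_rel T)).
    by rewrite -!rel_compA.
  apply: (sub_le_trans XT); rewrite {2}YT.
  by do 2![apply: rel_comp_le => //; try exact: sub_le_refl].
- have -> : rel_comp (rel_comp (ex_hom_rel U) (ex_hom_rel T))
        (rel_comp (rel_opp (ex_hom_rel T)) (rel_opp (ex_hom_rel U))) =
      rel_comp (ex_hom_rel U)
        (rel_comp (rel_comp (ex_hom_rel T) (rel_opp (ex_hom_rel T)))
          (rel_opp (ex_hom_rel U))).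
    by rewrite -!rel_compA.
  apply: sub_le_trans UZ; rewrite -[X in sub_le _ (rel_comp X _)]UY -(rel_compA _ (ex_rel Y)).
  by do 2![apply: rel_comp_le => //; try exact: sub_le_refl].
Qed.

Definition ex_comp X Y Z (U : ex_hom Y Z) (T : ex_hom X Y) : ex_hom X Z :=
  ExHom (is_ex_hom_comp U T).

Lemma ex_comp1c X Y (T : ex_hom X Y) : ex_comp (ex_id Y) T = T.
Proof. by apply: ex_hom_ext => /=; have [_ <-] := ex_homP T. Qed.

Lemma ex_compc1 X Y (T : ex_hom X Y) : ex_comp T (ex_id X) = T.
Proof. by apply: ex_hom_ext => /=; have [-> _] := ex_homP T. Qed.

Lemma ex_compA X Y Z W (V : ex_hom Z W) (U : ex_hom Y Z) (T : ex_hom X Y) :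
  ex_comp V (ex_comp U T) = ex_comp (ex_comp V U) T.
Proof. by apply: ex_hom_ext; exact: rel_compA. Qed.

Definition Ex : category := Category ex_comp1c ex_compc1 ex_compA.

Definition ex_embed (X : C) : Ex := ExObj (@equivalence_rel_diag C HC X).

End ExactCompletion.

Section Polish.
Local Open Scope classical_set_scope.
Local Open Scope ring_scope.

Definition separable (T : topologicalType) : Prop :=
  exists2 D : set T, countable D & dense D.

Definition is_metric (R : realType) (T : Type) (d : T -> T -> R) : Prop :=
  [/\ forall x, d x x = 0, forall x y, d x y = 0 -> x = y,
      forall x y, d x y = d y x & forall x y z, d x z <= d x y + d y z].

Definition metric_compatible (R : realType) (T : topologicalType)
    (d : T -> T -> R) : Prop :=
  forall (x : T) (A : set T),
    nbhs x A <-> exists2 e : R, 0 < e & [set y | d x y < e] `<=` A.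

Definition metric_complete (R : realType) (T : topologicalType)
    (d : T -> T -> R) : Prop :=
  forall u : nat -> T,
    (forall e : R, 0 < e -> exists N : nat, forall m n : nat,
       (N <= m)%N -> (N <= n)%N -> d (u m) (u n) < e) ->
    exists l : T, u @ \oo --> l.

Definition completely_metrizable (R : realType) (T : topologicalType) : Prop :=
  exists d : T -> T -> R,
    [/\ is_metric d, metric_compatible d & metric_complete d].

End Polish.

HB.mixin Record isPolish (R : realType) T of Topological T := {
  polish_separable : separable T;
  polish_completely_metrizable : completely_metrizable R T
}.

Local Open Scope classical_set_scope.
Local Open Scope group_scope.

HB.mixin Record isTopologicalGroup G of Group G & Topological G := {
  mulg_continuous : continuous (fun p : G * G => p.1 * p.2);
  invg_continuous : continuous (fun x : G => x^-1)
}.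

#[short(type="topologicalGroupType")]
HB.structure Definition TopologicalGroup :=
  {G of Group G & Topological G & isTopologicalGroup G}.

#[short(type="polishGroupType")]
HB.structure Definition PolishGroup (R : realType) :=
  {G of TopologicalGroup G & isPolish R G}.

Definition continuous_morphism (G H : topologicalGroupType) (f : G -> H) : Prop :=
  {morph f : x y / x * y} /\ continuous f.

Section PolishGroupCategory.
Variable R : realType.

Record polish_hom (G H : polishGroupType R) := PolishHom {
  polish_fun :> G -> H;
  polish_homP : continuous_morphism polish_fun
}.

Lemma polish_hom_ext G H (f g : polish_hom G H) : f =1 g -> f = g.
Proof.
move: f g => [f Pf] [g Pg] /= /funext E; move: Pg; rewrite -E => Pg.
by congr PolishHom; exact: Prop_irrelevance.
Qed.

Lemma polish_id_subproof (G : polishGroupType R) : continuous_morphism (@id G).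
Proof. by split=> // x; exact: cvg_id. Qed.

Definition polish_id G : polish_hom G G := PolishHom (polish_id_subproof G).

Lemma polish_comp_subproof G H K (g : polish_hom H K) (f : polish_hom G H) :
  continuous_morphism (g \o f).
Proof.
have [fM fc] := polish_homP f; have [gM gc] := polish_homP g.
split=> [x y|x]; first by rewrite /= fM gM.
by apply: continuous_comp; [exact: fc|exact: gc].
Qed.

Definition polish_comp G H K (g : polish_hom H K) (f : polish_hom G H) :
    polish_hom G K := PolishHom (polish_comp_subproof g f).

Lemma polish_comp1c G H (f : polish_hom G H) : polish_comp (polish_id H) f = f.
Proof. exact: polish_hom_ext. Qed.

Lemma polish_compc1 G H (f : polish_hom G H) : polish_comp f (polish_id G) = f.
Proof. exact: polish_hom_ext. Qed.

Lemma polish_compA G H K L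
    (h : polish_hom K L) (g : polish_hom H K) (f : polish_hom G H) :
  polish_comp h (polish_comp g f) = polish_comp (polish_comp h g) f.
Proof. exact: polish_hom_ext. Qed.

Definition PolGrp : category :=
  Category polish_comp1c polish_compc1 polish_compA.

End PolishGroupCategory.

Definition normal_subgroup (G : groupType) (N : set G) : Prop :=
  [/\ N 1, forall x y, N x -> N y -> N (x * y), forall x, N x -> N x^-1 &
      forall x g, N x -> N (x ^ g)].

(* [c] ranges over all Polish group structures on the subtype [set_type N], and
   has nothing to do with the subspace topology that is canonical there; the
   inclusion being a morphism says that the group law of [c] is the one of [G]. *)
Definition polish_subgroup (R : realType) (G : polishGroupType R) (N : set G) : Prop :=
  exists c : PolishGroup.axioms_ R (set_type N),
    @continuous_morphism (PolishGroup.Pack c) G set_val.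

Record polish_cover (R : realType) := PolishCover {
  cover_group :> polishGroupType R;
  cover_sub : set cover_group;
  cover_normal : normal_subgroup cover_sub;
  cover_polish : polish_subgroup cover_sub
}.

Section Quotient.
Variables (R : realType) (X : polish_cover R).
Local Notation N := (@cover_sub R X).

Definition lcoset (g : X) : set X := [set g * x | x in N].

Definition quotient : Type := set_type (range lcoset).

HB.instance Definition _ := Choice.on quotient.

Definition coset (g : X) : quotient := SigSub (mem_set (imageT lcoset g)).

Lemma lcosetP g h : lcoset g h <-> N (g^-1 * h).
Proof.
split=> [[x Nx <-]|Nx]; first by rewrite mulKg.
by exists (g^-1 * h) => //; rewrite mulVKg.
Qed.

Lemma lcoset_refl g : lcoset g g.
Proof. by apply/lcosetP; rewrite mulVg; case: (cover_normal X). Qed.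

Lemma cosetP g h : coset g = coset h <-> N (g^-1 * h).
Proof.
have [N1 NM NV _] := cover_normal X; split=> [E|gh].
  apply/lcosetP; have -> : lcoset g = lcoset h by exact: (congr1 val E).
  exact: lcoset_refl.
apply: val_inj => /=; apply/seteqP; split=> x /lcosetP Nx; apply/lcosetP.
  by have := NM _ _ (NV _ gh) Nx; rewrite invgM invgK mulgA mulgK.
by have := NM _ _ gh Nx; rewrite mulgA mulgK.
Qed.

Lemma coset_surj (A : quotient) : exists g, A = coset g.
Proof.
by case: A => A PA; have [g _ E] := set_mem PA; exists g; exact/val_inj/esym.
Qed.

Definition setM (A B : set X) : set X := [set a * b | a in A & b in B].
Definition setV (A : set X) : set X := [set a^-1 | a in A].

Lemma setM_lcoset g h : setM (lcoset g) (lcoset h) = lcoset (g * h).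
Proof.
have [N1 NM NV NJ] := cover_normal X; apply/seteqP; split=> [x|x].
  move=> [_ [a Na <-] [_ [b Nb <-] <-]]; apply/lcosetP.
  have := NM _ _ (NJ _ h Na) Nb.
  by rewrite conjgE invgM !mulgA mulgVK.
move=> [a Na <-]; exists g; first exact: lcoset_refl.
by exists (h * a); [exists a|rewrite mulgA].
Qed.

Lemma setV_lcoset g : setV (lcoset g) = lcoset g^-1.
Proof.
have [N1 NM NV NJ] := cover_normal X; apply/seteqP; split=> [x|x].
  move=> [_ [a Na <-] <-]; apply/lcosetP; rewrite invgK invgM.
  by have := NJ _ g^-1 (NV _ Na); rewrite conjgE invgK.
move=> [a Na <-]; exists (a^-1 * g); last by rewrite invgM invgK.
by apply/lcosetP; have := NJ _ g (NV _ Na); rewrite conjgE.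
Qed.

Lemma quotient_mul_subproof (A B : quotient) :
  setM (val A) (val B) \in range lcoset.
Proof.
have [g ->] := coset_surj A; have [h ->] := coset_surj B.
by rewrite /= setM_lcoset; exact/mem_set/imageT.
Qed.

Lemma quotient_inv_subproof (A : quotient) : setV (val A) \in range lcoset.
Proof.
by have [g ->] := coset_surj A; rewrite /= setV_lcoset; exact/mem_set/imageT.
Qed.

Definition quotient_mul (A B : quotient) : quotient :=
  SigSub (quotient_mul_subproof A B).
Definition quotient_inv (A : quotient) : quotient :=
  SigSub (quotient_inv_subproof A).

Lemma quotient_mulE g h : quotient_mul (coset g) (coset h) = coset (g * h).
Proof. by apply: val_inj; exact: setM_lcoset. Qed.

Lemma quotient_invE g : quotient_inv (coset g) = coset g^-1.
Proof. by apply: val_inj; exact: setV_lcoset. Qed.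

Lemma quotient_mulA : associative quotient_mul.
Proof.
move=> A B D; have [a ->] := coset_surj A; have [b ->] := coset_surj B.
by have [d ->] := coset_surj D; rewrite !quotient_mulE mulgA.
Qed.

Lemma quotient_mul1 : left_id (coset 1) quotient_mul.
Proof. by move=> A; have [a ->] := coset_surj A; rewrite quotient_mulE mul1g. Qed.

Lemma quotient_mulr1 : right_id (coset 1) quotient_mul.
Proof. by move=> A; have [a ->] := coset_surj A; rewrite quotient_mulE mulg1. Qed.

Lemma quotient_mulV : left_inverse (coset 1) quotient_inv quotient_mul.
Proof.
by move=> A; have [a ->] := coset_surj A; rewrite quotient_invE quotient_mulE mulVg.
Qed.

Lemma quotient_mulrV : right_inverse (coset 1) quotient_inv quotient_mul.
Proof.
by move=> A; have [a ->] := coset_surj A; rewrite quotient_invE quotient_mulE mulgV.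
Qed.

HB.instance Definition _ := isGroup.Build quotient
  quotient_mulA quotient_mul1 quotient_mulr1 quotient_mulV quotient_mulrV.

Lemma cosetM : {morph coset : g h / g * h}.
Proof. by move=> g h; rewrite -quotient_mulE. Qed.

End Quotient.

Definition borel_fun (G H : topologicalType) (f : G -> H) : Prop :=
  forall B : set H, <<s @open H >> B -> <<s @open G >> (f @^-1` B).

Section PolishCoverCategory.
Variable R : realType.
Implicit Types X Y Z : polish_cover R.

Definition is_lift X Y (f : quotient X -> quotient Y) (f' : X -> Y) : Prop :=
  forall g : X, f (coset g) = coset (f' g).

Definition borel_definable X Y (f : quotient X -> quotient Y) : Prop :=
  exists f' : X -> Y, is_lift f f' /\ borel_fun f'.

Record pc_hom X Y := PCHom {
  pc_fun :> quotient X -> quotient Y;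
  pc_homM : {morph pc_fun : x y / x * y};
  pc_hom_borel : borel_definable pc_fun
}.

Lemma pc_hom_ext X Y (f g : pc_hom X Y) : f =1 g -> f = g.
Proof.
move: f g => [f fM fB] [g gM gB] /= /funext E; move: gM gB; rewrite -E => gM gB.
by congr PCHom; exact: Prop_irrelevance.
Qed.

Lemma borel_definable_id X : borel_definable (@id (quotient X)).
Proof. by exists id; split. Qed.

Definition pc_id X : pc_hom X X :=
  PCHom (fun _ _ => erefl) (borel_definable_id X).

Lemma pc_comp_morph X Y Z (g : pc_hom Y Z) (f : pc_hom X Y) :
  {morph g \o f : x y / x * y}.
Proof. by move=> x y; rewrite /= !pc_homM. Qed.

Lemma pc_comp_borel X Y Z (g : pc_hom Y Z) (f : pc_hom X Y) :
  borel_definable (g \o f).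
Proof.
have [f' [ff' bf']] := pc_hom_borel f; have [g' [gg' bg']] := pc_hom_borel g.
exists (g' \o f'); split=> [x|B /bg'/bf']; last exact.
by rewrite /= ff' gg'.
Qed.

Definition pc_comp X Y Z (g : pc_hom Y Z) (f : pc_hom X Y) : pc_hom X Z :=
  PCHom (pc_comp_morph g f) (pc_comp_borel g f).

Lemma pc_comp1c X Y (f : pc_hom X Y) : pc_comp (pc_id Y) f = f.
Proof. exact: pc_hom_ext. Qed.

Lemma pc_compc1 X Y (f : pc_hom X Y) : pc_comp f (pc_id X) = f.
Proof. exact: pc_hom_ext. Qed.

Lemma pc_compA X Y Z W (h : pc_hom Z W) (g : pc_hom Y Z) (f : pc_hom X Y) :
  pc_comp h (pc_comp g f) = pc_comp (pc_comp h g) f.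
Proof. exact: pc_hom_ext. Qed.

Definition PC : category := Category pc_comp1c pc_compc1 pc_compA.

End PolishCoverCategory.

Section TrivialCover.
Variables (R : realType) (G : polishGroupType R).

Lemma trivial_normal : normal_subgroup [set 1 : G].
Proof.
split=> //= [x y -> ->|x ->|x g ->].
- by rewrite mulg1.
- by rewrite invg1.
- by rewrite conj1g.
Qed.

Definition trivial_sub : Type := set_type [set 1 : G].

HB.instance Definition _ := Topological.on trivial_sub.

Definition trivial_one : trivial_sub := SigSub (mem_set (erefl (1 : G))).

Lemma trivial_subE (x : trivial_sub) : x = trivial_one.
Proof. by apply: val_inj; case: x => x /= /set_mem. Qed.

Lemma trivial_sub_irr (x y : trivial_sub) : x = y.
Proof. by rewrite (trivial_subE x) (trivial_subE y). Qed.

HB.instance Definition _ := @isGroup.Build trivial_sub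
  trivial_one (fun x => x) (fun _ _ => trivial_one)
  (fun _ _ _ => erefl) (fun _ => trivial_sub_irr _ _) (fun _ => trivial_sub_irr _ _)
  (fun _ => erefl) (fun _ => erefl).

Lemma trivial_sub_continuous (T : topologicalType) (f : T -> trivial_sub) :
  continuous f.
Proof.
rewrite (_ : f = fun=> trivial_one); last by apply/funext => x; exact: trivial_sub_irr.
by move=> x; exact: cvg_cst.
Qed.

HB.instance Definition _ := isTopologicalGroup.Build trivial_sub
  (@trivial_sub_continuous _ _) (@trivial_sub_continuous _ _).

Lemma trivial_sub_nbhs (x : trivial_sub) (A : set trivial_sub) : nbhs x A -> A = setT.
Proof.
move=> /nbhs_singleton Ax; apply/seteqP; split=> // y _.
by rewrite (trivial_sub_irr y x).
Qed.

Lemma trivial_sub_separable : separable trivial_sub.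
Proof.
exists [set trivial_one]; first exact: countable1.
by move=> O [x Ox] _; exists x; split=> //=; exact: trivial_subE.
Qed.

Lemma trivial_sub_metrizable : completely_metrizable R trivial_sub.
Proof.
exists (fun _ _ => 0%R); split.
- by split=> // [x y _|x y z]; [exact: trivial_sub_irr|rewrite GRing.addr0].
- move=> x A; split=> [/trivial_sub_nbhs ->|[e e0 sA]].
    by exists 1%R => //; exact: Num.Theory.ltr01.
  have -> : A = setT by apply/seteqP; split=> // y _; exact: sA.
  exact: filterT.
- move=> u _; exists trivial_one.
  have -> : u = fun=> trivial_one by apply/funext => n; exact: trivial_subE.
  exact: cvg_cst.
Qed.

HB.instance Definition _ := isPolish.Build R trivial_sub
  trivial_sub_separable trivial_sub_metrizable.

Lemma trivial_polish : polish_subgroup [set 1 : G].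
Proof.
exists (PolishGroup.class (trivial_sub : polishGroupType R)); split.
  have val1 (x : trivial_sub) : set_val x = 1 :> G.
    by rewrite (trivial_subE x).
  by move=> x y; rewrite !val1 mulg1.
have -> : (set_val : trivial_sub -> G) = fun=> 1.
  by apply/funext => x; rewrite (trivial_subE x).
exact: cst_continuous.
Qed.

Definition trivial_cover : PC R := PolishCover trivial_normal trivial_polish.

End TrivialCover.

(* Main.v *)
(** Over the Polish groups every internal relation is determined by its set of
    points, because a homomorphism that becomes continuous after composition with an
    injective continuous one is itself continuous (Baire property of projections
    plus Pettis). An equivalence relation on [X] is then the coset relation of the
    normal Polish subgroup of the points related to 1, and a morphism of the exact
    completion is a homomorphism of the quotients; a Borel lift comes from a Borel
    section of an open surjection.

    Conversely, let [f : X/N -> Y/M] have a Borel lift [phi] and let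
    T = {(x, y) : f(xN) = yM}. As a set, T is X * M through
    (x, m) |-> (x, phi(x) m); for the product topology multiplication and division
    are continuous only on comeager sets, and left translations preserve meager
    sets. The sets of the t for which tA meets A in a nonmeager set, with A open,
    then form a subbase at 1 of a group topology on T. It is Polish because it has
    a comeager set of points in common with the product topology, so T is an
    internal relation inducing [f]. For [f] the identity it is the coset relation,
    which gives surjectivity on objects. *)

From HB Require Import structures.
From mathcomp Require Import all_boot all_order all_algebra.
From mathcomp Require Import all_classical reals topology measure.
From mathcomp Require Import lra.
Require Import Defs.

Set Implicit Arguments.
Unset Strict Implicit.
Unset Printing Implicit Defensive.

Import Order.TTheory GRing.Theory Num.Theory.
Local Open Scope classical_set_scope.

(** * Polish spaces without a metric *)

(** The obstacle is that the lift [phi] is neither a homomorphism nor continuous, so T need not be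
    closed in X * Y and inherits no Polish topology from it, while the product topology of X * M
    need not be a group topology on T. What saves the product topology is its meager sets: an
    element of T acts on X * M as a left translation of X and, on each fibre, as a left translation
    of M, so Kuratowski-Ulam reduces the invariance of meager sets to the groups X and M. The second
    difficulty is completeness of the new topology. A left-invariant metric of a Polish group need
    not be complete, so the metric is taken from the two-sided uniformity. The limit of a Cauchy
    sequence is then found inside the old Polish space, through a map that is continuous on a
    countable intersection of open sets and almost open there. The same argument supplies the Polish
    topology on the image of a homomorphism, hence the regularity of the category. *)

Section PolishSpaces.
Implicit Types T : topologicalType.

(** Empty members are allowed, which is why [b n !=set0] is asked for wherever it matters. *)
Definition base_seq T (b : nat -> set T) : Prop :=
  (forall n, open (b n)) /\
  forall (x : T) A, nbhs x A -> exists2 n, b n x & b n `<=` A.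

(** For a metric, [small k] says that all distances in the set are below 1/(k+1). The nested sets
    need not be closed, so the limit point only lies in their closures. *)
Definition nested_complete T (small : nat -> set T -> Prop) : Prop :=
  [/\ forall k (x : T) A, nbhs x A -> exists B, [/\ nbhs x B, B `<=` A & small k B],
      forall k A B, A `<=` B -> small k B -> small k A &
      forall B : nat -> set T, (forall k, B k.+1 `<=` B k) ->
        (forall k, B k !=set0) -> (forall k, small k (B k)) ->
        exists e : T, forall P, nbhs e P -> exists k, B k `<=` P].

Definition shrink_nbhs T : Prop := forall (x : T) A, nbhs x A ->
  exists B, [/\ open B, B x & closure B `<=` A].

(* Everything below uses completeness only through nested sequences of small
   sets, which frees it from the choice of a metric. *)
Definition polish_space T : Prop :=
  [/\ hausdorff_space T, shrink_nbhs T, exists b : nat -> set T, base_seq b &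
      exists small : nat -> set T -> Prop, nested_complete small].

Lemma base_seq_separable T (b : nat -> set T) : base_seq b -> separable T.
Proof.
move=> [bo bP].
exists [set x | exists n, exists h : exists x, b n x, x = sval (cid h)].
  pose g n : option T :=
    if pselect (exists x, b n x) is left h then Some (sval (cid h)) else None.
  apply: (@sub_countable _ _ _ (\bigcup_n [set x | g n = Some x])).
    apply: subset_card_le => x [n [h ->]]; exists n => //=; rewrite /g.
    case: pselect => // h'; by rewrite (Prop_irrelevance h h').
  apply: bigcup_countable => // n _; case: (g n) => [y|].
    apply: (@sub_countable _ _ _ [set y]); last exact: countable1.
    by apply: subset_card_le => x /= [->].
  by apply: (@sub_countable _ _ _ set0); [apply: subset_card_le => x /=|exact: countable0].
move=> O [x Ox] oO; have [n bx bO] := bP x O (open_nbhs_nbhs (conj oO Ox)).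
have h : exists x, b n x by exists x.
exists (sval (cid h)); split; last by exists n, h.
by apply: bO; case: cid.
Qed.

Section Metric.
Local Open Scope ring_scope.
Variables (R : realType) (T : topologicalType) (d : T -> T -> R).
Hypotheses (dm : is_metric d) (dc : metric_compatible d).

Let dxx x : d x x = 0. Proof. by case: dm. Qed.
Let dC x y : d x y = d y x. Proof. by case: dm. Qed.
Let dT x y z : d x z <= d x y + d y z. Proof. by case: dm. Qed.

Lemma metric_ge0 x y : 0 <= d x y.
Proof. by have := dT x y x; rewrite dxx (dC y x); lra. Qed.

Lemma metric_ball_open x (e : R) : open [set y | d x y < e].
Proof.
rewrite openE => y /= xy; apply/dc; exists (e - d x y); first by rewrite subr_gt0.
by move=> z /= yz; have := dT x y z; lra.
Qed.

Lemma metric_ball_nbhs x (e : R) : 0 < e -> nbhs x [set y | d x y < e].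
Proof. by move=> e0; apply/dc; exists e. Qed.

Lemma metric_closed_ball x (e e' : R) : e < e' ->
  closure [set y | d x y < e] `<=` [set y | d x y < e'].
Proof.
move=> ee y /(_ _ (metric_ball_nbhs y (e := e' - e) _))[|z [/= xz yz]].
  by rewrite subr_gt0.
by have := dT x z y; rewrite (dC z y); lra.
Qed.

Lemma metric_hausdorff : hausdorff_space T.
Proof.
move=> x y xy; have [_ /(_ x y) d0 _ _] := dm; apply: d0; apply/eqP/negPn/negP => dxy.
have d0 : 0 < d x y by rewrite lt_neqAle eq_sym dxy metric_ge0.
have [||z [/= xz yz]] := xy [set z | d x z < d x y / 2] [set z | d y z < d x y / 2].
- by apply: metric_ball_nbhs; lra.
- by apply: metric_ball_nbhs; lra.
by have := dT x z y; rewrite (dC z y); lra.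
Qed.

Lemma metric_shrink : shrink_nbhs T.
Proof.
move=> x A /dc[e e0 eA]; exists [set y | d x y < e / 2]; split => /=.
- exact: metric_ball_open.
- by rewrite dxx; lra.
- by apply: subset_trans eA; apply: metric_closed_ball; lra.
Qed.

Lemma inv_small (e : R) : 0 < e -> exists k : nat, k.+1%:R^-1 < e.
Proof.
move=> e0; exists (Num.truncn e^-1).
rewrite -[ltRHS]invrK ltf_pV2 ?posrE ?invr_gt0 ?ltr0n//.
by apply: Num.Theory.truncnS_gt.
Qed.

Lemma metric_base_seq : separable T -> exists b : nat -> set T, base_seq b.
Proof.
move=> [D /countable_injP[f fi] dD].
(* Since [f] is injective on [D], this is the ball of radius 1/(k+1) around the point of [D] with
   code [i], or empty if [i] is no code. *)
pose b0 i k : set T := [set y | exists x, [/\ D x, f x = i & d x y < k.+1%:R^-1]].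
pose b n := if @unpickle (nat * nat)%type n is Some (i, k) then b0 i k else set0.
exists b; split=> [n|x A /dc[e e0 eA]].
  rewrite /b; case: unpickle => [[i k]|]; last exact: open0.
  rewrite openE => y [x [Dx xi xy]]; have := @metric_ball_open x k.+1%:R^-1.
  rewrite openE => /(_ y xy); rewrite /interior; apply: filterS => z /= xz.
  by exists x.
have [|k ke] := @inv_small (e / 2); first lra.
have k0 : 0 < k.+1%:R^-1 :> R by rewrite invr_gt0 ltr0n.
have [|y [/= xy Dy]] := dD [set y | d x y < k.+1%:R^-1] _ (metric_ball_open _ _).
  by exists x => /=; rewrite dxx.
exists (pickle (f y, k)); rewrite /b pickleK /=.
  by exists y; rewrite dC.
move=> z [y' [Dy' ff yz]]; have E := fi _ _ (mem_set Dy') (mem_set Dy) ff.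
apply: eA => /=; rewrite E in yz; have := dT x y z.
by move: (k.+1%:R^-1) yz xy ke => r; lra.
Qed.

Lemma metric_nested : metric_complete d ->
  nested_complete (fun k A => forall x y, A x -> A y -> d x y < k.+1%:R^-1).
Proof.
move=> comp; split=> [k x A nA|k A B AB sB x y /AB Bx /AB By|B dB nB sB]; last 2 first.
- exact: sB.
- have mB k n : (k <= n)%N -> B n `<=` B k.
    move=> /subnK <-; elim: (n - k)%N => [//|i IH].
    by apply: subset_trans IH; rewrite addSn; exact: dB.
  pose u k := sval (cid (nB k)); have uB k : B k (u k) by rewrite /u; case: cid.
  have [|e ue] := comp u.
    move=> e /inv_small[k ke]; exists k => m n km kn.
    by apply: lt_trans ke; apply: sB; [apply: mB (uB m)|apply: mB (uB n)].
  exists e => P /dc[r r0 rP]; have [|k kr] := @inv_small (r / 2); first lra.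
  have [|N _ Nu] := ue _ (@metric_ball_nbhs e (r / 2) _); first lra.
  exists k => y By; apply: rP => /=.
  have := Nu (maxn N k) (leq_maxl _ _) => /=.
  have := sB k (u (maxn N k)) y (mB _ _ (leq_maxr _ _) _ (uB _)) By.
  by have := dT e (u (maxn N k)) y; move: (k.+1%:R^-1) kr => q; lra.
exists (A `&` [set y | d x y < k.+1%:R^-1 / 2]); split; first 2 last.
- move=> y z [_ /= xy] [_ /= xz].
  by have := dT y x z; rewrite (dC y x); move: (k.+1%:R^-1) xy xz => q; lra.
- apply: filterI => //; apply: metric_ball_nbhs.
  by rewrite divr_gt0// ?invr_gt0 ltr0n.
- by move=> y [].
Qed.

End Metric.

Lemma polish_spaceP (R : realType) T : separable T -> completely_metrizable R T ->
  polish_space T.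
Proof.
move=> sT [d [dm dcp dco]]; split.
- exact: metric_hausdorff dm dcp.
- exact: metric_shrink dm dcp.
- exact: metric_base_seq dm dcp sT.
- by eexists; exact: metric_nested dm dcp dco.
Qed.

Lemma hausdorff_separate T : hausdorff_space T -> forall x y : T, x <> y ->
  exists A B, [/\ open A, open B, A x, B y & A `&` B = set0].
Proof.
move=> hT x y /eqP xy; move: hT; rewrite open_hausdorff => /(_ x y xy).
by move=> [[A B] /= [/set_mem Ax /set_mem By] [oA oB /eqP AB]]; exists A, B.
Qed.

End PolishSpaces.

Lemma open_setX (T U : topologicalType) (A : set T) (B : set U) :
  open A -> open B -> open (A `*` B).
Proof.
move=> oA oB; rewrite openE => -[x y] [/= Ax By].
by exists (A, B) => //; split; exact: open_nbhs_nbhs.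
Qed.

Section PolishProduct.
Variables (T U : topologicalType).

(** Smallness of a subset of the product is tested on its two projections; the limits found there
    are the coordinates of the limit. *)
Lemma polish_space_prod : polish_space T -> polish_space U ->
  polish_space (T * U)%type.
Proof.
move=> [hT rT [b [bo bP]] [s [s1 s2 s3]]] [hU rU [b' [bo' bP']] [s' [s1' s2' s3']]].
split.
- move=> [x y] [x' y'] xy; congr pair.
    apply: hT => A B nA nB.
    have [||[u v] [/= [Au _] [Bu _]]] := xy (A `*` setT) (B `*` setT).
    - by exists (A, setT) => //; split => //; exact: filterT.
    - by exists (B, setT) => //; split => //; exact: filterT.
    by exists u.
  apply: hU => A B nA nB.
  have [||[u v] [/= [_ Au] [_ Bu]]] := xy (setT `*` A) (setT `*` B).
  - by exists (setT, A) => //; split => //; exact: filterT.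
  - by exists (setT, B) => //; split => //; exact: filterT.
  by exists v.
- move=> [x y] A [[A1 A2] [/= n1 n2] sA].
  have [B1 [o1 B1x c1]] := rT _ _ n1; have [B2 [o2 B2y c2]] := rU _ _ n2.
  exists (B1 `*` B2); split => //; first exact: open_setX.
  move=> [u v] cl; apply: sA; split => /=.
    apply: c1 => P nP; have [|[z w] [/= [? ?] [? ?]]] := cl (P `*` setT).
      by exists (P, setT) => //; split => //; exact: filterT.
    by exists z.
  apply: c2 => P nP; have [|[z w] [/= [? ?] [? ?]]] := cl (setT `*` P).
    by exists (setT, P) => //; split => //; exact: filterT.
  by exists w.
- exists (fun n => if @unpickle (nat * nat)%type n is Some (i, j)
                   then b i `*` b' j else set0).
  split=> [n|[x y] A [[A1 A2] [/= n1 n2] sA]].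
    by case: unpickle => [[i j]|]; [apply: open_setX|exact: open0].
  have [i bx bA] := bP _ _ n1; have [j by_ bA'] := bP' _ _ n2.
  exists (pickle (i, j)); rewrite pickleK//.
  by move=> [u v] [/= /bA ? /bA' ?]; exact: sA.
- exists (fun k A => s k (fst @` A) /\ s' k (snd @` A)); split.
  + move=> k [x y] A [[A1 A2] [/= n1 n2] sA].
    have [B1 [nB1 BA1 sB1]] := s1 k _ _ n1; have [B2 [nB2 BA2 sB2]] := s1' k _ _ n2.
    exists (B1 `*` B2); split.
    * by exists (B1, B2).
    * by move=> [u v] [/= /BA1 ? /BA2 ?]; exact: sA.
    * split; [apply: s2 sB1 => _ [[u v] [? ?] <-]|apply: s2' sB2 => _ [[u v] [? ?] <-]];
        exact.
  + move=> k A B AB [s1B s2B].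
    by split; [apply: s2 s1B|apply: s2' s2B]; exact: image_subset.
  + move=> B dB nB sB.
    have [||| e1 P1] := s3 (fun k => fst @` B k).
    * by move=> k; exact: image_subset.
    * by move=> k; have [z Bz] := nB k; exists z.1, z.
    * by move=> k; case: (sB k).
    have [||| e2 P2] := s3' (fun k => snd @` B k).
    * by move=> k; exact: image_subset.
    * by move=> k; have [z Bz] := nB k; exists z.2, z.
    * by move=> k; case: (sB k).
    have mB k n : (k <= n)%N -> B n `<=` B k.
      move=> /subnK <-; elim: (n - k)%N => [//|i IH].
      by apply: subset_trans IH; rewrite addSn; exact: dB.
    exists (e1, e2) => P [[A1 A2] [/= /P1[k1 k1P] /P2[k2 k2P]] sP].
    exists (maxn k1 k2) => -[u v] Buv; apply: sP; split => /=.
      by apply: k1P; exists (u, v) => //; exact: mB (leq_maxl _ _) _ Buv.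
    by apply: k2P; exists (u, v) => //; exact: mB (leq_maxr _ _) _ Buv.
Qed.

End PolishProduct.

Lemma set0F (T : Type) (A : set T) x : A = set0 -> A x -> False.
Proof. by move=> ->. Qed.

(** * Baire category *)

Section Category.
Implicit Types T U : topologicalType.

Definition no_interior T (A : set T) := forall O, open O -> O `<=` A -> O = set0.

Definition meager T (A : set T) := exists F : nat -> set T,
  [/\ forall n, closed (F n), forall n, no_interior (F n) & A `<=` \bigcup_n F n].

Lemma meagerS T (A B : set T) : A `<=` B -> meager B -> meager A.
Proof. by move=> AB [F [cF nF BF]]; exists F; split=> //; exact: subset_trans BF. Qed.

Lemma meager_closed T (A : set T) : closed A -> no_interior A -> meager A.
Proof. by move=> cA nA; exists (fun=> A); split=> // x Ax; exists 0%N. Qed.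

Lemma meager0 T : meager (set0 : set T).
Proof. by apply: meager_closed; [exact: closed0|move=> O _; rewrite subset0]. Qed.

Lemma meager_bigcup T (A : nat -> set T) : (forall n, meager (A n)) ->
  meager (\bigcup_n A n).
Proof.
move=> /choice[F FP].
exists (fun n => if @unpickle (nat * nat)%type n is Some (i, j) then F i j else set0).
split=> [n|n|x [i _ Ax]].
- by case: unpickle => [[i j]|]; [case: (FP i)|exact: closed0].
- by case: unpickle => [[i j]|]; [case: (FP i)|move=> O _; rewrite subset0].
have [_ _ /(_ x Ax)[j _ Fx]] := FP i.
by exists (pickle (i, j)) => //; rewrite pickleK.
Qed.

Lemma meagerU T (A B : set T) : meager A -> meager B -> meager (A `|` B).
Proof.
move=> mA mB; apply: (@meagerS _ _ (\bigcup_n (if n is 0%N then A else B))).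
  by move=> x [Ax|Bx]; [exists 0%N|exists 1%N].
by apply: meager_bigcup => -[|n].
Qed.

Definition baire T := forall O : set T, open O -> meager O -> O = set0.

(** Inclusion up to a meager set; the Baire property below is a pair of such inclusions. *)
Definition msub T (A B : set T) := meager (A `\` B).

Lemma sub_msub T (A B : set T) : A `<=` B -> msub A B.
Proof. by move=> AB; apply: meagerS (@meager0 T) => x [/AB]. Qed.

Lemma msub_trans T (B A C : set T) : msub A B -> msub B C -> msub A C.
Proof.
move=> AB BC; apply: meagerS (meagerU AB BC) => x [Ax Cx].
by have [Bx|Bx] := pselect (B x); [right|left].
Qed.

Lemma msub_meager T (A B : set T) : msub A B -> meager B -> meager A.
Proof.
move=> AB mB; apply: meagerS (meagerU AB mB) => x Ax.
by have [Bx|Bx] := pselect (B x); [right|left].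
Qed.

Lemma msub_bigcup T (A B : nat -> set T) : (forall n, msub (A n) (B n)) ->
  msub (\bigcup_n A n) (\bigcup_n B n).
Proof.
move=> AB; apply: meagerS (meager_bigcup AB) => x [[n _ Ax] nB].
by exists n => //; split=> // Bx; apply: nB; exists n.
Qed.

Definition bp T (A : set T) := exists O, [/\ open O, msub A O & msub O A].

Lemma bp_open T (A : set T) : open A -> bp A.
Proof. by move=> oA; exists A; split=> //; exact: sub_msub. Qed.

Lemma bp_meager T (A : set T) : meager A -> bp A.
Proof.
move=> mA; exists set0; split; first exact: open0.
  by apply: meagerS mA => x [].
exact: sub_msub.
Qed.

Lemma bp_msub T (A B : set T) : bp A -> msub A B -> msub B A -> bp B.
Proof.
move=> [O [oO AO OA]] AB BA; exists O; split=> //.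
  exact: msub_trans BA AO.
exact: msub_trans OA AB.
Qed.

Lemma bp_bigcup T (A : nat -> set T) : (forall n, bp (A n)) -> bp (\bigcup_n A n).
Proof.
move=> /choice[O OP]; exists (\bigcup_n O n); split.
- by apply: bigcup_open => n _; case: (OP n).
- by apply: msub_bigcup => n; case: (OP n).
- by apply: msub_bigcup => n; case: (OP n).
Qed.

(** The complement of an open [O] and its interior differ by the boundary of [O], which is closed
    without interior. *)
Lemma bp_setC T (A : set T) : bp A -> bp (~` A).
Proof.
move=> [O [oO AO OA]]; exists ((~` O)°); split; first exact: open_interior.
  apply: (@msub_trans _ (~` O)).
    by apply: meagerS OA => x [nA /contrapT].
  apply: meager_closed => [|V oV sV].
    rewrite (_ : _ `\` _ = ~` (O `|` (~` O)°)); last first.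
      by rewrite setCU.
    by apply: open_closedC; apply: openU => //; exact: open_interior.
  apply/seteqP; split=> // x Vx; have [_] := sV x Vx; apply.
  have := open_nbhs_nbhs (conj oV Vx); apply: filterS => y /sV[].
  by [].
apply: meagerS AO => x [/interior_subset nO nA]; split=> //; exact: contrapT.
Qed.

Lemma bp_borel T (A : set T) : <<s @open T >> A -> bp A.
Proof.
move=> /(_ [set A | bp A]); apply; split; last exact: bp_open.
split=> [|B bB|B bB]; first by apply: bp_meager; exact: meager0.
  by rewrite setTD; exact: bp_setC.
exact: bp_bigcup.
Qed.

Lemma bp_nonmeager T (A : set T) : bp A -> ~ meager A ->
  exists O, [/\ open O, O !=set0 & msub O A].
Proof.
move=> [O [oO AO OA]] nA; exists O; split=> //.
apply/set0P/negP => /eqP O0; apply: nA; apply: msub_meager AO _.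
by rewrite O0; exact: meager0.
Qed.

Lemma nonmeager_ex T (A B : set T) : ~ meager A -> meager B -> exists2 x, A x & ~ B x.
Proof.
move=> nA mB; apply: contrapT => h; apply: nA; apply: meagerS mB => x Ax.
by apply: contrapT => nB; apply: h; exists x.
Qed.

Definition cont_on T U (D : set T) (f : T -> U) :=
  forall x, D x -> f @ within D (nbhs x) --> f x.

Lemma cont_onS T U (D D' : set T) (f : T -> U) :
  D' `<=` D -> cont_on D f -> cont_on D' f.
Proof.
move=> DD' cf x D'x; apply: cvg_trans (cf x (DD' _ D'x)).
by apply: cvg_app; apply: within_subset => //; exact: nbhs_filter.
Qed.

Lemma continuous_cont_on T U (D : set T) (f : T -> U) : continuous f -> cont_on D f.
Proof. by move=> cf x _; apply: cvg_within_filter; exact: cf. Qed.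

(** Over a target with a countable base this amounts to Baire measurability, by [bp_cat_cont] and
    [cat_cont_bp]. *)
Definition cat_cont T U (f : T -> U) := exists2 D, meager (~` D) & cont_on D f.

Lemma continuous_cat_cont T U (f : T -> U) : continuous f -> cat_cont f.
Proof.
by move=> cf; exists setT; [rewrite setCT; exact: meager0|exact: continuous_cont_on].
Qed.

Lemma bp_cat_cont T U (b : nat -> set U) (f : T -> U) : base_seq b ->
  (forall n, bp (f @^-1` b n)) -> cat_cont f.
Proof.
move=> [bo bP] /choice[O OP].
exists (~` \bigcup_n ((f @^-1` b n `\` O n) `|` (O n `\` f @^-1` b n))).
  by rewrite setCK; apply: meager_bigcup => n; have [_ ? ?] := OP n; exact: meagerU.
move=> x Dx A /bP[n bx bA]; have [oO _ _] := OP n.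
have Ox : O n x by apply: contrapT => nO; apply: Dx; exists n => //; left.
have := open_nbhs_nbhs (conj oO Ox); apply: filterS => y Oy Dy; apply: bA.
by apply: contrapT => nb; apply: Dy; exists n => //; right.
Qed.

Lemma cat_cont_bp T U (f : T -> U) (A : set U) : cat_cont f -> open A -> bp (f @^-1` A).
Proof.
(* Continuity along [D] puts each point of [D] with image in [A] into this interior. *)
move=> [D mD cf] oA; exists ([set x | D x -> A (f x)]°); split.
- exact: open_interior.
- apply: meagerS mD => x [/= fA nO] Dx; apply: nO.
  by have := cf x Dx A (open_nbhs_nbhs (conj oA fA)).
- by apply: meagerS mD => x [/interior_subset/= h nA] Dx; apply: nA; exact: h.
Qed.

Lemma cat_cont_pair T U (V : topologicalType) (f : T -> U) (g : T -> V) :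
  cat_cont f -> cat_cont g -> cat_cont (fun x => (f x, g x)).
Proof.
move=> [D mD cf] [E mE cg]; exists (D `&` E); first by rewrite setCI; exact: meagerU.
move=> x [Dx Ex]; apply: cvg_pair.
  by apply: (@cont_onS _ _ D) => // y [].
by apply: (@cont_onS _ _ E) => // y [].
Qed.

Lemma cat_cont_comp T U (V : topologicalType) (g : U -> V) (f : T -> U) :
  continuous g -> cat_cont f -> cat_cont (g \o f).
Proof.
move=> cg [D mD cf]; exists D => // x Dx.
by apply: continuous_cvg; [exact: cg|exact: cf].
Qed.

Definition open_map T U (f : T -> U) := forall O, open O -> open (f @` O).

Lemma meager_open_preimage T U (f : T -> U) (A : set U) :
  continuous f -> open_map f -> meager A -> meager (f @^-1` A).
Proof.
move=> cf of_ [F [cF nF AF]]; exists (fun n => f @^-1` F n); split=> [n|n O oO sO|x].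
- exact: closed_comp.
- have E : f @` O = set0 by apply: (nF n); [exact: of_|move=> _ [x Ox <-]; exact: sO].
  by apply/seteqP; split=> // x Ox; have : (f @` O) (f x); [by exists x|rewrite E].
- by move=> /AF[n _ Fx]; exists n.
Qed.

Lemma cat_cont_precomp T U (V : topologicalType) (g : U -> V) (f : T -> U) :
  cat_cont g -> continuous f -> open_map f -> cat_cont (g \o f).
Proof.
move=> [D mD cg] cf of_; exists (f @^-1` D).
  by rewrite preimage_setC; exact: meager_open_preimage.
move=> x Dx A /(cg _ Dx) /cf.
by [].
Qed.

(** A countable base leaves only countably many meager pieces [b n]&[A] to collect. *)
Lemma meager_local T (b : nat -> set T) (A : set T) : base_seq b ->
  meager (A `&` [set x | exists2 P, nbhs x P & meager (P `&` A)]).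
Proof.
move=> [bo bP]; pose D := [set n | meager (b n `&` A)].
apply: (@meagerS _ _ (\bigcup_(n in D) (b n `&` A))).
  move=> x [Ax [P /bP[n bx bPn] mP]]; exists n => //=.
  by apply: meagerS mP => y [/bPn].
rewrite bigcup_mkcond; apply: meager_bigcup => n.
by case: ifPn => [/set_mem//|_]; exact: meager0.
Qed.

(** If the section at [x] of a closed [F n] has interior, it contains a nonempty [b k]. For fixed
    [n] and [k] these [x] form the closed set [E n k], and an open [O] inside it would put the box
    [O * b k] inside [F n]. *)
Lemma kuratowski_ulam T U (b : nat -> set U) (A : set (T * U)) : base_seq b ->
  meager A -> meager [set x | ~ meager [set y | A (x, y)]].
Proof.
move=> [bo bP] [F [cF nF AF]].
pose E n k := [set x | b k !=set0 /\ forall y, b k y -> F n (x, y)].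
apply: (@meagerS _ _ (\bigcup_n \bigcup_k E n k)).
  move=> x /= nm; apply: contrapT => h; apply: nm.
  exists (fun n => [set y | F n (x, y)]); split=> [n|n O oO sO|y /AF//].
    move=> y cy; apply: cF => P [[P1 P2] [/= n1 n2] sP].
    have [z [Fz Pz]] := cy _ n2; exists (x, z); split=> //.
    by apply: sP; split=> //=; exact: nbhs_singleton.
  apply/seteqP; split=> // y Oy; have [k bky bO] := bP _ _ (open_nbhs_nbhs (conj oO Oy)).
  by apply: h; exists n => //; exists k => //; split; [exists y|move=> z /bO/sO].
apply: meager_bigcup => n; apply: meager_bigcup => k; apply: meager_closed.
  move=> x cx; split; first by have [|z [[b0 _] _]] := cx setT; first exact: filterT.
  move=> y by_; apply: cF => P [[P1 P2] [/= n1 n2] sP].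
  have [z [[_ Ez] Pz]] := cx _ n1; exists (z, y); split; first exact: Ez.
  by apply: sP; split => //=; exact: nbhs_singleton.
move=> O oO sO; apply/seteqP; split=> // x Ox.
have [[y by_] _] := sO x Ox.
have : O `*` b k = set0.
  apply: (nF n); first exact: open_setX.
  by move=> [x' y'] [/= /sO[_ Ex'] /Ex'].
by move=> /(set0F (x := (x, y))); case.
Qed.

(** A nonmeager [A] with the Baire property fills some box up to a meager set. By the direct
    statement, some section in that box is both meager and comeager in the second side, against the
    Baire property of [U]. *)
Lemma kuratowski_ulam_conv T U (b : nat -> set U) (A : set (T * U)) : base_seq b ->
  baire T -> baire U -> bp A -> meager [set x | ~ meager [set y | A (x, y)]] -> meager A.
Proof.
move=> bb bT bU bA mA; apply: contrapT => /(bp_nonmeager bA)[O [oO [[x y] Oxy] OA]].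
move: oO; rewrite openE => /(_ _ Oxy)[[P Q] [/= nP nQ] sPQ].
have P0 : ~ meager P°.
  by move=> /(bT _ (@open_interior _ _))/(set0F (x := x)); exact.
have := nonmeager_ex P0 (meagerU mA (kuratowski_ulam bb OA)).
move=> [z /interior_subset Pz /not_orP[/contrapT m1 /contrapT m2]].
have /(bU _ (@open_interior _ _))/(set0F (x := y)) : meager Q°.
  apply: meagerS (meagerU m1 m2) => w /interior_subset Qw.
  have [Aw|Aw] := pselect (A (z, w)); [by left|right]; split=> //.
  exact: sPQ.
by apply; exact: nQ.
Qed.

End Category.

Lemma dependent_choice_nat (S : Type) (P : S -> Prop) (Q : nat -> S -> S -> Prop) s0 :
  P s0 -> (forall k s, P s -> exists2 s', P s' & Q k s s') ->
  exists u : nat -> S, u 0%N = s0 /\ forall k, P (u k) /\ Q k (u k) (u k.+1).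
Proof.
move=> Ps0 step.
have /choice[f fP] : forall ks : nat * S, exists s', P ks.2 -> P s' /\ Q ks.1 ks.2 s'.
  move=> [k s]; have [Ps|nPs] := pselect (P s); last by exists s.
  by have [s' ? ?] := step k s Ps; exists s'.
pose u := fix u k := if k is k'.+1 then f (k', u k') else s0.
have Pu k : P (u k) by elim: k => //= k /(fP (k, _))[].
by exists u; split=> // k; split=> //; have [] := fP (k, u k) (Pu k).
Qed.

Section Nested.
Variables (T : topologicalType) (small : nat -> set T -> Prop).
Hypothesis sm : nested_complete small.

(** The closure condition brings the limit back into every [B k]. Smallness is asked from [B 1] on,
    so that [B 0] can be an arbitrary starting set. *)
Lemma nested_limit (B : nat -> set T) : (forall k, closure (B k.+1) `<=` B k) ->
  (forall k, B k !=set0) -> (forall k, small k (B k.+1)) ->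
  exists e, (forall k, B k e) /\ forall P, nbhs e P -> exists k, B k `<=` P.
Proof.
move=> cB nB sB; have [_ _ lim] := sm.
have dB k : B k.+1 `<=` B k by exact: subset_trans (@subset_closure _ _) (cB k).
have [//|//|//|e eP] := lim (fun k => B k.+1).
exists e; split=> [k|P /eP[k kP]]; last by exists k.+1.
apply: cB => P /eP[j jP].
have mB m n : (m <= n)%N -> B n `<=` B m.
  move=> /subnK <-; elim: (n - m)%N => [//|i IH].
  by apply: subset_trans IH; rewrite addSn; exact: dB.
have [x Bx] := nB (maxn k j).+1; exists x; split.
  by apply: mB _ Bx; rewrite ltnS leq_maxl.
by apply: jP; apply: mB _ Bx; rewrite ltnS leq_maxr.
Qed.

Lemma nested_refine (b : nat -> set T) : shrink_nbhs T -> base_seq b ->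
  forall k A x, nbhs x A -> exists j, [/\ b j x, small k (b j) & closure (b j) `<=` A].
Proof.
move=> sh [bo bP] k A x nA; have [s1 s2 _] := sm.
have [B [oB Bx BA]] := sh _ _ nA.
have [B' [nB' BB' sB']] := s1 k x B (open_nbhs_nbhs (conj oB Bx)).
have [j bx bB] := bP _ _ nB'; exists j; split=> //; first exact: s2 sB'.
by apply: subset_trans BA; apply: closureS; exact: subset_trans BB'.
Qed.

End Nested.

Lemma polish_baire (T : topologicalType) : polish_space T -> baire T.
Proof.
move=> [_ sh [b bb] [small sm]] O oO [F [cF nF OF]].
apply: contrapT => /eqP/set0P[x0 Ox0].
have [] := @dependent_choice_nat (set T) (fun B => open B /\ B !=set0)
  (fun k B B' => [/\ closure B' `<=` B, small k B' & B' `<=` ~` F k]) O.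
- by split=> //; exists x0.
- move=> k B [oB [x Bx]].
  have [y [By nFy]] : exists y, B y /\ ~ F k y.
    apply: contrapT => h; apply: (@set0F _ B x) => //; apply: (nF k) => // z Bz.
    by apply: contrapT => nFz; apply: h; exists z.
  have nB : nbhs y (B `&` ~` F k).
    apply: open_nbhs_nbhs; split=> //; apply: openI => //; exact: closed_openC.
  have [j [bjy sj cj]] := nested_refine sm sh bb k nB.
  exists (b j); first by split; [case: bb|exists y].
  split=> //; first by move=> z /cj[].
  by move=> z /(@subset_closure _ (b j))/cj[].
move=> B [B0 BP].
have [|||e [eB _]] := nested_limit sm (B := B).
- by move=> k; have [_ []] := BP k.
- by move=> k; have [[]] := BP k.
- by move=> k; have [_ []] := BP k.
have [n _ Fe] : (\bigcup_n F n) e by apply: OF; rewrite -B0.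
by have [_ [_ _ /(_ e (eB _))]] := BP n; exact.
Qed.

(** * The Baire property of projections *)

Section SouslinScheme.
Variables (Z M : topologicalType) (bZ : nat -> set Z) (G : Z -> M -> Prop) (D : set Z).
Hypotheses (bbZ : base_seq bZ) (pM : polish_space M) (mD : meager (~` D)).
(** The relation is closed over the comeager set [D] only: this is what the graph of a function
    satisfies when it is continuous on [D]. *)
Hypothesis closedG : forall z m, D z ->
  (forall P Q, nbhs z P -> nbhs m Q -> exists z' m', [/\ D z', P z', Q m' & G z' m']) ->
  G z m.

Definition proj_rel (V : set M) : set Z := [set z | exists2 m, V m & G z m].

(** A closed envelope of [A]: it contains [A] up to a meager set, and by [fat_cover] it respects
    countable covers up to a meager set. *)
Definition fat (A : set Z) : set Z := [set z | forall P, nbhs z P -> ~ meager (P `&` A)].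

Let fat_closed A : closed (fat A).
Proof.
move=> z cz P /nbhs_interior nP mP; have [w [fw Pw]] := cz _ nP.
exact: fw Pw mP.
Qed.

Let sub_fat A : msub A (fat A).
Proof.
apply: meagerS (meager_local A bbZ) => z [Az nf]; split=> //.
by apply: contrapT => h; apply: nf => P nP mP; apply: h; exists P.
Qed.

(** The set [fat A]\[K] has the Baire property, so up to a meager set it is an open [O]. As [A] lies
    in [K] up to a meager set, [A] is meager in [O], and [O] contains no point of [fat A]. *)
Let fat_cover (A : set Z) (C : nat -> set Z) :
  A `<=` \bigcup_j C j -> msub (fat A) (\bigcup_j fat (C j)).
Proof.
move=> AC; set K := \bigcup_j _.
have mAK : msub A K.
  by apply: msub_trans (sub_msub AC) _; apply: msub_bigcup => j; exact: sub_fat.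
have [O [oO KO OK]] : bp (fat A `\` K).
  rewrite setDE -[X in bp X]setCK; apply: bp_setC; rewrite setCI setCK.
  rewrite -bigcup2E; apply: bp_bigcup => -[|[|n]] /=.
  - by apply: bp_open; exact: closed_openC.
  - apply: bp_bigcup => j; rewrite -[fat _]setCK; apply: bp_setC.
    by apply: bp_open; exact: closed_openC.
  - by apply: bp_open; exact: open0.
apply: meagerS KO => z [fz nK]; split=> // Oz.
apply: (fz O (open_nbhs_nbhs (conj oO Oz))).
apply: meagerS (meagerU OK mAK) => w [Ow Aw].
have [Kw|nKw] := pselect (K w); last by right.
by left; split=> // -[].
Qed.

(* Off a meager set, a point at which the projection of [V] is locally nonmeager
   is pulled along a sequence of shrinking open sets to a point related to it. *)
Lemma bp_proj_rel (V : set M) : open V -> bp (proj_rel V).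
Proof.
have [_ sh [b bb] [small sm]] := pM; have [bo bP] := bb.
pose C k i := [set j | small k (b j) /\ closure (b j) `<=` b i].
pose A i := proj_rel (b i).
(* The exceptional points at stage [k]: those in the envelope of [A i] but in the envelope of no
   admissible refinement of [b i]. Off all [N k i], a branch of refinements can be followed
   forever. *)
pose N k i := fat (A i) `\` \bigcup_j (if `[< C k i j >] then fat (A j) else set0).
have mN k i : meager (N k i).
  have cov : A i `<=` \bigcup_j (if `[< C k i j >] then A j else set0).
    move=> z [m bm Gzm].
    have [j [bjm sj cj]] := nested_refine sm sh bb k (open_nbhs_nbhs (conj (bo i) bm)).
    exists j => //; case: asboolP => [_|]; last by case.
    by exists m.
  apply: meagerS (fat_cover cov) => z [fz nz]; split=> // -[j _].
  case: asboolP => [Cj fj|_ f0].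
    by apply: nz; exists j => //; case: asboolP.
  by apply: (f0 setT filterT); rewrite setI0; exact: meager0.
have mfat i : msub (fat (A i)) (A i).
  apply: meagerS (meagerU mD (meager_bigcup (fun k => meager_bigcup (mN k)))).
  move=> z [fz nAz]; apply: contrapT => /not_orP[/contrapT Dz nNz]; apply: nAz.
  have [] := @dependent_choice_nat nat (fun j => fat (A j) z)
    (fun k i j => C k i j) i => //.
    move=> k j fj; apply: contrapT => h; apply: nNz; exists k => //; exists j => //.
    by split=> // -[l _]; case: asboolP => // Cl fl; apply: h; exists l.
  move=> u [u0 uP].
  have [|||e [eB elim]] := nested_limit sm (B := fun k => b (u k)).
  - by move=> k; have [_ []] := uP k.
  - move=> k; have [fu _] := uP k; apply: contrapT => h.
    apply: (fu setT filterT); apply: meagerS (@meager0 _) => w [_ [m bm _]].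
    by apply: h; exists m.
  - by move=> k; have [_ []] := uP k.
  exists e; first by rewrite -u0.
  (* Since [z] is in the envelope of every [A (u k)], each neighbourhood of [z] contains points of
     [D] related to a point of [b (u k)]; so [(z, e)] is a limit of related pairs over [D]. *)
  apply: closedG => // P Q nP /elim[k bQ]; have [fu _] := uP k.
  have [w [Pw [m bm Gm]] /contrapT Dw] := nonmeager_ex (fu P nP) mD.
  by exists w, m; split=> //; exact: bQ.
have bpA i : bp (A i).
  apply: (@bp_msub _ (fat (A i))) => //; rewrite -[fat _]setCK; apply: bp_setC.
  by apply: bp_open; exact: closed_openC.
move=> oV.
rewrite (_ : proj_rel V = \bigcup_i (if `[< b i `<=` V >] then A i else set0)).
  by apply: bp_bigcup => i; case: ifP => // _; apply: bp_open; exact: open0.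
apply/seteqP; split=> [z [m Vm Gm]|z [i _]].
  have [i bm bV] := bP _ _ (open_nbhs_nbhs (conj oV Vm)).
  by exists i => //; case: asboolP => // _; exists m.
by case: asboolP => // iV [m /iV Vm Gm]; exists m.
Qed.

End SouslinScheme.

(** * Borel sections of open surjections *)

Section BorelSets.
Variable T : topologicalType.

Definition borel (A : set T) : Prop := <<s @open T >> A.

Lemma borel_open A : open A -> borel A.
Proof. by move=> oA; exact: sub_sigma_algebra. Qed.

Lemma borel_setC A : borel A -> borel (~` A).
Proof. by move=> bA; rewrite -setTD; exact: sigma_algebraCD. Qed.

Lemma borel_bigcup (A : nat -> set T) : (forall n, borel (A n)) -> borel (\bigcup_n A n).
Proof. exact: sigma_algebra_bigcup. Qed.

Lemma borel_setI A B : borel A -> borel B -> borel (A `&` B).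
Proof.
move=> bA bB; rewrite -[_ `&` _]setCK setCI -bigcup2E; apply: borel_setC.
apply: borel_bigcup => -[|[|n]] /=; [exact: borel_setC|exact: borel_setC|].
by apply: borel_open; exact: open0.
Qed.

Lemma borel_and (P : Prop) A : borel A -> borel [set x | P /\ A x].
Proof.
move=> bA; have [p|np] := pselect P.
  by rewrite (_ : mkset _ = A)//; apply/seteqP; split=> x; [case|].
rewrite (_ : mkset _ = set0); first by apply: borel_open; exact: open0.
by apply/seteqP; split=> x // -[].
Qed.

End BorelSets.

Section BorelSection.
Variables (E X : topologicalType) (p : E -> X).
Hypotheses (pE : polish_space E) (hX : hausdorff_space X).
Hypotheses (cp : continuous p) (op : open_map p) (sp : forall x, exists e, p e = x).

(* Following the least admissible child of each basic open set selects a point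
   of the fibre, and each choice is a Borel condition on [x]. *)
Lemma borel_section : exists s : X -> E, cancel s p /\ borel_fun s.
Proof.
have [_ sh [b bb] [small sm]] := pE; have [bo bP] := bb.
pose least (Q : nat -> Prop) j := Q j /\ forall i, (i < j)%N -> ~ Q i.
have leastP Q : (exists j, Q j) -> exists j, least Q j.
  move=> h; have /ex_minnP[j /asboolP Qj jm] : exists j, `[< Q j >].
    by have [j Qj] := h; exists j; exact/asboolP.
  exists j; split=> // i ij /asboolP/jm; by rewrite leqNgt ij.
have leastU Q i j : least Q i -> least Q j -> i = j.
  move=> [Qi im] [Qj jm]; case: (ltngtP i j) => // ij; [case: (jm _ ij)|case: (im _ ij)];
    exact.
pose C k (B : set E) x j := (small k (b j) /\ closure (b j) `<=` B) /\ (p @` b j) x.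
pose reach := fix reach k x j := if k is k'.+1
  then exists i, reach k' x i /\ least (C k (b i) x) j else least (C 0%N setT x) j.
have reachU k x i j : reach k x i -> reach k x j -> i = j.
  elim: k i j => [|k IH] i j /=; first exact: leastU.
  move=> [i' [ri' li]] [j' [rj' lj]]; move: li; rewrite (IH _ _ ri' rj').
  by move=> li; exact: leastU lj.
have Cex k B x : (exists2 e, nbhs e B & p e = x) -> exists j, C k B x j.
  move=> [e nB pe]; have [j [bj sj cj]] := nested_refine sm sh bb k nB.
  by exists j; split=> //; exists e.
have reachC k x j : reach k x j -> (p @` b j) x.
  by case: k => [[[_ ?]]//|k [i [_ [[_ ?]]]]].
have reachE k x : exists j, reach k x j.
  elim: k => [|k [i ri]] /=.
    by apply: leastP; apply: Cex; have [e pe] := sp x; exists e => //; exact: filterT.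
  have [j lj] : exists j, least (C k.+1 (b i) x) j.
    apply: leastP; apply: Cex; have [e be pe] := reachC _ _ _ ri; exists e => //.
    exact: open_nbhs_nbhs.
  by exists j, i.
have /choice[s sP] : forall x, exists e, (forall k j, reach k x j -> b j e) /\
    forall P, nbhs e P -> exists k j, reach k x j /\ b j `<=` P.
  move=> x; have /choice[u uP] := fun k => reachE k x.
  have uS k : least (C k.+1 (b (u k)) x) (u k.+1).
    by have [i [ri li]] := uP k.+1; rewrite (reachU _ _ _ _ (uP k) ri).
  have [|||e [eB elim]] := nested_limit sm (B := fun k => b (u k)).
  - by move=> k; have [[[]]] := uS k.
  - by move=> k; have [e be _] := reachC _ _ _ (uP k); exists e.
  (* [small] is not assumed monotone in its index, so smallness of index [k] is inherited from
     [b (u k)], which contains [b (u k.+1)]. *)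
  - move=> k; have [[[sk _] _] _] := uS k; have [_ s2 _] := sm.
    case: k sk => [|k] sk.
      by have [[[_ c] _] _] := uS 0%N; have [[[s0 _] _] _] := uP 0%N;
         apply: s2 s0; exact: subset_trans (@subset_closure _ _) c.
    have [[[_ c] _] _] := uS k.+1; have [[[s0 _] _] _] := uS k.
    by apply: s2 s0; exact: subset_trans (@subset_closure _ _) c.
  exists e; split=> [k j /(reachU _ _ _ _ (uP k)) <-//|P /elim[k kP]].
  by exists k, (u k).
exists s; split=> [x|B bB].
  apply: hX => P Q nP nQ; have [_ /(_ _ (@cp (s x) P nP))[k [j [rj bPj]]]] := sP x.
  have [e be pe] := reachC _ _ _ rj; exists x; split; last exact: nbhs_singleton.
  by rewrite -pe; exact: bPj.
have leastB (Q : X -> nat -> Prop) j : (forall i, borel [set x | Q x i]) ->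
    borel [set x | least (Q x) j].
  move=> bQ; rewrite (_ : mkset _ = [set x | Q x j] `&`
     ~` \bigcup_i [set x | (i < j)%N /\ Q x i]).
    apply: borel_setI => //; apply: borel_setC; apply: borel_bigcup => i.
    by apply: borel_and; exact: bQ.
  apply/seteqP; split=> x /= [Qj h]; split=> //.
    by move=> [i _ [ij Qi]]; exact: h Qi.
  by move=> i ij Qi; apply: h; exists i.
have CB k A j : borel [set x | C k A x j].
  by apply: borel_and; apply: borel_open; exact: op.
have reachB k j : borel [set x | reach k x j].
  elim: k j => [|k IH] j; first by apply: leastB.
  rewrite (_ : mkset _ = \bigcup_i ([set x | reach k x i] `&`
     [set x | least (C k.+1 (b i) x) j])).
    by apply: borel_bigcup => i; apply: borel_setI => //; exact: leastB.
  by apply/seteqP; split=> x [i]; [move=> ?; exists i|move=> _ ?; exists i].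
apply: (bB [set B | borel (s @^-1` B)]); split.
- split=> [|A /= bA|A bA] /=.
  + by rewrite preimage_set0; apply: borel_open; exact: open0.
  + by rewrite setTD preimage_setC; exact: borel_setC.
  + by rewrite preimage_bigcup; exact: borel_bigcup.
(* [s x] is in [O] exactly when some basic set reached from [x] is inside [O]. *)
- move=> O oO /=; rewrite (_ : _ @^-1` _ =
    \bigcup_k \bigcup_j [set x | b j `<=` O /\ reach k x j]).
    by apply: borel_bigcup => k; apply: borel_bigcup => j; by apply: borel_and; exact: reachB.
  apply/seteqP; split=> x /=.
    move=> Osx; have [_ /(_ _ (open_nbhs_nbhs (conj oO Osx)))[k [j [rj bO]]]] := sP x.
    by exists k => //; exists j.
  by move=> [k _ [j _ [bO rj]]]; apply: bO; have [h _] := sP x; exact: h rj.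
Qed.

End BorelSection.

Local Open Scope group_scope.

(** * Topological groups and the open mapping theorem *)

Section TopGroup.
Variable G : topologicalGroupType.
Implicit Types (A V : set G) (x y g : G).

Lemma cvg_mulg (T : Type) (F : set_system T) {FF : Filter F} (f h : T -> G) x y :
  f @ F --> x -> h @ F --> y -> (fun t => f t * h t) @ F --> x * y.
Proof. by apply: continuous2_cvg; exact: (@mulg_continuous G (x, y)). Qed.

Lemma cvg_invg (T : Type) (F : set_system T) {FF : Filter F} (f : T -> G) x :
  f @ F --> x -> (fun t => (f t)^-1) @ F --> x^-1.
Proof. by apply: continuous_cvg; exact: (@invg_continuous G x). Qed.

Lemma lmulg_continuous g : continuous (fun x => g * x).
Proof. by move=> x; apply: cvg_mulg; [exact: cvg_cst|exact: cvg_id]. Qed.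

Lemma rmulg_continuous g : continuous (fun x => x * g).
Proof. by move=> x; apply: cvg_mulg; [exact: cvg_id|exact: cvg_cst]. Qed.

Arguments lmulg_continuous : clear implicits.
Arguments rmulg_continuous : clear implicits.

Lemma lmulg_open g : open_map (fun x => g * x).
Proof.
move=> O oO; rewrite (_ : _ @` _ = (fun x => g^-1 * x) @^-1` O).
  by move/continuousP: (lmulg_continuous g^-1); exact.
apply/seteqP; split=> [_ [x Ox <-]|x Ox] /=; first by rewrite mulKg.
by exists (g^-1 * x) => //; rewrite mulVKg.
Qed.

Lemma meager_lmulg g A : meager A -> meager ((fun x => g * x) @^-1` A).
Proof. by apply: meager_open_preimage; [exact: lmulg_continuous|exact: lmulg_open]. Qed.

Lemma nbhs1_mulr x A : nbhs x A -> nbhs 1 [set g | A (g * x)].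
Proof. by move=> nA; apply: (rmulg_continuous x 1 A); rewrite mul1g. Qed.

Lemma nbhs1_divr x V : nbhs 1 V -> nbhs x [set y | V (y * x^-1)].
Proof. by move=> nV; apply: (rmulg_continuous x^-1 x V); rewrite mulgV. Qed.

Lemma nbhs1_mulg V : nbhs 1 V ->
  exists2 V', nbhs 1 V' & forall a b, V' a -> V' b -> V (a * b).
Proof.
move=> nV; have [|[P Q] [/= nP nQ] sPQ] := @mulg_continuous G (1, 1) V.
  by rewrite /= mulg1.
exists (P `&` Q); first exact: filterI.
by move=> a b [Pa _] [_ Qb]; exact: (sPQ (a, b)).
Qed.

Lemma nbhs1_invg V : nbhs 1 V -> nbhs 1 [set x | V x^-1].
Proof. by move=> nV; apply: (@invg_continuous G 1 V); rewrite invg1. Qed.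

Lemma nbhs1_divg V : nbhs 1 V ->
  exists2 V', nbhs 1 V' & forall a b, V' a -> V' b -> V (a * b^-1).
Proof.
move=> /nbhs1_mulg[V' nV' V'V]; exists (V' `&` [set x | V' x^-1]).
  by apply: filterI => //; exact: nbhs1_invg.
by move=> a b [Va _] [_ Vb]; exact: V'V.
Qed.

Lemma topgroup_shrink : shrink_nbhs G.
Proof.
move=> x A nA; have [V nV VA] := nbhs1_mulg (nbhs1_mulr nA).
exists ([set y | V (y * x^-1)]°); split.
- exact: open_interior.
- exact: nbhs1_divr.
move=> y cy; have [z [/interior_subset /= Vz Vy]] := cy _ (nbhs1_divr y (nbhs1_invg nV)).
by have := VA _ _ Vy Vz; rewrite /= invgM invgK !mulgA !mulgVK.
Qed.

(** Up to a meager set, [A] fills a nonempty open [O]. For [h] near 1 the open set of the [y] with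
    [y] and [h * y] in [O] is nonempty, hence nonmeager, and contains such a [y] with both points in
    [A]. *)
Lemma pettis A : baire G -> bp A -> ~ meager A ->
  nbhs 1 [set h | exists2 x, A x & A (h * x)].
Proof.
move=> bG bA /(bp_nonmeager bA)[O [oO [x Ox] OA]].
have := nbhs1_mulr (open_nbhs_nbhs (conj oO Ox)); apply: filterS => h /= Ohx.
have oOh : open (O `&` (fun y => h * y) @^-1` O).
  by apply: openI => //; move/continuousP: (lmulg_continuous h); exact.
have nm : ~ meager (O `&` (fun y => h * y) @^-1` O).
  by move=> /(bG _ oOh)/(set0F (x := x)); exact.
have [y [Oy Ohy] /not_orP[n1 n2]] := nonmeager_ex nm (meagerU OA (meager_lmulg h OA)).
by exists y; apply: contrapT => nA; [apply: n1|apply: n2].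
Qed.

(** This stands for a cover by countably many translates of a neighbourhood of 1: the group is a
    countable union of sets whose quotients [y * z^-1] stay in [V]. *)
Lemma base_divg_cover (b : nat -> set G) V : base_seq b -> nbhs 1 V ->
  forall x, exists2 n, b n x & forall y z, b n y -> b n z -> V (y * z^-1).
Proof.
move=> [bo bP] /nbhs1_divg[V' nV' V'V] x.
have [n bx bV] := bP _ _ (nbhs1_divr x nV').
exists n => // y z /bV Vy /bV Vz; have := V'V _ _ Vy Vz.
by rewrite invgM invgK mulgA mulgVK.
Qed.

End TopGroup.
Arguments lmulg_continuous {G}.
Arguments rmulg_continuous {G}.
Arguments lmulg_open {G}.

Section Morphisms.

Lemma morph1 (G H : groupType) (f : G -> H) : {morph f : x y / x * y} -> f 1 = 1.
Proof. by move=> fM; apply: (@mulgI _ (f 1)); rewrite -fM !mulg1. Qed.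

Lemma morphV (G H : groupType) (f : G -> H) : {morph f : x y / x * y} ->
  {morph f : x / x^-1}.
Proof.
by move=> fM x; apply: (@mulgI _ (f x)); rewrite -fM !mulgV (morph1 fM).
Qed.

Lemma continuous_at1 (G H : topologicalGroupType) (f : G -> H) :
  {morph f : x y / x * y} -> (forall V, nbhs 1 V -> nbhs 1 (f @^-1` V)) ->
  continuous f.
Proof.
move=> fM c1 x A nA; have := nbhs1_divr x (c1 _ (nbhs1_mulr nA)).
by apply: filterS => y /=; rewrite -fM mulgVK.
Qed.

Lemma meager_cover_ex (T : topologicalType) (x : T) (A : nat -> set T) : baire T ->
  (forall y, exists n, A n y) -> exists n, ~ meager (A n).
Proof.
move=> bT cov; apply: contrapT => h.
have : meager (setT : set T).
  apply: (@meagerS _ _ (\bigcup_n A n)); first by move=> y _; have [n] := cov y; exists n.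
  by apply: meager_bigcup => n; apply: contrapT => m; apply: h; exists n.
by move=> /(bT _ openT)/(set0F (x := x)); exact.
Qed.

(** One of the countably many preimages of sets with quotients in [V] is nonmeager; [pettis] turns
    it into a neighbourhood of 1 sent into [V]. *)
Lemma bp_morph_continuous (G H : topologicalGroupType) (b : nat -> set H)
    (f : G -> H) : baire G -> base_seq b ->
  {morph f : x y / x * y} -> (forall V, open V -> bp (f @^-1` V)) -> continuous f.
Proof.
move=> bG bb fM fbp; apply: continuous_at1 => // V nV.
pose A n := if `[< forall y z, b n y -> b n z -> V (y * z^-1) >]
            then f @^-1` b n else set0.
have [|n] := @meager_cover_ex G 1 A bG.
  move=> x; have [n bx bV] := base_divg_cover bb nV (f x).
  by exists n; rewrite /A; case: asboolP.
rewrite /A; case: asboolP => [bV|_ m0]; last by case: m0; exact: meager0.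
have [bo _] := bb => /(pettis bG (fbp _ (bo n))).
apply: filterS => h [x /= bx bhx]; have := bV _ _ bhx bx.
by rewrite fM mulgK.
Qed.

(** The images of the basic sets cover [H], so one with quotients inside the given neighbourhood is
    nonmeager. It has the Baire property as a projection of the closed graph, and [pettis] applies
    in [H]. *)
Lemma open_mapping (G H : topologicalGroupType) (f : G -> H) :
  polish_space G -> polish_space H -> continuous_morphism f ->
  (forall y, exists x, f x = y) -> open_map f.
Proof.
move=> pG pH [fM fc] fs O oO; rewrite openE => _ [x Ox <-].
have [_ _ [b bb] _] := pG; have [hH _ [b' bb'] _] := pH.
have bH := polish_baire pH.
have nV := nbhs1_mulr (open_nbhs_nbhs (conj oO Ox)); set V := mkset _ in nV.
pose A n := if `[< forall y z, b n y -> b n z -> V (y * z^-1) >]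
            then f @` b n else set0.
have [|n] := @meager_cover_ex H 1 A bH.
  move=> y; have [a <-] := fs y; have [n bx bV] := base_divg_cover bb nV a.
  by exists n; rewrite /A; case: asboolP => // _; exists a.
rewrite /A; case: asboolP => [bV|_ m0]; last by case: m0; exact: meager0.
have bpf : bp (f @` b n).
  have -> : f @` b n = proj_rel (fun z m => f m = z) (b n).
    by apply/seteqP; split=> y [a ba ya]; exists a.
  have [bo _] := bb; apply: (bp_proj_rel bb' pG (D := setT)) => //.
    by rewrite setCT; exact: meager0.
  move=> z m _ zm; apply: hH => P Q nP nQ.
  have [z' [m' [_ Qz Pm fm]]] := zm Q (f @^-1` P) nQ (@fc _ _ nP).
  by exists z'; split=> //; rewrite -fm.
move=> /(pettis bH bpf)/(nbhs1_divr (f x)); apply: filterS => y /= [_ [a ba <-]].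
move=> [c bc fc']; exists (c * a^-1 * x); first exact: bV.
by rewrite !fM fc' (morphV fM) mulgK mulgVK.
Qed.

(** The preimage is a projection of the graph of [g]. Injectivity of [i] makes that graph closed
    over the set where [i \o g] is continuous, although nothing is known yet about continuity of
    [g]. *)
Lemma bp_lift (Z M Y : topologicalType) (b : nat -> set Z) (i : M -> Y) (g : Z -> M)
    (V : set M) : base_seq b -> polish_space M -> hausdorff_space Y ->
  injective i -> continuous i -> cat_cont (i \o g) -> open V -> bp (g @^-1` V).
Proof.
move=> bb pM hY ii ci [D mD cD] oV.
have -> : g @^-1` V = proj_rel (fun z m => g z = m) V.
  by apply/seteqP; split=> [z Vg|z [m Vm gm]]; [exists (g z)|rewrite /= gm].
apply: (bp_proj_rel bb pM mD) => // z m Dz zm; apply: ii; apply: hY => P Q nP nQ.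
have [z' [m' [Dz' Pz Qm gz]]] := zm _ _ (cD z Dz P nP) (ci _ _ nQ).
by exists (i m'); split=> //; rewrite -gz; exact: Pz.
Qed.

Lemma cat_cont_lift (Z M Y : topologicalType) (b : nat -> set Z) (i : M -> Y)
    (g : Z -> M) : base_seq b -> polish_space M -> hausdorff_space Y ->
  injective i -> continuous i -> cat_cont (i \o g) -> cat_cont g.
Proof.
move=> bb pM hY ii ci cg; have [_ _ [b' bb'] _] := pM; have [bo _] := bb'.
by apply: bp_cat_cont bb' _ => n; apply: (bp_lift bb pM hY ii ci cg).
Qed.

Lemma continuous_lift (W M Y : topologicalGroupType) (i : M -> Y) (h : W -> M) :
  polish_space W -> polish_space M -> hausdorff_space Y ->
  injective i -> continuous i -> continuous (i \o h) -> {morph h : x y / x * y} ->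
  continuous h.
Proof.
move=> pW pM hY ii ci cih hM; have [_ _ [b bb] _] := pW; have [_ _ [b' bb'] _] := pM.
apply: (bp_morph_continuous (polish_baire pW) bb' hM) => V oV.
exact: (bp_lift bb pM hY ii ci (continuous_cat_cont cih) oV).
Qed.

End Morphisms.

(** * Group topologies from a base at 1 *)

Section TwoSidedComplete.
Variables (T : topologicalGroupType) (E : topologicalType).
Variables (O : nat -> set E) (f : E -> T) (u : nat -> T).
Let D := \bigcap_k O k.
Hypotheses (pE : polish_space E) (oO : forall k, open (O k)) (cf : cont_on D f).
Hypothesis almost_open : forall (B : set E) e, open B -> B e -> D e ->
  nbhs (f e) (closure (f @` (B `&` D))).
Hypothesis f_dense : dense (f @` D).
Hypothesis u_cauchy : forall V : set T, nbhs 1 V -> exists N, forall m n,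
  (N <= m)%N -> (N <= n)%N -> V ((u m)^-1 * u n) /\ V (u m * (u n)^-1).

(** An open substitute for the image of [B], which need not be open itself. *)
Let I (B : set E) : set T := (closure (f @` (B `&` D)))°.

Let I_open B : open (I B). Proof. exact: open_interior. Qed.

Let f_I B e : open B -> B e -> D e -> I B (f e).
Proof. exact: almost_open. Qed.

Let I_meet B (P : set T) t : open P -> P t -> I B t -> exists e, [/\ B e, D e & P (f e)].
Proof.
move=> oP Pt It; have /interior_subset/(_ P (open_nbhs_nbhs (conj oP Pt))) := It.
by move=> [_ [[e [Be De] <-] Pfe]]; exists e.
Qed.

Let sub_I B (P Q : set T) : (forall e, B e -> D e -> P (f e)) -> closure P `<=` Q ->
  I B `<=` Q.
Proof.
move=> BP PQ t /interior_subset ct; apply: PQ; apply: closureS ct.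
by move=> _ [e [Be De] <-]; exact: BP.
Qed.

(** A state is a pair of open sets with a rank, such that every [u n] of at least that rank
    translates [I] of the first set into [I] of the second. *)
Let invariant (s : set E * set E * nat) := [/\ open s.1.1, open s.1.2,
  exists t, I s.1.1 t & forall n t, (s.2 <= n)%N -> I s.1.1 t -> I s.1.2 (u n * t)].

Let succ (small : nat -> set E -> Prop) k (s s' : set E * set E * nat) :=
  [/\ closure s'.1.1 `<=` s.1.1, small k s'.1.1, s'.1.1 `<=` O k &
  [/\ closure s'.1.2 `<=` s.1.2, small k s'.1.2 & s'.1.2 `<=` O k]].

(* Two nested sequences of open sets of [E] are built, shrinking to [c] and [b],
   so that translation by [u n] eventually maps a neighbourhood of [f c] into any
   given neighbourhood of [f b]; then [u n * f c] converges to [f b]. *)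
Lemma two_sided_complete : exists l : T, u @ \oo --> l.
Proof.
have [_ sh [b bb] [small sm]] := pE; have [bo bP] := bb.
have IT t : I setT t.
  rewrite /I; apply: filterS filterT => x _ P; rewrite nbhsE => -[Q [oQ Qx] QP].
  have [|y [Qy [e De ye]]] := f_dense _ oQ; first by exists x.
  by exists y; split; [exists e|exact: QP].
have [||v [v0 vP]] := @dependent_choice_nat _ invariant (succ small) (setT, setT, 0%N).
- by split=> /=; [exact: openT|exact: openT|exists 1|].
- move=> k [[C B] N] [/= oC oB [s0 Cs0] CB].
  have nC := nbhs1_mulr (open_nbhs_nbhs (conj (I_open C) Cs0)).
  have [V2 nV2 V2P] := nbhs1_mulg nC.
  have [N1 N1P] := u_cauchy nV2; set n0 := maxn N N1.
  have n0N1 : (N1 <= n0)%N by exact: leq_maxr.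
  (* The point [f d] is taken so near [u n0 * s0] that its pullbacks by later terms of [u] stay in
     [I C]. *)
  pose Q := I B `&` (fun t => (u n0)^-1 * t * s0^-1) @^-1` V2°.
  have oQ : open Q.
    apply: openI => //; apply: open_comp; last exact: open_interior.
    move=> t _; apply: cvg_mulg; last exact: cvg_cst.
    exact: lmulg_continuous.
  have Q0 : Q (u n0 * s0).
    split; first by apply: CB => //; exact: leq_maxl.
    by rewrite /= mulKg mulgV; exact: nV2.
  have [d [Bd Dd [IBd /interior_subset /= V2d]]] := I_meet oQ Q0 (CB _ _ (leq_maxl _ _) Cs0).
  have [j [bjd sj cj]] : exists j, [/\ b j d, small k (b j) & closure (b j) `<=` B `&` O k].
    apply: nested_refine => //; apply: open_nbhs_nbhs; split; first exact: openI.
    by split=> //; exact: Dd.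
  have nB := nbhs1_mulr (open_nbhs_nbhs (conj (I_open (b j)) (f_I (bo j) bjd Dd))).
  have [V4 nV4 V4P] := nbhs1_mulg nB.
  have [N2 N2P] := u_cauchy nV4; set n1 := maxn n0 N2.
  (* The left half of the Cauchy condition compares [(u n1)^-1] with [(u n0)^-1] and keeps [s'] in
     [I C]. *)
  pose s' := (u n1)^-1 * f d.
  have Cs' : I C s'.
    have [h _] := N1P n1 n0 (leq_trans n0N1 (leq_maxl _ _)) n0N1.
    by have := V2P _ _ h V2d; rewrite /= -!mulgA mulVg mulg1 mulVKg.
  have [Q' [oQ' Q's' cQ']] : exists Q', [/\ open Q', Q' s' &
      closure Q' `<=` (fun t => u n1 * t * (f d)^-1) @^-1` V4].
    apply: topgroup_shrink.
    have : continuous (fun t => u n1 * t * (f d)^-1).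
      by move=> t; apply: cvg_mulg; [exact: lmulg_continuous|exact: cvg_cst].
    by move=> /(_ s' V4); apply; rewrite /s' mulVKg mulgV.
  have [c [Cc Dc [ICc Q'c]]] : exists c, [/\ C c, D c & (I C `&` Q') (f c)].
    by apply: (@I_meet C (I C `&` Q') s'); [apply: openI|split|].
  have [P [oP Pc PQ']] : exists P, [/\ open P, P c & forall e, P e -> D e -> Q' (f e)].
    have := cf Dc (open_nbhs_nbhs (conj oQ' Q'c)).
    rewrite nbhsE /= => -[P [oP Pc] PQ']; exists P; split=> //.
  have [i [bic si ci]] : exists i, [/\ b i c, small k (b i) &
      closure (b i) `<=` C `&` O k `&` P].
    apply: nested_refine => //; apply: open_nbhs_nbhs; split.
      by do ?apply: openI.
    by split=> //; split=> //; exact: Dc.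
  exists (b i, b j, n1).
    split=> //=; first by exists (f c); exact: f_I.
    move=> n t n1n It.
    have V4t : V4 (u n1 * t * (f d)^-1).
      apply: (sub_I _ cQ' It) => e be De; apply: PQ' => //.
      by have [] := ci e (@subset_closure _ _ _ be).
    (* The right half of the Cauchy condition replaces [u n1] by [u n] without leaving [I (b j)]. *)
    have [_ h] := N2P n n1 (leq_trans (leq_maxr _ _) n1n) (leq_maxr _ _).
    by have := V4P _ _ h V4t; rewrite /= !mulgA !mulgVK.
  by split=> //=; [move=> x /ci[[]]|move=> x /(@subset_closure _ _)/ci[[]]|split=> //;
    [move=> x /cj[]|move=> x /(@subset_closure _ _)/cj[]]].
have Iv k : exists t, I (v k).1.1 t by have [[]] := vP k.
have Ine B t : I B t -> B !=set0.
  by move=> /(I_meet openT) -/(_ Logic.I)[e [Be _ _]]; exists e.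
have [|||c [cC _]] := nested_limit sm (B := fun k => (v k).1.1).
- by move=> k; have [_ []] := vP k.
- by move=> k; have [t /Ine] := Iv k.
- by move=> k; have [_ []] := vP k.
have [|||d [dB dlim]] := nested_limit sm (B := fun k => (v k).1.2).
- by move=> k; have [_ [_ _ _ []]] := vP k.
- move=> k; have [t It] := Iv k; have [[_ _ _ h] _] := vP k.
  exact: Ine (h _ _ (leqnn _) It).
- by move=> k; have [_ [_ _ _ []]] := vP k.
have Dc : D c by move=> k _; have [_ [_ _ h _]] := vP k; exact: h (cC k.+1).
have Dd : D d by move=> k _; have [_ [_ _ _ [_ _ h]]] := vP k; exact: h (dB k.+1).
have lim : (fun n => u n * f c) @ \oo --> f d.
  move=> P /topgroup_shrink[P' [oP' P'd P'P]].
  have /dlim[k kP'] := cf Dd (open_nbhs_nbhs (conj oP' P'd)).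
  have [[oC _ _ h] _] := vP k; exists (v k).2 => // n /= vn.
  have It := h n (f c) vn (f_I oC (cC k) Dc).
  by apply: (sub_I _ P'P It) => e /kP' h' De; exact: h'.
exists (f d * (f c)^-1).
rewrite (_ : u = fun n => u n * f c * (f c)^-1); last first.
  by apply/funext => n; rewrite mulgK.
by apply: cvg_mulg; [exact: lim|exact: cvg_cst].
Qed.

End TwoSidedComplete.

(** The proofs are phantom arguments: they let an alias of [G] carry a structure that depends on
    hypotheses. [base_group], [induced_group] and [subgroup_of] follow the same pattern. *)
Definition polish_of (R : realType) (G : topologicalGroupType) (_ : separable G)
  (_ : completely_metrizable R G) : Type := G.

Section PolishOf.
Variables (R : realType) (G : topologicalGroupType).
Hypotheses (sG : separable G) (mG : completely_metrizable R G).

HB.instance Definition _ := TopologicalGroup.on (polish_of sG mG).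
HB.instance Definition _ := isPolish.Build R (polish_of sG mG) sG mG.

Definition polish_group_of : polishGroupType R := polish_of sG mG.

End PolishOf.

Lemma polish_group_space (R : realType) (G : polishGroupType R) : polish_space G.
Proof.
exact: polish_spaceP (@polish_separable R G) (@polish_completely_metrizable R G).
Qed.

Record nbhs1_base (T : groupType) (W : nat -> set T) : Prop := Nbhs1Base {
  nbhs1_base1 : forall n, W n 1;
  nbhs1_baseI : forall n m, exists k, W k `<=` W n `&` W m;
  nbhs1_baseV : forall n, exists m, forall x y, W m x -> W m y -> W n (x^-1 * y);
  nbhs1_baseJ : forall n g, exists m, forall x, W m x -> W n (x ^ g);
  nbhs1_base_sep : forall x, (forall n, W n x) -> x = 1
}.

Definition base_group (T : groupType) (W : nat -> set T) (_ : nbhs1_base W) : Type := T.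

Section GroupTopology.
Variables (T : groupType) (W : nat -> set T) (HW : nbhs1_base W).
Local Notation G := (base_group HW).

HB.instance Definition _ := Group.on G.

Definition base_nbhs (x : G) : set_system G :=
  [set A | exists n, forall y : G, W n (x^-1 * y) -> A y].

Lemma base_nbhs_filter x : ProperFilter (base_nbhs x).
Proof.
apply: Build_ProperFilter_ex.
  by move=> A [n nA]; exists x; apply: nA; rewrite mulVg; exact: nbhs1_base1 HW n.
split=> [|A B [n nA] [m mB]|A B AB [n nA]].
- by exists 0%N.
- have [k kW] := nbhs1_baseI HW n m.
  by exists k => y /kW[/nA ? /mB].
- by exists n => y /nA/AB.
Qed.

Lemma base_nbhs_singleton x A : base_nbhs x A -> A x.
Proof. by move=> [n]; apply; rewrite mulVg; exact: nbhs1_base1 HW n. Qed.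

Lemma nbhs1_baseV1 n : exists m, forall x, W m x -> W n x^-1.
Proof.
have [m mn] := nbhs1_baseV HW n; exists m => x mx.
by have := mn _ _ mx (nbhs1_base1 HW m); rewrite mulg1.
Qed.

Lemma nbhs1_baseM n : exists m, forall x y, W m x -> W m y -> W n (x * y).
Proof.
have [m mn] := nbhs1_baseV HW n; have [k km] := nbhs1_baseV1 m.
have [l lP] := nbhs1_baseI HW m k; exists l => x y /lP[_ /km kx] /lP[my _].
by have := mn _ _ kx my; rewrite invgK.
Qed.

Lemma base_nbhs_nbhs x A : base_nbhs x A -> base_nbhs x (base_nbhs^~ A).
Proof.
move=> [n nA]; have [m mn] := nbhs1_baseM n; exists m => y my; exists m => z mz.
by apply: nA; have := mn _ _ my mz; rewrite -mulgA mulVKg.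
Qed.

HB.instance Definition _ := hasNbhs.Build G base_nbhs.
HB.instance Definition _ := Nbhs_isNbhsTopological.Build G
  base_nbhs_filter base_nbhs_singleton base_nbhs_nbhs.

Lemma base_mulg_continuous : continuous (fun p : G * G => p.1 * p.2).
Proof.
move=> [x y] A [n nA]; have [m mn] := nbhs1_baseM n; have [k km] := nbhs1_baseJ HW m y.
exists ([set z | W k (x^-1 * z)], [set z | W m (y^-1 * z)]).
  by split; [exists k|exists m].
move=> [a b] [/= /km ka mb]; apply: nA; have := mn _ _ ka mb.
by rewrite /= conjgE invgM !mulgA mulgK.
Qed.

Lemma base_invg_continuous : continuous (fun x : G => x^-1).
Proof.
move=> x A [n nA]; have [m mn] := nbhs1_baseV1 n.
have [k km] := nbhs1_baseJ HW m x^-1; exists k => y /km ky /=; apply: nA.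
have := mn _ ky; rewrite conjgE !invgM !invgK.
by rewrite !mulgA mulgK.
Qed.

HB.instance Definition _ := isTopologicalGroup.Build G
  base_mulg_continuous base_invg_continuous.

Lemma nbhs1_baseE (A : set G) : nbhs (1 : G) A <-> exists n, W n `<=` A.
Proof.
split=> -[n nA]; exists n => x; first by move=> Wx; apply: nA; rewrite invg1 mul1g.
by rewrite invg1 mul1g; exact: nA.
Qed.

(** An alias for the uniformity controlling both [x^-1 * y] and [x * y^-1]; the metric made from it
    is the one shown complete. *)
Definition two_sided : Type := G.
Local Notation U := two_sided.

HB.instance Definition _ := Group.on U.

Definition two_sided_ent : set_system (U * U) := [set A | exists n, forall x y : G,
  W n (x^-1 * y) -> W n (x * y^-1) -> A (x, y)].

Lemma two_sided_ent_filter : Filter two_sided_ent.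
Proof.
split=> [|A B [n nA] [m mB]|A B AB [n nA]].
- by exists 0%N.
- have [k kW] := nbhs1_baseI HW n m.
  by exists k => x y /kW[h1 h2] /kW[h3 h4]; split; [exact: nA|exact: mB].
- by exists n => x y h1 h2; apply: AB; exact: nA.
Qed.

Lemma two_sided_ent_diagonal A : two_sided_ent A -> diagonal `<=` A.
Proof.
move=> [n nA] [x y] /= /diagonalP <-.
by apply: nA; rewrite ?mulVg ?mulgV; exact: nbhs1_base1 HW n.
Qed.

Lemma two_sided_ent_inv A : two_sided_ent A -> two_sided_ent (A^-1)%relation.
Proof.
move=> [n nA]; have [m mn] := nbhs1_baseV1 n; exists m => x y /mn + /mn.
by rewrite !invgM !invgK; exact: nA.
Qed.

Lemma two_sided_ent_split A : two_sided_ent A ->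
  exists2 B, two_sided_ent B & (B \; B)%relation `<=` A.
Proof.
move=> [n nA]; have [m mn] := nbhs1_baseM n.
exists [set xy : U * U | W m (xy.1^-1 * xy.2) /\ W m (xy.1 * xy.2^-1)]; first by exists m.
move=> [x z] /= [y /= [h1 h2] [h3 h4]]; apply: nA.
  by have := mn _ _ h1 h3; rewrite mulgA mulgK.
by have := mn _ _ h2 h4; rewrite mulgA mulgVK.
Qed.

HB.instance Definition _ := isUniform.Build U two_sided_ent_filter
  two_sided_ent_diagonal two_sided_ent_inv two_sided_ent_split.

Lemma two_sided_countable : countable_uniformity U.
Proof.
apply/countable_uniformityP.
exists (fun n => [set xy : U * U | W n (xy.1^-1 * xy.2) /\ W n (xy.1 * xy.2^-1)]).
  by move=> A [n nA]; exists n => -[x y] /= [? ?]; exact: nA.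
by move=> n; exists n.
Qed.

Section Metric.
Variable R : realType.
Let M := countable_uniform.type two_sided_countable.
Local Open Scope ring_scope.

Let B (x : M) (e : R) (y : M) : Prop := @ball R M x e y.

(** Metrization of a countable uniformity gives balls; the distance is recovered as the infimum of
    the radii, a nonempty set because balls of radius 2 are everything. *)
Definition two_sided_dist (x y : G) : R := inf [set e | 0 < e /\ B x e y].
Local Notation d := two_sided_dist.

Let has_infB x y : has_inf [set e | 0 < e /\ B x e y].
Proof.
split; first by exists 2; split=> //; exact: countable_uniform.countable_uniform_bounded.
by exists 0 => e [/ltW].
Qed.

Let dist_le x y e : 0 < e -> B x e y -> d x y <= e.
Proof. by move=> e0 Be; apply: ge_inf => //=; case: (has_infB x y). Qed.

Let dist_lt x y e : d x y < e -> B x e y.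
Proof.
move=> /(inf_lt (proj1 (has_infB x y)))[e' [e'0 Be'] e'e].
exact: le_ball (ltW e'e) _ Be'.
Qed.

Let dist_ge0 x y : 0 <= d x y.
Proof. by apply: lb_le_inf; [case: (has_infB x y)|move=> e [/ltW]]. Qed.

Let entB (A : set (U * U)) : two_sided_ent A <->
  exists2 e : R, 0 < e & forall x y : M, B x e y -> A (x, y).
Proof.
have := @entourage_ballE R M; rewrite predeqE => /(_ A) E; split.
  by move=> /E[e /= e0 eA]; exists e => // x y Bxy; exact: (eA (x, y)).
by move=> [e e0 eA]; apply/E; exists e => //= -[x y] /=; exact: eA.
Qed.

Let dist_small n : exists2 e : R, 0 < e &
  forall x y, d x y < e -> W n (x^-1 * y)%g /\ W n (x * y^-1)%g.
Proof.
have /entB[e e0 eP] : two_sided_ent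
    [set xy : U * U | W n (xy.1^-1 * xy.2)%g /\ W n (xy.1 * xy.2^-1)%g].
  by exists n.
by exists e => // x y /dist_lt/eP.
Qed.

Lemma two_sided_metric : is_metric d.
Proof.
split=> [x|x y d0|x y|x y z].
- apply/eqP; rewrite eq_le dist_ge0 andbT; apply/ler_addgt0Pr => e e0.
  by rewrite add0r; apply: dist_le => //; exact: ballxx.
- apply: (@mulgI _ (x^-1)%g); rewrite mulVg; apply/esym.
  apply: (nbhs1_base_sep HW) => n.
  have [e e0 eP] := dist_small n.
  by have [] := eP x y; rewrite ?d0.
- by rewrite /d; congr inf; apply/seteqP; split=> e [e0 /ball_sym].
- apply/ler_addgt0Pr => e e0.
  have e20 : 0 < e / 2 by rewrite divr_gt0.
  have h1 : B x (d x y + e / 2) y by apply: dist_lt; rewrite ltrDl.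
  have h2 : B y (d y z + e / 2) z by apply: dist_lt; rewrite ltrDl.
  have := ball_triangle h1 h2; rewrite addrACA -splitr; apply: dist_le.
  by rewrite ltr_wpDl// addr_ge0.
Qed.

Lemma two_sided_compatible : @metric_compatible R G d.
Proof.
move=> x A; split=> [[n nA]|[e e0 eA]].
  have [e e0 eP] := dist_small n; exists e => // y /= /eP[h _]; exact: nA.
have [n nP] : two_sided_ent [set xy : U * U | d xy.1 xy.2 < e].
  apply/entB; exists (e / 2); first by rewrite divr_gt0.
  move=> a b /dist_le/= h; apply: le_lt_trans (h _) _; first by rewrite divr_gt0.
  by rewrite ltr_pdivrMr// ltr_pMr// ltr1n.
(* One-sided closeness suffices near a fixed [x]: [x * y^-1] is the inverse of the conjugate of
   [x^-1 * y] by [x^-1]. *)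
have [m1 m1P] := nbhs1_baseV1 n; have [m2 m2P] := nbhs1_baseJ HW m1 (x^-1)%g.
have [k kP] := nbhs1_baseI HW n m2; exists k => y /kP[ny /m2P/m1P ny'].
apply: eA; apply: nP => //; move: ny'.
by rewrite conjgE invgK -mulgA mulVKg invgM invgK.
Qed.

Lemma two_sided_cauchy (u : nat -> G) :
  (forall e : R, 0 < e -> exists N : nat, forall m n : nat,
     (N <= m)%N -> (N <= n)%N -> d (u m) (u n) < e) ->
  forall V : set G, nbhs (1%g : G) V -> exists N, forall m n,
    (N <= m)%N -> (N <= n)%N -> V ((u m)^-1 * u n)%g /\ V (u m * (u n)^-1)%g.
Proof.
move=> uc V /nbhs1_baseE[n nV]; have [e e0 eP] := dist_small n.
have [N NP] := uc e e0; exists N => p q Np Nq.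
by have [h1 h2] := eP _ _ (NP p q Np Nq); split; exact: nV.
Qed.

End Metric.

Lemma base_group_polish (R : realType) (E : topologicalType) (O : nat -> set E)
    (f : E -> G) : polish_space E -> (forall k, open (O k)) ->
  cont_on (\bigcap_k O k) f ->
  (forall (B : set E) e, open B -> B e -> (\bigcap_k O k) e ->
     nbhs (f e) (closure (f @` (B `&` \bigcap_k O k)))) ->
  dense (f @` \bigcap_k O k) ->
  completely_metrizable R G.
Proof.
move=> pE oO cf af df; exists (@two_sided_dist R); split.
- exact: two_sided_metric.
- exact: two_sided_compatible.
- by move=> u /two_sided_cauchy; exact: two_sided_complete pE oO cf af df.
Qed.

End GroupTopology.

(** * Products and closed subgroups *)

Section ProductGroup.
Variables (G H : topologicalGroupType).

Lemma prod_mulg_continuous : continuous (fun p : (G * H) * (G * H) => p.1 * p.2).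
Proof.
move=> [[a b] [c d]].
rewrite (_ : (fun p => _) = fun p : (G * H) * (G * H) =>
  (p.1.1 * p.2.1, p.1.2 * p.2.2)) //.
have c1 : (fun p : (G * H) * (G * H) => p.1) @ (a, b, (c, d)) --> (a, b) by exact: cvg_fst.
have c2 : (fun p : (G * H) * (G * H) => p.2) @ (a, b, (c, d)) --> (c, d) by exact: cvg_snd.
apply: cvg_pair; apply: cvg_mulg.
- by apply: cvg_comp c1 _; exact: cvg_fst.
- by apply: cvg_comp c2 _; exact: cvg_fst.
- by apply: cvg_comp c1 _; exact: cvg_snd.
- by apply: cvg_comp c2 _; exact: cvg_snd.
Qed.

Lemma prod_invg_continuous : continuous (fun p : G * H => p^-1).
Proof.
move=> [a b]; rewrite (_ : (fun p => _) = fun p : G * H => (p.1^-1, p.2^-1)) //.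
by apply: cvg_pair; apply: cvg_invg; [exact: cvg_fst|exact: cvg_snd].
Qed.

HB.instance Definition _ := isTopologicalGroup.Build (G * H)%type
  prod_mulg_continuous prod_invg_continuous.

End ProductGroup.

Lemma polish_space_separable (T : topologicalType) : polish_space T -> separable T.
Proof. by move=> [_ _ [b bb] _]; exact: base_seq_separable bb. Qed.

Lemma prod_metrizable (R : realType) (T U : topologicalType) :
  completely_metrizable R T -> completely_metrizable R U ->
  completely_metrizable R (T * U)%type.
Proof.
move=> [d [dm dc dC]] [d' [dm' dc' dC']].
have d0 := metric_ge0 dm; have d0' := metric_ge0 dm'.
have [dxx dE ds dt] := dm; have [dxx' dE' ds' dt'] := dm'.
exists (fun p q => d p.1 q.1 + d' p.2 q.2)%R; split.
- split=> [p|[x y] [z w] /= h|p q|p q r].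
  + by rewrite dxx dxx' addr0.
  + have h1 := d0 x z; have h2 := d0' y w.
    by congr pair; [apply: dE|apply: dE']; lra.
  + by rewrite ds ds'.
  + have := dt p.1 q.1 r.1; have := dt' p.2 q.2 r.2; lra.
- move=> [x y] A; split.
    move=> [[P Q] [/= /dc[e e0 eP] /dc'[e' e'0 eQ]] sPQ].
    exists (Num.min e e'); first by rewrite lt_min e0 e'0.
    move=> [z w] /=; rewrite lt_min => /andP[h h']; apply: sPQ; split => /=.
      by apply: eP => /=; have := d0' y w; lra.
    by apply: eQ => /=; have := d0 x z; lra.
  move=> [e e0 eA]; exists ([set z | d x z < e / 2]%R, [set w | d' y w < e / 2]%R).
    split => /=; [apply: metric_ball_nbhs|apply: metric_ball_nbhs] => //; lra.
  by move=> [z w] [/= h h']; apply: eA => /=; lra.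
- move=> u uc.
  have [|l ul] := dC (fun n => (u n).1).
    move=> e /uc[N NP]; exists N => m n Nm Nn.
    by have := NP m n Nm Nn; have := d0' (u m).2 (u n).2; lra.
  have [|l' ul'] := dC' (fun n => (u n).2).
    move=> e /uc[N NP]; exists N => m n Nm Nn.
    by have := NP m n Nm Nn; have := d0 (u m).1 (u n).1; lra.
  exists (l, l'); rewrite (_ : u = fun n => ((u n).1, (u n).2)); first exact: cvg_pair.
  by apply/funext => n; case: (u n).
Qed.

Definition polish_prod (R : realType) (G H : polishGroupType R) : polishGroupType R :=
  polish_group_of
    (polish_space_separable (polish_space_prod (polish_group_space G) (polish_group_space H)))
    (prod_metrizable (@polish_completely_metrizable R G) (@polish_completely_metrizable R H)).

Definition induced_group (K : groupType) (G : topologicalGroupType) (j : K -> G)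
  (_ : {morph j : x y / x * y}) : Type := initial_topology j.

Section Induced.
Variables (K : groupType) (G : topologicalGroupType) (j : K -> G).
Hypothesis jM : {morph j : x y / x * y}.
Local Notation I := (induced_group jM).

HB.instance Definition _ := Topological.copy I (initial_topology j).
HB.instance Definition _ := Group.copy I K.

Lemma induced_nbhs (x : I) A : nbhs x A <-> exists2 P, nbhs (j x) P & j @^-1` P `<=` A.
Proof.
split=> [|[P nP PA]].
  rewrite nbhsE => -[_ [[Q oQ <-] Qx] QA]; exists Q => //; exact: open_nbhs_nbhs.
apply: filterS PA _; exact: (@initial_continuous K G j x P nP).
Qed.

Lemma induced_continuous : continuous (j : I -> G).
Proof. exact: initial_continuous. Qed.

Lemma induced_cvg (T : Type) (F : set_system T) {FF : Filter F} (f : T -> I) (x : I)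
    (g : T -> G) : (forall t, g t = j (f t)) -> g @ F --> j x -> f @ F --> x.
Proof.
move=> gf jf A /induced_nbhs[P nP PA].
have h : F (g @^-1` P) := jf P nP.
by apply: (@filterS _ F FF _ (f @^-1` A) _ h) => t; rewrite /= gf; exact: PA.
Qed.

Lemma induced_mulg_continuous : continuous (fun p : I * I => p.1 * p.2).
Proof.
move=> [x y]; apply: (@induced_cvg _ _ _ _ _ (fun p : I * I => j p.1 * j p.2)).
  by move=> p; rewrite jM.
rewrite jM; apply: cvg_mulg.
  by apply: (@cvg_comp _ _ _ (fun p : I * I => p.1) j);
    [exact: cvg_fst|exact: induced_continuous].
by apply: (@cvg_comp _ _ _ (fun p : I * I => p.2) j);
  [exact: cvg_snd|exact: induced_continuous].
Qed.

Lemma induced_invg_continuous : continuous (fun x : I => x^-1).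
Proof.
move=> x; apply: (@induced_cvg _ _ (nbhs_filter x) _ _ (fun x : I => (j x)^-1)).
  by move=> p; rewrite (morphV jM).
by rewrite (morphV jM); apply: (@cvg_invg _ _ _ (nbhs_filter x)); exact: induced_continuous.
Qed.

HB.instance Definition _ := isTopologicalGroup.Build I
  induced_mulg_continuous induced_invg_continuous.

Lemma induced_separable (b : nat -> set G) : base_seq b -> separable I.
Proof.
move=> [bo bP]; apply: (@base_seq_separable I (fun n => j @^-1` b n)); split=> [n|x A].
  by exists (b n).
move=> /induced_nbhs[P /bP[n bx bP'] PA]; exists n => // y /= /bP' Py.
exact: PA.
Qed.

(** Injectivity makes the pulled-back distance a metric; closedness of the range brings limits of
    Cauchy sequences back. *)
Lemma induced_metrizable (R : realType) : injective j -> closed (range j) ->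
  completely_metrizable R G -> completely_metrizable R I.
Proof.
move=> ji cj [d [dm dc dC]]; have [dxx dE ds dt] := dm.
exists (fun x y => d (j x) (j y)); split.
- by split=> [x|x y /dE/ji|x y|x y z].
- move=> x A; rewrite induced_nbhs; split=> [[P /dc[e e0 eP] PA]|[e e0 eA]].
    by exists e => // y h; apply: PA; exact: eP.
  exists [set y | d (j x) y < e]%R; first exact: metric_ball_nbhs.
  by move=> y h; exact: eA.
- move=> u /dC[l ul].
  have [x _ xl] : (range j) l.
    apply: cj => P /ul[N _ NP]; exists (j (u N)); split; first by exists (u N).
    by apply: NP => /=.
  by exists x; apply: (@induced_cvg _ _ _ _ _ (j \o u)) => //; rewrite xl.
Qed.

End Induced.

Section InducedPolish.
Variables (R : realType) (K : groupType) (G : polishGroupType R) (j : K -> G).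
Hypotheses (jM : {morph j : x y / x * y}) (ji : injective j) (cj : closed (range j)).

Lemma induced_polish_separable : separable (induced_group jM).
Proof.
by have [_ _ [b bb] _] := polish_group_space G; exact: induced_separable bb.
Qed.

Definition induced_polish : polishGroupType R :=
  polish_group_of induced_polish_separable
    (induced_metrizable jM ji cj (@polish_completely_metrizable R G)).

Lemma induced_polish_continuous : continuous (j : induced_polish -> G).
Proof. exact: induced_continuous. Qed.

Lemma induced_polish_cvg (T : Type) (F : set_system T) {FF : Filter F}
    (f : T -> induced_polish) (x : induced_polish) (g : T -> G) :
  (forall t, g t = j (f t)) -> g @ F --> j x -> f @ F --> x.
Proof. exact: (@induced_cvg _ _ _ jM _ _ _ f x g). Qed.

End InducedPolish.

Definition subgroup_set (G : groupType) (N : set G) : Prop :=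
  [/\ N 1, forall x y, N x -> N y -> N (x * y) & forall x, N x -> N x^-1].

Definition subgroup_of (G : groupType) (N : set G) (_ : subgroup_set N) : Type :=
  set_type N.

Section Subgroup.
Variables (G : groupType) (N : set G) (HN : subgroup_set N).
Local Notation S := (subgroup_of HN).

Definition subgroup_elt x (Nx : N x) : S := SigSub (mem_set Nx).
Definition subgroup_val (x : S) : G := val (x : set_type N).

Lemma subgroup_valP (x : S) : N (subgroup_val x).
Proof. by apply: set_mem; exact: (valP (x : set_type N)). Qed.

Lemma subgroup_val_inj : injective subgroup_val.
Proof. exact: val_inj. Qed.

Definition subgroup_one : S := subgroup_elt (let: And3 h _ _ := HN in h).
Definition subgroup_mul (x y : S) : S :=
  subgroup_elt (let: And3 _ h _ := HN in h _ _ (subgroup_valP x) (subgroup_valP y)).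
Definition subgroup_inv (x : S) : S :=
  subgroup_elt (let: And3 _ _ h := HN in h _ (subgroup_valP x)).

Lemma subgroup_mulA : associative subgroup_mul.
Proof. by move=> x y z; apply: subgroup_val_inj; exact: mulgA. Qed.
Lemma subgroup_mul1 : left_id subgroup_one subgroup_mul.
Proof. by move=> x; apply: subgroup_val_inj; exact: mul1g. Qed.
Lemma subgroup_mulr1 : right_id subgroup_one subgroup_mul.
Proof. by move=> x; apply: subgroup_val_inj; exact: mulg1. Qed.
Lemma subgroup_mulV : left_inverse subgroup_one subgroup_inv subgroup_mul.
Proof. by move=> x; apply: subgroup_val_inj; exact: mulVg. Qed.
Lemma subgroup_mulrV : right_inverse subgroup_one subgroup_inv subgroup_mul.
Proof. by move=> x; apply: subgroup_val_inj; exact: mulgV. Qed.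

HB.instance Definition _ := Choice.copy S (set_type N).
HB.instance Definition _ := isGroup.Build S
  subgroup_mulA subgroup_mul1 subgroup_mulr1 subgroup_mulV subgroup_mulrV.

Lemma subgroup_valM : {morph subgroup_val : x y / x * y}.
Proof. by []. Qed.

Lemma subgroup_val_range : range subgroup_val = N.
Proof.
apply/seteqP; split=> [_ [x _ <-]|x Nx]; first exact: subgroup_valP.
by exists (subgroup_elt Nx).
Qed.

End Subgroup.

Lemma nbhs1_seq (G : topologicalGroupType) (b : nat -> set G) : base_seq b ->
  exists V : nat -> set G, (forall n, nbhs 1 (V n)) /\
    forall P, nbhs 1 P -> exists n, V n `<=` P.
Proof.
move=> [bo bP]; exists (fun n => if `[< b n 1 >] then b n else setT).
split=> [n|P /bP[n b1 bP']].
  by case: asboolP => [b1|_]; [exact: open_nbhs_nbhs|exact: filterT].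
by exists n; case: asboolP.
Qed.

(** * Images of homomorphisms *)

Section Image.
Variables (R : realType) (G H : polishGroupType R) (f : G -> H).
Hypothesis fc : continuous_morphism f.

Lemma range_subgroup : subgroup_set (range f).
Proof.
have [fM _] := fc; split=> [|_ _ [x _ <-] [y _ <-]|_ [x _ <-]].
- by exists 1 => //; exact: morph1.
- by exists (x * y).
- by exists x^-1 => //; exact: morphV.
Qed.

(* The image carries the quotient topology of [G], not the one induced by [H]. *)
Lemma polish_image : exists (I : polishGroupType R) (q : G -> I) (m : I -> H),
  [/\ continuous_morphism q, forall y, exists x, q x = y, continuous_morphism m,
      injective m & f =1 m \o q].
Proof.
have [fM ct] := fc; have pG := polish_group_space G; have pH := polish_group_space H.
have [_ _ [b bb] _] := pG; have [V [nV VP]] := nbhs1_seq bb.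
pose S := subgroup_of range_subgroup.
pose q x : S := subgroup_elt range_subgroup (imageT f x).
pose W n : set S := q @` V n.
have qM : {morph q : x y / x * y} by move=> x y; apply: subgroup_val_inj; exact: fM.
have qs y : exists x, q x = y.
  move: (@subgroup_valP H (range f) range_subgroup y) => [x _ xy].
  by exists x; exact: subgroup_val_inj.
have HW : nbhs1_base W.
  split=> [n|n m|n|n y|x xW].
  - by exists 1; [exact: nbhs_singleton|exact: morph1].
  - have [k kP] := VP _ (filterI (nV n) (nV m)).
    by exists k => _ [x /kP[? ?] <-]; split; exists x.
  - have [P nP PV] := nbhs1_divg (nbhs1_invg (nbhs1_invg (nV n))).
    have [m mP] := VP _ (nbhs1_invg nP); exists m => _ _ [x /mP/= Vx <-] [y /mP/= Vy <-].
    exists (x^-1 * y); last by rewrite qM (morphV qM).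
    by have := PV _ _ Vx Vy; rewrite /= !invgK.
  - have [x <-] := qs y.
    have [|m mP] := VP ((fun z => z ^ x) @^-1` V n).
      have h : (fun z => z ^ x) @ (1 : G) --> (1 : G) ^ x.
        rewrite [X in _ --> X]conjgE; apply: cvg_mulg; first exact: cvg_cst.
        exact: rmulg_continuous.
      by apply: h; rewrite conj1g.
    exists m => _ [z /mP/= Vz <-]; exists (z ^ x) => //.
    by rewrite !conjgE !qM (morphV qM).
  - apply: subgroup_val_inj; rewrite /=; have [hH _ _ _] := pH; apply: hH => P Q nP nQ.
    have [|n nQ'] := VP (f @^-1` Q).
      by apply: ct; rewrite (morph1 fM).
    have [a Va ax] := xW n; exists (subgroup_val x); split; first exact: nbhs_singleton.
    by rewrite -ax; exact: nQ'.
pose I := base_group HW.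
have qc : continuous (q : G -> I).
  apply: (@continuous_at1 G I) => // P /nbhs1_baseE[n nP].
  by apply: filterS (nV n) => x Vx; apply: nP; exists x.
have bT : \bigcap_(k : nat) (setT : set G) = setT by apply/seteqP; split.
(* The constant sequence [setT] is used because [q] is continuous everywhere and open. *)
have mI : completely_metrizable R I.
  apply: (@base_group_polish S W HW R G (fun=> setT) q pG) => //.
  - by move=> _; exact: openT.
  - exact: continuous_cont_on.
  - move=> B e oB Be _; rewrite bT setIT; apply: filterS (@subset_closure _ _) _.
    have nBe : nbhs (e^-1 * e) ((fun x => e^-1 * x) @` B).
      by apply: open_nbhs_nbhs; split; [exact: (lmulg_open e^-1 B oB)|exists e].
    have [n nB] := VP _ (nbhs1_mulr nBe).
    exists n => y [a /nB /= Ba ay]; move: Ba; rewrite mulVg mulg1 => -[z Bz zE].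
    by exists z => //; rewrite -[z](mulVKg e) zE qM ay mulVKg.
  - move=> P [y Py] _; have [x xy] := qs y; exists y; split=> //.
    by rewrite bT; exists x.
have sI : separable I.
  have [D cD dD] := polish_space_separable pG; exists (q @` D).
    exact: card_le_trans (card_image_le _ _) cD.
  move=> P [y Py] oP; have [x xy] := qs y.
  have [||z [Pz Dz]] := dD (q @^-1` P).
  - by exists x; rewrite /= xy.
  - by move/continuousP: qc; exact.
  by exists (q z); split=> //; exists z.
exists (polish_group_of sI mI), q, (@subgroup_val H _ range_subgroup).
split=> //; split=> //.
apply: (@continuous_at1 I H) => // P nP; apply/nbhs1_baseE.
have [|n nP'] := VP (f @^-1` P); first by apply: ct; rewrite (morph1 fM).
by exists n => _ [x /nP' Px <-].
Qed.

End Image.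

Local Open Scope cat_scope.

(** * Regularity of the category of Polish groups *)

Section Regular.
Variable R : realType.
Local Notation C := (PolGrp R).
Implicit Types A B Z : polishGroupType R.

Lemma polish_homM A B (f : polish_hom A B) : {morph f : x y / x * y}.
Proof. by case: (polish_homP f). Qed.

Lemma polish_homC A B (f : polish_hom A B) : continuous f.
Proof. by case: (polish_homP f). Qed.

Lemma polish_hausdorff A : hausdorff_space A.
Proof. by case: (polish_group_space A). Qed.

Lemma hom_eqP A B (f g : polish_hom A B) : f = g <-> f =1 g.
Proof. by split=> [->|/polish_hom_ext]. Qed.

Lemma closed_eqfun (T Z : topologicalType) (f g : T -> Z) : hausdorff_space Z ->
  continuous f -> continuous g -> closed [set x | f x = g x].
Proof.
move=> hZ cf cg x cx; apply: hZ => P Q nP nQ.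
have [y [/= fg [Py Qy]]] := cx _ (@filterI _ _ (nbhs_filter x) _ _
  (cf x P nP : nbhs x (f @^-1` P)) (cg x Q nQ : nbhs x (g @^-1` Q))).
by exists (f y); split=> //; rewrite fg.
Qed.

Lemma polish_pullback A B Z (f : polish_hom A Z) (g : polish_hom B Z) :
  exists (P : polishGroupType R) (p : polish_hom P A) (q : polish_hom P B),
  [/\ forall x, f (p x) = g (q x),
      forall a b, f a = g b -> exists x, p x = a /\ q x = b,
      forall x y, p x = p y -> q x = q y -> x = y &
      forall (T : polishGroupType R) (u : polish_hom T A) (v : polish_hom T B),
        (forall t, f (u t) = g (v t)) ->
        exists h : polish_hom T P, forall t, p (h t) = u t /\ q (h t) = v t].
Proof.
pose AB := polish_prod A B.
pose N : set AB := [set x : A * B | f x.1 = g x.2].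
have fM := polish_homM f; have gM := polish_homM g.
have sN : subgroup_set N.
  split=> [|[a b] [c d] /= h h'|[a b] /= h].
  - by rewrite /N /= (morph1 fM) (morph1 gM).
  - by rewrite /N /= fM gM; congr (_ * _).
  - by rewrite /N /= (morphV fM) (morphV gM); congr (_^-1).
have cN : closed (range (@subgroup_val AB N sN)).
  rewrite subgroup_val_range; apply: (@closed_eqfun (A * B)%type).
  - exact: polish_hausdorff.
  - by move=> x; apply: continuous_cvg; [exact: polish_homC|exact: cvg_fst].
  - by move=> x; apply: continuous_cvg; [exact: polish_homC|exact: cvg_snd].
pose P := induced_polish (@subgroup_valM AB N sN) (@subgroup_val_inj AB N sN) cN.
pose j : P -> A * B := @subgroup_val AB N sN.
have jc : continuous (j : P -> (A * B)%type).
  exact: (@induced_polish_continuous R _ AB _ (@subgroup_valM AB N sN)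
    (@subgroup_val_inj AB N sN) cN).
have jM : {morph j : x y / x * y} by [].
have pP : continuous_morphism (fun x : P => (j x).1).
  split=> [x y|x]; first by rewrite jM.
  by apply: (@cvg_comp _ _ _ j (fun x => x.1)); [exact: jc|exact: cvg_fst].
have qP : continuous_morphism (fun x : P => (j x).2).
  split=> [x y|x]; first by rewrite jM.
  by apply: (@cvg_comp _ _ _ j (fun x => x.2)); [exact: jc|exact: cvg_snd].
exists P, (PolishHom pP), (PolishHom qP); split=> /=.
- by move=> x; exact: (@subgroup_valP AB N sN x).
- by move=> a b fg; exists (@subgroup_elt AB N sN (a, b) fg).
- move=> x y h1 h2; apply: (@subgroup_val_inj AB N sN); rewrite -/(j x) -/(j y).
  by case: (j x) (j y) h1 h2 => ? ? [? ?] /= -> ->.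
- move=> T u v uv.
  pose h t : P := @subgroup_elt AB N sN (u t, v t) (uv t).
  have hP : continuous_morphism h.
    split=> [x y|x].
      apply: (@subgroup_val_inj AB N sN).
      change ((u (x * y)%g, v (x * y)%g) = (u x * u y, v x * v y)%g).
      by rewrite (polish_homM u) (polish_homM v).
    apply: (@induced_polish_cvg R _ AB _ (@subgroup_valM AB N sN)
      (@subgroup_val_inj AB N sN) cN _ _ (nbhs_filter x) h (h x)
      (fun t => (u t, v t))) => //.
    by apply: cvg_pair; exact: polish_homC.
  by exists (PolishHom hP).
Qed.

(** Two points with the same image are the coordinates of one point of the kernel pair, whose two
    projections a mono identifies. *)
Lemma mono_inj A B (m : polish_hom A B) : mono (m : @hom C A B) -> injective m.
Proof.
move=> mm x y xy; have [P [p [q [pq sPQ _ _]]]] := polish_pullback m m.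
have [z [<- <-]] := sPQ _ _ xy.
suff -> : p = q by [].
by apply: mm; apply/hom_eqP => t; exact: pq.
Qed.

Lemma inj_mono A B (m : polish_hom A B) : injective m -> mono (m : @hom C A B).
Proof.
by move=> im T u v /hom_eqP uv; apply/hom_eqP => t; apply: im; exact: uv.
Qed.

(** The pair witnessing regularity is the kernel pair; the induced map out of [B] is continuous
    because [e] is open. *)
Lemma surj_regular_epi A B (e : polish_hom A B) : (forall y, exists x, e x = y) ->
  regular_epi (e : @hom C A B).
Proof.
move=> se; have [P [p [q [pq sPQ _ _]]]] := polish_pullback e e.
exists P, p, q; split; first by apply/hom_eqP => x; exact: pq.
move=> T f /hom_eqP fpq.
have ff x y : e x = e y -> f x = f y.
  by move=> /sPQ[z [<- <-]]; exact: fpq.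
have /choice[s sP] := se.
have fs x : f (s (e x)) = f x by apply: ff; rewrite sP.
have oe := open_mapping (polish_group_space A) (polish_group_space B) (polish_homP e) se.
have hP : continuous_morphism (f \o s).
  split=> [x y|].
    by rewrite -{1}(sP x) -{1}(sP y) -polish_homM /= fs polish_homM.
  apply/continuousP => O oO.
  rewrite (_ : _ @^-1` O = e @` (f @^-1` O)).
    by apply: oe; move/continuousP: (@polish_homC _ _ f); exact.
  apply/seteqP; split=> [y Oy|_ [x Ox <-]]; first by exists (s y) => //=.
  by rewrite /= fs.
exists (PolishHom hP); split; first by apply/hom_eqP => x; exact: fs.
move=> h /hom_eqP he; apply/hom_eqP => y.
by have := he (s y); rewrite /= sP => ->.
Qed.

Lemma PolGrp_image A Z (f : polish_hom A Z) : exists (m : @mono_to C Z)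
  (q : polish_hom A (mdom m)),
  [/\ forall y, exists x, q x = y & f = marr m ∘ q :> @hom C A Z].
Proof.
have [I [q [m [qP sq mP im fmq]]]] := polish_image (polish_homP f).
exists (MonoTo (@inj_mono _ _ (PolishHom mP) im)), (PolishHom qP); split=> //.
by apply/hom_eqP.
Qed.

(** In the image factorization of [e], the identity of [B] lifts through the mono part, which is
    therefore onto. *)
Lemma regular_epi_surj A B (e : polish_hom A B) : regular_epi (e : @hom C A B) ->
  forall y, exists x, e x = y.
Proof.
move=> re; have [m [q [sq emq]]] := PolGrp_image e.
have [|d md] := regular_epi_lift (m := marr m) (f := q : @hom C A _)
  (g := idc (B : C)) re (marr_mono (m := m)).
  by rewrite comp1c.
move=> y; have [x xy] := sq ((d : polish_hom _ _) y); exists x.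
move/hom_eqP: emq => -> /=; rewrite xy.
by move/hom_eqP: md => /(_ y).
Qed.

End Regular.

Definition trivial_type : Type := unit.
HB.instance Definition _ := Choice.on trivial_type.

Lemma trivial_type_irr (x y : trivial_type) : x = y.
Proof. by case: x; case: y. Qed.

HB.instance Definition _ := @isGroup.Build trivial_type
  tt (fun x => x) (fun _ _ => tt)
  (fun _ _ _ => erefl) (fun _ => trivial_type_irr _ _) (fun _ => trivial_type_irr _ _)
  (fun _ => erefl) (fun _ => erefl).

Lemma trivial_nbhs1_base : nbhs1_base (fun=> [set: trivial_type]).
Proof.
by split=> [n|n m|n|n g|x _]; [by []|exists 0%N|exists 0%N|exists 0%N|
  exact: trivial_type_irr].
Qed.

Definition trivial_group : topologicalGroupType := base_group trivial_nbhs1_base.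

Lemma trivial_group_separable : separable trivial_group.
Proof.
exists [set: trivial_group]; last by move=> O [x Ox] _; exists x.
by apply: (@sub_countable _ _ _ [set (tt : trivial_group)]);
  [apply: subset_card_le => -[]|exact: countable1].
Qed.

Lemma trivial_group_metrizable (R : realType) : completely_metrizable R trivial_group.
Proof.
have allT (x : trivial_group) A : nbhs x A <-> A = setT.
  split=> [/nbhs_singleton|->]; last exact: filterT.
  by case: x => Ax; apply/seteqP; split=> // -[].
exists (fun _ _ => 0%R); split.
- split=> [//|x y _|//|x y z]; last by rewrite addr0.
  exact: trivial_type_irr.
- move=> x A; rewrite allT; split=> [->|[e e0 eA]]; first by exists 1%R.
  by apply/seteqP; split=> // y _; exact: eA.
- by move=> u _; exists tt => A; rewrite allT => ->; exact: filterT.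
Qed.

Definition trivial_polish_group (R : realType) : polishGroupType R :=
  polish_group_of trivial_group_separable (trivial_group_metrizable R).

Section RegularPolGrp.
Variable R : realType.
Local Notation C := (PolGrp R).

Lemma PolGrp_regular : is_regular C.
Proof.
split.
- pose I := trivial_polish_group R.
  exists (I : C) => T; have hP : @continuous_morphism T I (fun=> tt).
    by split=> // x; exact: cvg_cst.
  exists (PolishHom hP : @hom C T I); split=> // h _.
  by apply/hom_eqP => x /=; case: (polish_fun h x).
- move=> A B.
  have p1 : @continuous_morphism (polish_prod A B) A (fun x : A * B => x.1).
    by split=> // x; exact: cvg_fst.
  have p2 : @continuous_morphism (polish_prod A B) B (fun x : A * B => x.2).
    by split=> // x; exact: cvg_snd.
  exists (Span (PolishHom p1 : @hom C (polish_prod A B) A)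
    (PolishHom p2 : @hom C (polish_prod A B) B)) => T f g /=.
  have hP : @continuous_morphism T (polish_prod A B) (fun t => (f t, g t) : A * B).
    split=> [x y|x]; last by apply: cvg_pair; exact: polish_homC.
    by rewrite !polish_homM.
  exists (PolishHom hP : @hom C T (polish_prod A B)); split=> /=.
    by split; apply/hom_eqP.
  move=> k [/hom_eqP k1 /hom_eqP k2]; apply/hom_eqP => t /=.
  by rewrite -k1 -k2 /=; case: (polish_fun k t).
- move=> A B Z f g; have [P [p [q [pq sPQ iPQ uPQ]]]] := polish_pullback f g.
  exists (Span (p : @hom C P A) (q : @hom C P B)); split => /=.
    by apply/hom_eqP => x; exact: pq.
  move=> T u v /hom_eqP uv; have [h hP] := uPQ T u v uv.
  exists h; split; first by split; apply/hom_eqP => t; have [] := hP t.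
  move=> k [/hom_eqP k1 /hom_eqP k2]; apply/hom_eqP => t; have [h1 h2] := hP t.
  by apply: iPQ; [rewrite h1 -k1|rewrite h2 -k2].
- move=> A Z f; have [m [q [sq fmq]]] := PolGrp_image f.
  by exists m, q; split=> //; exact: surj_regular_epi.
- move=> A B Z f g S [/hom_eqP comm univ] /regular_epi_surj sf; apply: surj_regular_epi.
  have [P [p [q [pq sPQ _ _]]]] := polish_pullback f g.
  have [|h [[_ /hom_eqP h2] _]] := univ P p q; first by apply/hom_eqP.
  move=> b; have [a ab] := sf (polish_fun g b); have [x [_ <-]] := sPQ _ _ ab.
  by exists (polish_fun h x); exact: h2.
Qed.

End RegularPolGrp.

(** * Polish topology of a group with generically continuous operations *)

Lemma separable_subset (S : topologicalType) (b : nat -> set S) (D : set S) :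
  base_seq b -> exists2 D', countable D' & D' `<=` D /\
    forall x, D x -> forall P, nbhs x P -> exists2 y, D' y & P y.
Proof.
move=> [bo bP].
have /choice[f fP] : forall n, exists o : option S, (forall y, o = Some y -> D y /\ b n y) /\
    forall x, D x -> b n x -> o <> None.
  move=> n; have [[y [Dy by_]]|h] := pselect (exists y, D y /\ b n y).
    by exists (Some y); split=> // _ [<-].
  by exists None; split=> // x Dx bx _; apply: h; exists x.
exists (\bigcup_n [set x | f n = Some x]).
  apply: bigcup_countable => // n _; case: (f n) => [y|].
    apply: (@sub_countable _ _ _ [set y]); last exact: countable1.
    by apply: subset_card_le => x /= [->].
  by apply: (@sub_countable _ _ _ set0); [apply: subset_card_le => x /=|exact: countable0].
split=> [x [n _ /= /(proj1 (fP n))[]]//|x Dx P /bP[n bx bP']].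
case E : (f n) => [y|]; last by have := proj2 (fP n) x Dx bx; rewrite E.
have [Dy by_] := proj1 (fP n) y E.
by exists y; [exists n|exact: bP'].
Qed.

Section GroupChunk.
Variables (S : topologicalType) (T : groupType) (enc : T -> S) (dec : S -> T).
Hypotheses (encK : cancel enc dec) (decK : cancel dec enc).
Hypothesis pS : polish_space S.
Variables (s0 : S) (b : nat -> set S).
Hypothesis bb : base_seq b.

Let bS : baire S := polish_baire pS.

Definition act (t : T) (s : S) : S := enc (t * dec s).

Hypothesis act_meager : forall t A, meager A -> meager (act t @^-1` A).
Hypothesis act_bp : forall t U, open U -> bp (act t @^-1` U).
Hypothesis mul_cat : cat_cont (fun p : S * S => enc (dec p.1 * dec p.2)).
Hypothesis div_cat : cat_cont (fun p : S * S => enc ((dec p.1)^-1 * dec p.2)).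

Let actM t u s : act t (act u s) = act (t * u) s.
Proof. by rewrite /act encK mulgA. Qed.

Let act1 s : act 1 s = s.
Proof. by rewrite /act mul1g decK. Qed.

Let actK t : cancel (act t) (act t^-1).
Proof. by move=> s; rewrite actM mulVg act1. Qed.

Let actVK t : cancel (act t^-1) (act t).
Proof. by move=> s; rewrite actM mulgV act1. Qed.

Let act_nonmeager t (A : set S) : ~ meager A -> ~ meager (act t @^-1` A).
Proof.
move=> nA /(act_meager (t^-1)) mA; apply: nA; apply: meagerS mA => s As.
by rewrite /= actVK.
Qed.

Let open_nonmeager (U : set S) : open U -> U !=set0 -> ~ meager U.
Proof. by move=> oU [x Ux] /(bS oU)/(set0F (x := x)); exact. Qed.

Let base_in (U : set S) : open U -> U !=set0 -> exists j, b j !=set0 /\ b j `<=` U.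
Proof.
move=> oU [x Ux]; have [_ bP] := bb.
by have [j bx bU] := bP _ _ (open_nbhs_nbhs (conj oU Ux)); exists j; split=> //; exists x.
Qed.

Let act_base t i : b i !=set0 -> exists j, b j !=set0 /\ msub (b j) (act t @^-1` b i).
Proof.
have [bo _] := bb => b0.
have [O [oO O0 OA]] := bp_nonmeager (act_bp t (bo i))
  (@act_nonmeager t _ (open_nonmeager (bo i) b0)).
have [j [j0 jO]] := base_in oO O0; exists j; split=> //.
exact: msub_trans (sub_msub jO) OA.
Qed.

Definition return_set (A : set S) : set T :=
  [set t | ~ meager (A `&` act t @^-1` A)].

Let return_V A t : return_set A t -> return_set A t^-1.
Proof.
move=> Nt mt; apply: Nt; apply: meagerS (act_meager t mt) => s [As Ats].
by split=> //=; rewrite actK.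
Qed.

(** Only the class of [A] modulo meager sets matters, so open sets can stand for sets with the Baire
    property, in particular for translates of open sets. *)
Let return_msub A B : msub A B -> return_set A `<=` return_set B.
Proof.
move=> AB t NA mB; apply: NA.
apply: meagerS (meagerU mB (meagerU AB (act_meager t AB))) => s [As Ats].
have [Bs|Bs] := pselect (B s); last by right; left.
have [Bts|Bts] := pselect (B (act t s)); last by right; right.
by left.
Qed.

Let return_J A g t : return_set (act g^-1 @^-1` A) t -> return_set A (t ^ g).
Proof.
move=> NA mA; apply: NA; apply: meagerS (act_meager g^-1 mA) => s [As Ats].
by split=> //=; move: Ats; rewrite /= !actM conjgE -!mulgA mulgV mulg1.
Qed.

(** Finite intersections over the first [n] basic sets; the empty ones are skipped because nothing
    returns to them. *)
Definition return_base n : set T :=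
  [set t | forall i, (i < n)%N -> b i !=set0 -> return_set (b i) t].
Local Notation W := return_base.

Let W_anti n m : (n <= m)%N -> W m `<=` W n.
Proof. by move=> nm t Wt i /leq_trans-/(_ _ nm)/Wt. Qed.

Let W_fin (Q : nat -> T -> Prop) n : (forall i, b i !=set0 ->
    exists m, forall t, W m t -> Q i t) ->
  exists m, forall t, W m t -> forall i, (i < n)%N -> b i !=set0 -> Q i t.
Proof.
move=> h; elim: n => [|n [m mP]]; first by exists 0%N.
have [b0|nb0] := pselect (b n !=set0).
  have [k kP] := h n b0; exists (maxn m k) => t Wt i; rewrite ltnS leq_eqVlt.
  move=> /orP[/eqP -> _|]; first by apply: kP; exact: W_anti (leq_maxr _ _) _ Wt.
  by apply: mP; exact: W_anti (leq_maxl _ _) _ Wt.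
exists m => t Wt i; rewrite ltnS leq_eqVlt => /orP[/eqP ->|]; last exact: mP.
by move=> /nb0.
Qed.

Let W_return U : open U -> U !=set0 -> exists m, W m `<=` return_set U.
Proof.
move=> oU /(base_in oU)[j [j0 jU]]; exists j.+1 => t /(_ j (ltnSn j) j0).
by apply: return_msub; exact: sub_msub.
Qed.

Let W_V n t : W n t -> W n t^-1.
Proof. by move=> Wt i ni b0; apply: return_V; exact: Wt. Qed.

Section Generic.
Variables (Q Q2 : set (S * S)).
Hypotheses (mQ : meager (~` Q)) (mQ2 : meager (~` Q2)).
Hypothesis Qc : cont_on Q (fun p : S * S => enc (dec p.1 * dec p.2)).
Hypothesis Q2c : cont_on Q2 (fun p : S * S => enc ((dec p.1)^-1 * dec p.2)).

Let G1 : set S := [set x | meager [set y | ~ Q (x, y)]].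
Let G2 : set S := [set x | meager [set y | ~ Q2 (x, y)]].

Let mG1 : meager (~` G1). Proof. exact: kuratowski_ulam bb mQ. Qed.
Let mG2 : meager (~` G2). Proof. exact: kuratowski_ulam bb mQ2. Qed.

(* An element [t] returning [B] to itself is [x2 * x1^-1] with [x1], [x2] generic
   in [B], and [(x1, a) |-> x1^-1 a], [(x2, c) |-> x2 c] are continuous at generic
   points: this replaces continuity of [t |-> t a] at [1]. *)
Lemma return_absorb U : open U -> U !=set0 -> exists B A,
  [/\ open B, B !=set0, open A, A !=set0 &
      A `<=` U /\ forall t, return_set B t -> msub A (act t @^-1` U)].
Proof.
move=> oU U0; have nU := open_nonmeager oU U0.
have [x0 _ /not_orP[/contrapT G1x /contrapT G2x]] :=
  nonmeager_ex nU (meagerU mG1 mG2).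
have [a0 Ua0 /not_orP[/contrapT Q2a /= /contrapT Qa]] :=
  nonmeager_ex nU (meagerU G2x (act_meager (dec x0)^-1 G1x)).
(* As [x0 * (x0^-1 * a0)] is [a0], there are neighbourhoods with [P * D] inside [U] and then
   [P2^-1 * A2] inside [D], up to exceptional pairs. So [t = x2 * x1^-1] sends [a] to
   [x2 * (x1^-1 * a)], in [U]. *)
have [|[P D] [/= nP nD] sPD] := @Qc _ Qa U.
  rewrite /= /act encK mulVKg decK; exact: open_nbhs_nbhs.
have [|[P2 A2] [/= nP2 nA2] sPA2] := @Q2c _ Q2a D; first exact: nD.
exists (P `&` P2)°, (A2° `&` U); split.
- exact: open_interior.
- by exists x0; exact: filterI.
- by apply: openI => //; exact: open_interior.
- by exists a0.
split=> [a []//|t Nt].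
have [x1 [/interior_subset[_ P2x1] /interior_subset[Px2 _]]] :=
  nonmeager_ex Nt (meagerU mG2 (act_meager t mG1)).
move=> /not_orP[/contrapT G2x1 /contrapT G1x2].
apply: meagerS (meagerU G2x1 (act_meager (dec x1)^-1 G1x2)).
move=> a [[/interior_subset A2a _] nUa]; apply: contrapT.
move=> /not_orP[/contrapT Q2a' /= /contrapT Qa']; apply: nUa => /=.
have Da : D (act (dec x1)^-1 a) by exact: (sPA2 (x1, a) (conj P2x1 A2a) Q2a').
have := sPD (act t x1, act (dec x1)^-1 a) (conj Px2 Da) Qa'.
by rewrite /= /act !encK -mulgA mulVKg.
Qed.

Lemma return_nbhs1_base : nbhs1_base W.
Proof.
have [bo bP] := bb; split.
- move=> n i _ b0 m; apply: (open_nonmeager (bo i) b0); apply: meagerS m => s bs.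
  by split=> //=; rewrite act1.
- move=> n m; exists (maxn n m) => t Wt.
  by split; apply: W_anti Wt; [exact: leq_maxl|exact: leq_maxr].
- move=> n.
  (* For [x] and [y] in [W m], both [x^-1 A] and [y^-1 A] lie in [b i] up to a meager set, and
     [x^-1 * y] carries the second onto the first. *)
  have /choice[A AP] : forall i, exists A, b i !=set0 -> ~ meager A /\
      exists m, forall t, W m t -> msub A (act t @^-1` b i).
    move=> i; have [b0|nb0] := pselect (b i !=set0); last by exists set0.
    have [B [A [oB B0 oA A0 [_ AP]]]] := return_absorb (bo i) b0.
    exists A => _; split; first exact: open_nonmeager.
    by have [m mP] := W_return oB B0; exists m => t /mP/AP.
  have [|m mP] := @W_fin (fun i t => msub (A i) (act t @^-1` b i)) n.
    by move=> i /AP[].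
  exists m => x y /W_V/mP Wx /W_V/mP Wy i ni b0 mZ.
  have [nA _] := AP i b0; apply: nA.
  apply: msub_meager (act_meager y^-1 mZ).
  apply: meagerS (meagerU (Wx i ni b0) (Wy i ni b0)) => a [Aa nZ].
  have [h|h] := pselect ((act x^-1 @^-1` b i) a); last by left.
  right; split=> // h'; apply: nZ; split=> //=.
  by rewrite actM -mulgA mulgV mulg1.
- move=> n g; have [|m mP] := @W_fin (fun i t => return_set (b i) (t ^ g)) n.
    move=> i b0; have [j [j0 jb]] := act_base g^-1 b0; exists j.+1 => t Wt.
    by apply: return_J; apply: return_msub jb _ _; exact: Wt.
  by exists m => t /mP.
(* If [t] is not 1 it moves every point, so [S] is covered by countably many sets that [t] sends off
   themselves. One of them is nonmeager and fills an open set, to which [t] must return. *)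
- move=> t Wt; apply: contrapT => t1; have [hS _ _ _] := pS.
  pose A n := if @unpickle (nat * nat)%type n is Some (i, j) then
    if `[< b i `&` b j = set0 >] then b i `&` act t @^-1` b j else set0 else set0.
  have [|n] := @meager_cover_ex S s0 A bS.
    move=> s; have st : s <> act t s.
      move=> /(congr1 dec); rewrite /act encK -{1}[dec s]mul1g => /mulIg /esym.
      exact: t1.
    have [P [P' [oP oP' Ps Ps' PP']]] := hausdorff_separate hS st.
    have [i bi iP] := bP _ _ (open_nbhs_nbhs (conj oP Ps)).
    have [j bj jP] := bP _ _ (open_nbhs_nbhs (conj oP' Ps')).
    exists (pickle (i, j)); rewrite /A pickleK; case: asboolP => // h; case: h.
    apply/seteqP; split=> // z [/iP Pz /jP P'z].
    by have : (P `&` P') z; [split|rewrite PP'].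
  rewrite /A; case: unpickle => [[i j]|m0]; last by case: m0; exact: meager0.
  case: asboolP => [ij|_ m0]; last by case: m0; exact: meager0.
  have bpA : bp (b i `&` act t @^-1` b j).
    rewrite -[_ `&` _]setCK setCI; apply: bp_setC; rewrite -bigcup2E; apply: bp_bigcup.
    move=> [|[|k]] /=; [by apply/bp_setC/bp_open|by apply/bp_setC/act_bp|].
    by apply: bp_open; exact: open0.
  move=> /(bp_nonmeager bpA)[O [oO O0 OA]].
  have [m mP] := W_return oO O0.
  have := return_msub OA (mP _ (Wt m)); apply; apply: meagerS (@meager0 _).
  move=> s [[_ h] [h' _]].
  by have : (b i `&` b j) (act t s); [split|rewrite ij].
Qed.

Local Notation G := (base_group return_nbhs1_base).

(** This plays the part of separability. For each [i < n] the class records a basic set that [t^-1]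
    sends into [b i] up to a meager set. If [u] records the same [b j], then [t^-1 * u] sends
    [u^-1 (b j)] onto [t^-1 (b j)], both almost inside [b i]. *)
Lemma return_class n : exists c : T -> nat, forall t u, c t = c u -> W n (t^-1 * u).
Proof.
have [bo _] := bb.
have /choice[J JP] : forall t, exists J, forall i, b i !=set0 ->
    b (J i) !=set0 /\ msub (b (J i)) (act t^-1 @^-1` b i).
  move=> t; have /choice[J JP] : forall i, exists j, b i !=set0 ->
      b j !=set0 /\ msub (b j) (act t^-1 @^-1` b i).
    move=> i; have [/(act_base t^-1)[j ?]|nb0] := pselect (b i !=set0); first by exists j.
    by exists 0%N.
  by exists J.
exists (fun t => pickle (mkseq (J t) n)) => t u /(pcan_inj pickleK) E i ni b0 mZ.
have Ji : J t i = J u i by have := congr1 (nth 0%N ^~ i) E; rewrite !nth_mkseq.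
have [j0 h1] := JP t i b0; have [_ h2] := JP u i b0; rewrite -Ji in h2.
apply: (open_nonmeager (bo (J t i)) j0); apply: msub_meager (act_meager u^-1 mZ).
apply: meagerS (meagerU h1 h2) => a [ba nZ].
have [h|h] := pselect ((act t^-1 @^-1` b i) a); last by left.
right; split=> // h'; apply: nZ; split=> //=.
by rewrite actM -mulgA mulgV mulg1.
Qed.

(** One of the countably many classes is nonmeager, and a translate of it lies in this coset. It
    follows that new neighbourhoods meet every comeager set of [S]. *)
Lemma coset_nonmeager n y : ~ meager [set s | W n (y^-1 * dec s)].
Proof.
have [c cP] := return_class n.
have [|k nk] := @meager_cover_ex S s0 (fun k => [set s | c (dec s) = k]) bS.
  by move=> s; exists (c (dec s)).
have [s1 cs1 _] := nonmeager_ex nk (@meager0 _).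
move=> mZ; apply: nk; apply: meagerS (act_meager (y * (dec s1)^-1) mZ) => s cs.
rewrite /= /act encK -mulgA mulKg; apply: cP.
by rewrite cs1 cs.
Qed.

(** The points where [A] is locally nonmeager, with neighbourhoods of the new topology but meager
    sets of the old one. *)
Let fatG (A : set S) : set G :=
  [set t | forall n, ~ meager (A `&` [set s | W n (t^-1 * dec s)])].

Let fatG_sub A : meager (A `&` [set a | ~ fatG A (dec a)]).
Proof.
have /choice[c cP] := return_class.
apply: (@meagerS _ _ (\bigcup_n \bigcup_k
  (if `[< meager (A `&` [set s | c n (dec s) = k]) >]
   then A `&` [set s | c n (dec s) = k] else set0))).
  move=> a [Aa /existsNP[n /contrapT mn]]; exists n => //; exists (c n (dec a)) => //.
  case: asboolP => // h; case: h; apply: meagerS mn => s [As cs]; split=> //.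
  by apply: cP.
apply: meager_bigcup => n; apply: meager_bigcup => k.
by case: asboolP => // _; exact: meager0.
Qed.

Let fatG_msub A B : msub A B -> fatG A `<=` fatG B.
Proof.
move=> AB t At n mB; apply: (At n); apply: meagerS (meagerU mB AB) => s [As Ws].
by have [Bs|Bs] := pselect (B s); [left|right].
Qed.

Let fatG_act A g t : fatG A t -> fatG (act g^-1 @^-1` A) (g * t).
Proof.
move=> At n mB; apply: (At n); apply: meagerS (act_meager g mB) => s [As Ws].
split; first by rewrite /= actK.
by rewrite /= /act encK invgM -mulgA mulKg.
Qed.

(** This gives almost openness of [dec] at most points. If [A] is absorbed into [B] by the
    translations near 1, then for [y] near [dec a] the translation by [y * (dec a)^-1] moves local
    nonmagerness of [A] at [dec a] to local nonmeagerness of [B] at [y]. *)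
Let fatG_nbhs B : open B ->
  meager (B `&` [set e | ~ nbhs (dec e : G) (fatG B)]).
Proof.
move=> oB; set C := _ `&` _.
have key U : open U -> U !=set0 -> U `<=` B ->
    exists A, [/\ open A, A !=set0, A `<=` U & meager (A `&` C)].
  move=> oU U0 UB; have [B' [A [oB' B'0 oA A0 [AU AP]]]] := return_absorb oU U0.
  exists A; split=> //; apply: meagerS (fatG_sub A) => a [Aa [_ nCa]]; split=> // fa.
  apply: nCa.
  have nB' : nbhs (1 : G) (return_set B').
    by apply/nbhs1_baseE; exact: W_return.
  have := nbhs1_divr (dec a : G) nB'; apply: filterS => y /= /AP sA.
  have := @fatG_act A ((y : T) * (dec a)^-1) _ fa; rewrite mulgVK; apply: fatG_msub.
  apply: meagerS (act_meager ((y : T) * (dec a)^-1)^-1 sA) => s [As nBs]; split=> //.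
  by rewrite /= actVK => /UB.
(* By [key], the open set [V] where [C] is locally meager is dense in [B]; so [C] is meager inside
   [V], and what remains of [B] lies in a closed set without interior. *)
pose V := [set x | exists A, [/\ open A, A x & meager (A `&` C)]].
have oV : open V.
  rewrite openE => x [A [oA Ax mA]]; have := open_nbhs_nbhs (conj oA Ax).
  by apply: filterS => z Az; exists A.
have mCV : meager (C `&` V).
  apply: meagerS (meager_local C bb) => x [Cx [A [oA Ax mA]]]; split=> //.
  by exists A => //; exact: open_nbhs_nbhs.
have mF : meager (~` (V `|` (~` B)°)).
  apply: meager_closed.
    by apply: open_closedC; apply: openU => //; exact: open_interior.
  move=> P oP sP; apply/seteqP; split=> // x Px.
  have [y [Py By]] : (P `&` B) !=set0.
    apply: contrapT => h; apply: (sP x Px); right.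
    have := open_nbhs_nbhs (conj oP Px); apply: filterS => z Pz Bz.
    by apply: h; exists z.
  have [||A [oA [z Az] sA mA]] := key _ (openI oP oB).
  - by exists y.
  - by move=> z [].
  have [Pz _] := sA z Az; case: (sP z Pz); left; by exists A.
apply: meagerS (meagerU mCV mF) => x Cx.
have [Vx|nVx] := pselect (V x); [by left|right=> -[//|/interior_subset]].
by case: Cx.
Qed.

(** Up to a meager set [x * b i] is an open [O], and multiplication is continuous at [(x, d)] for a
    generic [d] in [b i] with [x * d] in [O]. For generic [y] near [x], [y] sends a nonempty open
    part of [b i] almost into [O], so [x^-1 * y] returns [b i] to itself. *)
Let dec_continuous x n : G1 x -> nbhs x [set y | G1 y -> W n ((dec x)^-1 * dec y)].
Proof.
have [bo bP] := bb; move=> Gx.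
suff h i : b i !=set0 ->
    nbhs x [set y | G1 y -> return_set (b i) ((dec x)^-1 * dec y)].
  elim: n => [|n IH]; first by apply: filterS filterT => y _ _ i.
  have [/h nb|nb0] := pselect (b n !=set0).
    apply: filterS (filterI IH nb) => y [Wy Ny] Gy i; rewrite ltnS leq_eqVlt.
    by move=> /orP[/eqP -> _|ni b0]; [exact: Ny|exact: (Wy Gy)].
  apply: filterS IH => y Wy Gy i; rewrite ltnS leq_eqVlt.
  by move=> /orP[/eqP -> /nb0|ni b0]; [|exact: (Wy Gy)].
move=> i0; have nb := open_nonmeager (bo i) i0.
have [O [oO bO Ob]] := act_bp (dec x)^-1 (bo i).
have [d bd] := nonmeager_ex nb (meagerU Gx (act_meager (dec x) bO)).
move=> /not_orP[/contrapT Qd] nOd.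
have {nOd}Od : O (act (dec x) d).
  by apply: contrapT => h; apply: nOd; split=> //; rewrite /= actK.
have [|[P A] [/= nP nA] sPA] := @Qc _ Qd O; first exact: open_nbhs_nbhs.
apply: filterS nP => y Py Gy mZ.
have : meager (A° `&` b i).
  apply: meagerS (meagerU mZ (meagerU Gy (act_meager (dec y) Ob))).
  move=> z [/interior_subset Az bz].
  have [h|h] := pselect ((act ((dec x)^-1 * dec y) @^-1` b i) z); first by left.
  right; have [Qz|Qz] := pselect (Q (y, z)); last by left.
  right; split; first exact: (sPA (y, z) (conj Py Az) Qz).
  by rewrite /= actM.
apply: open_nonmeager; first by apply: openI => //; exact: open_interior.
by exists d.
Qed.

Lemma return_polish (R : realType) : separable G /\ completely_metrizable R G.
Proof.
have [bo bP] := bb.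
(* The bad points: those not generic for multiplication, and those where almost openness fails for
   some basic set. Removing a countable union of closed sets covering them leaves an intersection of
   open sets, as completeness requires. *)
pose N := ~` G1 `|` \bigcup_k (b k `&` [set e | ~ nbhs (dec e : G) (fatG (b k))]).
have [F [cF nF NF]] : meager N.
  by apply: meagerU => //; apply: meager_bigcup => k; exact: fatG_nbhs.
pose O k := ~` F k; pose D := \bigcap_k O k.
have oO k : open (O k) by exact: closed_openC.
have mD : meager (~` D).
  by exists F; split=> //; rewrite setC_bigcap => x [k _ /contrapT Fx]; exists k.
have DN x : D x -> ~ N x by move=> Dx /NF[k _]; exact: Dx.
have DG x : D x -> G1 x by move=> /DN nN; apply: contrapT => h; apply: nN; left.
have cd : cont_on D (dec : S -> G).
  move=> x Dx A [n nA]; apply: filterS (dec_continuous n (DG _ Dx)) => y Wy Dy.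
  by apply: nA; apply: Wy; exact: DG.
have hit (A : set S) (t : G) P : nbhs t P ->
    (forall n, ~ meager (A `&` [set s | W n (t^-1 * dec s)])) ->
    exists s, [/\ A s, D s & P (dec s)].
  move=> [n nP] /(_ n)/nonmeager_ex/(_ mD)[s [As Ws] /contrapT Ds].
  by exists s; split=> //; exact: nP.
have dd : dense ((dec : S -> G) @` D).
  move=> P [y Py] oP.
  have [|s [_ Ds Ps]] := hit setT y P (open_nbhs_nbhs (conj oP Py)).
    by move=> n; rewrite setTI; exact: coset_nonmeager.
  by exists (dec s); split=> //; exists s.
split.
- have [D' cD' [D'D dD']] := separable_subset D bb.
  exists ((dec : S -> G) @` D'); first exact: card_le_trans (card_image_le _ _) cD'.
  move=> P P0 oP; have [z [Pz [x Dx xz]]] := dd P P0 oP.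
  have Px : P (dec x) by rewrite xz.
  have [y D'y Py'] := dD' x Dx _ (@cd x Dx P (open_nbhs_nbhs (conj oP Px))).
  by exists (dec y); split; [apply: Py'; exact: D'D|exists y].
apply: (@base_group_polish T W return_nbhs1_base R S O dec pS oO cd) => // B e oB Be De.
have [k bk kB] := bP _ _ (open_nbhs_nbhs (conj oB Be)).
have : nbhs (dec e : G) (fatG (b k)).
  by apply: contrapT => h; apply: (DN _ De); right; exists k.
apply: filterS => t ft P /hit/(_ ft)[s [bs Ds Ps]].
by exists (dec s); split=> //; exists s => //; split=> //; exact: kB.
Qed.

(** Pettis' argument across two topologies: the Baire property is taken in [S], and a return set
    replaces the quotient set as neighbourhood of 1. *)
Lemma return_morph_continuous (K : topologicalGroupType) (b' : nat -> set K) (p : T -> K) :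
  base_seq b' -> {morph p : x y / x * y} ->
  (forall V, open V -> bp ((p \o dec) @^-1` V)) -> continuous (p : G -> K).
Proof.
move=> bb' pM pbp; apply: (@continuous_at1 G K) => // V nV.
pose A n := if `[< forall y z, b' n y -> b' n z -> V (y * z^-1) >]
            then (p \o dec) @^-1` b' n else set0.
have [|n] := @meager_cover_ex S s0 A bS.
  move=> x; have [n bx bV] := base_divg_cover bb' nV (p (dec x)).
  by exists n; rewrite /A; case: asboolP.
rewrite /A; case: asboolP => [bV|_ m0]; last by case: m0; exact: meager0.
have [bo' _] := bb' => /(bp_nonmeager (pbp _ (bo' n)))[U [oU U0 UA]].
have [m mP] := W_return oU U0; apply/nbhs1_baseE; exists m => t /mP/(return_msub UA) Nt.
have [x [/= bx bxt] _] := nonmeager_ex Nt (@meager0 _).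
by have := bV _ _ bxt bx; rewrite /act encK pM mulgK.
Qed.

End Generic.

Theorem group_chunk (R : realType) : exists (G : polishGroupType R) (f : G -> T),
  [/\ {morph f : x y / x * y}, injective f, forall t, exists x, f x = t &
      forall (K : polishGroupType R) (p : T -> K), {morph p : x y / x * y} ->
        (forall V, open V -> bp ((p \o dec) @^-1` V)) -> continuous (p \o f)].
Proof.
have [Q mQ Qc] := mul_cat; have [Q2 mQ2 Q2c] := div_cat.
have [sG mG] := return_polish mQ mQ2 Qc Q2c R.
exists (polish_group_of sG mG), id; split=> // [t|K p pM pbp]; first by exists t.
have [_ _ [b' bb'] _] := polish_group_space K.
exact: (return_morph_continuous bb' pM pbp).
Qed.

End GroupChunk.

Lemma open_map_section (T U : topologicalType) (f : T -> U) :
  (forall t, exists s : U -> T, [/\ continuous s, s (f t) = t & cancel s f]) ->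
  open_map f.
Proof.
move=> sec O oO; rewrite openE => _ [t Ot <-]; have [s [cs st sK]] := sec t.
have := cs (f t) O; rewrite st => /(_ (open_nbhs_nbhs (conj oO Ot))) nO.
have {nO} : nbhs (f t) (s @^-1` O) := nO.
by apply: filterS => u Osu; exists (s u).
Qed.

Lemma cat_cont_mulg (Z : topologicalType) (G : topologicalGroupType) (f g : Z -> G) :
  cat_cont f -> cat_cont g -> cat_cont (fun z => f z * g z).
Proof.
move=> cf cg; apply: (@cat_cont_comp _ _ _ (fun p : G * G => p.1 * p.2) (fun z => (f z, g z))).
  exact: (@mulg_continuous G).
exact: cat_cont_pair.
Qed.

Lemma cat_cont_invg (Z : topologicalType) (G : topologicalGroupType) (f : Z -> G) :
  cat_cont f -> cat_cont (fun z => (f z)^-1).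
Proof.
move=> cf; apply: (@cat_cont_comp _ _ _ (fun x : G => x^-1) f) => //.
exact: (@invg_continuous G).
Qed.

Lemma cat_cont_borel (X Y : topologicalType) (f : X -> Y) : polish_space Y ->
  borel_fun f -> cat_cont f.
Proof.
move=> [_ _ [b bb] _] bf; apply: (bp_cat_cont bb) => n; apply: bp_borel; apply: bf.
by apply: borel_open; have [bo _] := bb.
Qed.

(** * The graph of a homomorphism of quotients as a Polish group *)

Section GraphGroup.
Variables (R : realType) (X Y M : polishGroupType R) (i : M -> Y) (phi : X -> Y).
Variable N : set (X * Y).
Hypotheses (iP : continuous_morphism i) (ii : injective i) (cphi : cat_cont phi).
Hypotheses (sN : subgroup_set N).
Hypothesis NP : forall x y, N (x, y) <-> exists m, y = phi x * i m.

Let iM : {morph i : x y / x * y}. Proof. by case: iP. Qed.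
Let ci : continuous i. Proof. by case: iP. Qed.

Local Notation T := (subgroup_of sN).
Local Notation S := (X * M)%type.
Let val (t : T) : X * Y := @subgroup_val _ N sN t.

Let dec_subproof (s : S) : N (s.1, phi s.1 * i s.2).
Proof. by apply/NP; exists s.2. Qed.

Let dec (s : S) : T := subgroup_elt sN (dec_subproof s).

Let offset_ex (t : T) : exists m, (val t).2 = phi (val t).1 * i m.
Proof. by apply/NP; rewrite -surjective_pairing; exact: subgroup_valP. Qed.

Let offset (t : T) : M := sval (cid (offset_ex t)).

Let offsetE t : i (offset t) = (phi (val t).1)^-1 * (val t).2.
Proof. by rewrite /offset; case: cid => m /= ->; rewrite mulKg. Qed.

Let enc (t : T) : S := ((val t).1, offset t).

Let valdec s : val (dec s) = (s.1, phi s.1 * i s.2). Proof. by []. Qed.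
Let valM t u : val (t * u) = ((val t).1 * (val u).1, (val t).2 * (val u).2).
Proof. by []. Qed.
Let valV t : val t^-1 = ((val t).1^-1, (val t).2^-1). Proof. by []. Qed.

Let encK : cancel enc dec.
Proof.
move=> t; apply: (@subgroup_val_inj _ N sN); rewrite -/(val (dec _)) valdec /=.
by rewrite offsetE mulVKg -surjective_pairing.
Qed.

Let decK : cancel dec enc.
Proof. by move=> [x m]; congr pair; apply: ii; rewrite offsetE valdec /= mulKg. Qed.

Let pS : polish_space S.
Proof. by apply: polish_space_prod; exact: polish_group_space. Qed.

Let hY : hausdorff_space Y. Proof. exact: polish_hausdorff. Qed.

(** Explicit formulas exist only for the image of the [M]-coordinate in [Y]; generic continuity is
    pulled back along [i]. *)
Let cat_pair_lift (Z : topologicalType) (g1 : Z -> X) (g2 : Z -> M) :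
  polish_space Z -> continuous g1 -> cat_cont (i \o g2) ->
  cat_cont (fun z => (g1 z, g2 z)).
Proof.
move=> [_ _ [b bb] _] c1 c2; apply: cat_cont_pair; first exact: continuous_cat_cont.
exact: (cat_cont_lift bb (polish_group_space M) hY ii ci c2).
Qed.

Let cont_fst : continuous (fun s : S => s.1). Proof. by move=> s; exact: cvg_fst. Qed.
Let cont_snd : continuous (fun s : S => s.2). Proof. by move=> s; exact: cvg_snd. Qed.

Let phi_comp (Z : topologicalType) (g : Z -> X) : continuous g -> open_map g ->
  cat_cont (fun z => phi (g z)).
Proof. by move=> cg og; exact: (cat_cont_precomp cphi cg og). Qed.

Let i_comp (Z : topologicalType) (g : Z -> M) : continuous g -> cat_cont (fun z => i (g z)).
Proof.
move=> cg; apply: continuous_cat_cont => z.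
by apply: (@cvg_comp _ _ _ g i); [exact: cg|exact: ci].
Qed.

Let cst_comp (Z : topologicalType) (y : Y) : cat_cont (fun _ : Z => y).
Proof. by apply: continuous_cat_cont => z; exact: cvg_cst. Qed.

Let fst_open_map : open_map (fun s : S => s.1).
Proof.
apply: open_map_section => s; exists (fun x => (x, s.2)); split=> //; last by case: s.
by move=> x; apply: cvg_pair; [exact: cvg_id|exact: cvg_cst].
Qed.

Let act_cat (t : T) : cat_cont (act enc dec t).
Proof.
apply: (@cat_pair_lift _ (fun s : S => (val t).1 * s.1)) => //.
  by move=> s; apply: cvg_mulg; [exact: cvg_cst|exact: cont_fst].
have -> : i \o (fun s => offset (t * dec s)) =
    fun s => (phi ((val t).1 * s.1))^-1 * ((val t).2 * (phi s.1 * i s.2)).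
  by apply/funext => s; rewrite /= offsetE valM valdec.
apply: cat_cont_mulg; last first.
  apply: cat_cont_mulg; first exact: cst_comp.
  by apply: cat_cont_mulg; [exact: phi_comp|exact: i_comp].
apply: cat_cont_invg; apply: phi_comp.
  by move=> s; apply: cvg_mulg; [exact: cvg_cst|exact: cont_fst].
apply: open_map_section => s; exists (fun x => ((val t).1^-1 * x, s.2)); split=> [x||x].
- by apply: cvg_pair; [exact: lmulg_continuous|exact: cvg_cst].
- by rewrite mulKg; case: s.
- by rewrite /= mulVKg.
Qed.

(** On the fibre over [x] the action is the left translation of [M] by [offset (t * dec (x, 1))],
    and on the base it is a left translation of [X]. Both preserve meager sets; the converse of
    Kuratowski-Ulam applies because generic continuity gives the preimage the Baire property. *)
Let act_meagerP (t : T) (A : set S) : meager A -> meager (act enc dec t @^-1` A).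
Proof.
have [_ _ [b bb] _] := polish_group_space M.
move=> [F [cF nF AF]]; apply: (@meagerS _ _ (\bigcup_n (act enc dec t @^-1` F n))).
  by move=> s /AF[n _ Fs]; exists n.
apply: meager_bigcup => n; apply: (kuratowski_ulam_conv bb).
- exact/polish_baire/polish_group_space.
- exact/polish_baire/polish_group_space.
- rewrite -[F n]setCK -preimage_setC; apply: bp_setC; apply: cat_cont_bp; first exact: act_cat.
  exact: closed_openC.
have mFn : meager (F n) by exact: meager_closed.
have := meager_lmulg (val t).1 (kuratowski_ulam bb mFn).
apply: meagerS => x /= nm mF; apply: nm.
have := meager_lmulg (offset (t * dec (x, 1))) mF; apply: meagerS => m /=.
congr (F n (_, _)); apply: ii; rewrite iM !offsetE !valM !valdec /=.
by rewrite (morph1 iM) mulg1 !mulgA.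
Qed.

Let c1 : continuous (fun p : S * S => p.1). Proof. by move=> p; exact: cvg_fst. Qed.
Let c2 : continuous (fun p : S * S => p.2). Proof. by move=> p; exact: cvg_snd. Qed.
Let c11 : continuous (fun p : S * S => p.1.1).
Proof.
move=> p; apply: (@cvg_comp _ _ _ (fun p : S * S => p.1) (fun s => s.1)).
  exact: c1.
exact: cont_fst.
Qed.
Let c12 : continuous (fun p : S * S => p.1.2).
Proof.
move=> p; apply: (@cvg_comp _ _ _ (fun p : S * S => p.1) (fun s => s.2)).
  exact: c1.
exact: cont_snd.
Qed.
Let c21 : continuous (fun p : S * S => p.2.1).
Proof.
move=> p; apply: (@cvg_comp _ _ _ (fun p : S * S => p.2) (fun s => s.1)).
  exact: c2.
exact: cont_fst.
Qed.
Let c22 : continuous (fun p : S * S => p.2.2).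
Proof.
move=> p; apply: (@cvg_comp _ _ _ (fun p : S * S => p.2) (fun s => s.2)).
  exact: c2.
exact: cont_snd.
Qed.

Let set21_continuous (p : S * S) (h : X -> X) : continuous h ->
  continuous (fun x => (p.1, (h x, p.2.2)) : S * S).
Proof.
move=> ch x; apply: (@cvg_pair _ _ _ (nbhs x) (nbhs p.1) (nbhs (h x, p.2.2))).
  exact: (@cvg_cst _ p.1 _ (nbhs x)).
by apply: (@cvg_pair _ _ _ (nbhs x) (nbhs (h x)) (nbhs p.2.2));
  [exact: ch|exact: (@cvg_cst _ p.2.2 _ (nbhs x))].
Qed.

Let o11 : open_map (fun p : S * S => p.1.1).
Proof.
apply: open_map_section => p; exists (fun x => ((x, p.1.2), p.2)); split=> [x||//].
  apply: (@cvg_pair _ _ _ (nbhs x) (nbhs (x, p.1.2)) (nbhs p.2)).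
    by apply: (@cvg_pair _ _ _ (nbhs x) (nbhs x) (nbhs p.1.2));
      [exact: cvg_id|exact: (@cvg_cst _ p.1.2 _ (nbhs x))].
  exact: (@cvg_cst _ p.2 _ (nbhs x)).
by case: p => [[]].
Qed.

Let o21 : open_map (fun p : S * S => p.2.1).
Proof.
apply: open_map_section => p; exists (fun x => (p.1, (x, p.2.2))); split=> [||//].
  by apply: (@set21_continuous p id) => x; exact: cvg_id.
by case: p => [? []].
Qed.

Let mul_cat : cat_cont (fun p : S * S => enc (dec p.1 * dec p.2)).
Proof.
have cm : continuous (fun p : S * S => p.1.1 * p.2.1).
  by move=> p; apply: cvg_mulg; [exact: c11|exact: c21].
apply: (@cat_pair_lift _ (fun p : S * S => p.1.1 * p.2.1)) => //.
  exact: polish_space_prod.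
have -> : i \o (fun p : S * S => offset (dec p.1 * dec p.2)) = fun p =>
    (phi (p.1.1 * p.2.1))^-1 * ((phi p.1.1 * i p.1.2) * (phi p.2.1 * i p.2.2)).
  by apply/funext => p; rewrite /= offsetE ?(valM, valV) !valdec.
apply: cat_cont_mulg.
  apply: cat_cont_invg; apply: phi_comp => //.
  (* The section solves for the [X]-coordinate of the second factor and keeps the rest of [p].
     Openness makes [phi] of the product generically continuous. *)
  apply: open_map_section => p; exists (fun x => (p.1, (p.1.1^-1 * x, p.2.2))); split.
  - by apply: set21_continuous; exact: lmulg_continuous.
  - by rewrite mulKg; case: p => [? []].
  - by move=> x; rewrite /= mulVKg.
by apply: cat_cont_mulg; apply: cat_cont_mulg;
  [exact: phi_comp|exact: i_comp|exact: phi_comp|exact: i_comp].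
Qed.

Let div_cat : cat_cont (fun p : S * S => enc ((dec p.1)^-1 * dec p.2)).
Proof.
have cm : continuous (fun p : S * S => p.1.1^-1 * p.2.1).
  by move=> p; apply: cvg_mulg; [apply: cvg_invg; exact: c11|exact: c21].
apply: (@cat_pair_lift _ (fun p : S * S => p.1.1^-1 * p.2.1)) => //.
  exact: polish_space_prod.
have -> : i \o (fun p : S * S => offset ((dec p.1)^-1 * dec p.2)) = fun p =>
    (phi (p.1.1^-1 * p.2.1))^-1 * ((phi p.1.1 * i p.1.2)^-1 * (phi p.2.1 * i p.2.2)).
  by apply/funext => p; rewrite /= offsetE ?(valM, valV) !valdec.
apply: cat_cont_mulg.
  apply: cat_cont_invg; apply: phi_comp => //.
  apply: open_map_section => p; exists (fun x => (p.1, (p.1.1 * x, p.2.2))); split.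
  - by apply: set21_continuous; exact: lmulg_continuous.
  - by rewrite mulVKg; case: p => [? []].
  - by move=> x; rewrite /= mulKg.
by apply: cat_cont_mulg; [apply: cat_cont_invg|]; apply: cat_cont_mulg;
  [exact: phi_comp|exact: i_comp|exact: phi_comp|exact: i_comp].
Qed.

Lemma graph_group : exists (E : polishGroupType R) (p : polish_hom E X) (q : polish_hom E Y),
  (forall e e', p e = p e' -> q e = q e' -> e = e') /\
  forall x y, (exists e, p e = x /\ q e = y) <-> N (x, y).
Proof.
have [_ _ [b bb] _] := pS.
have act_bpP t U : open U -> bp (act enc dec t @^-1` U).
  by move=> oU; apply: cat_cont_bp oU; exact: act_cat.
have [E [f [fM fi fs fc]]] := @group_chunk S T enc dec encK decK pS (1, 1) b bb
  act_meagerP act_bpP mul_cat div_cat R.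
have pP : continuous_morphism (fun e : E => (val (f e)).1).
  split=> [x y|]; first by rewrite fM.
  apply: (fc X (fun t => (val t).1)) => // V oV.
  by apply: bp_open; move/continuousP: cont_fst; exact.
have qP : continuous_morphism (fun e : E => (val (f e)).2).
  split=> [x y|]; first by rewrite fM.
  apply: (fc Y (fun t => (val t).2)) => // V oV.
  by apply: cat_cont_bp oV; apply: cat_cont_mulg; [exact: phi_comp|exact: i_comp].
exists E, (PolishHom pP), (PolishHom qP); split=> [e e' /= h1 h2|x y].
  apply: fi; apply: (@subgroup_val_inj _ N sN).
  rewrite -/(val (f e)) -/(val (f e')).
  by rewrite [LHS]surjective_pairing [RHS]surjective_pairing h1 h2.
split=> [[e [/= <- <-]]|Nxy].
  by rewrite -surjective_pairing; exact: subgroup_valP.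
by have [e fe] := fs (subgroup_elt sN Nxy); exists e; rewrite /= fe.
Qed.

End GraphGroup.

(** * Equivalence with the groups with a Polish cover *)

Section EquivalenceCriterion.
Variables (C D : category) (F : functor C D).
Hypothesis faithful : forall A B (f g : hom A B), fmap F f = fmap F g -> f = g.
Hypothesis full : forall A B (h : hom (F A) (F B)), exists f, fmap F f = h.
Hypothesis ess_surj : forall Z : D, exists A, exists e : hom (F A) Z, is_iso e.

Let G0 Z : C := sval (cid (ess_surj Z)).
Let eps_ex Z : exists e : hom (F (G0 Z)) Z, is_iso e.
Proof. by rewrite /G0; case: cid. Qed.
Let eps Z : hom (F (G0 Z)) Z := sval (cid (eps_ex Z)).
Let eps_iso Z : is_iso (eps Z). Proof. by rewrite /eps; case: cid. Qed.
Let iota Z : hom Z (F (G0 Z)) := sval (cid (eps_iso Z)).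
Let iotaK Z : iota Z ∘ eps Z = idc _. Proof. by rewrite /iota; case: cid => i []. Qed.
Let epsK Z : eps Z ∘ iota Z = idc _. Proof. by rewrite /iota; case: cid => i []. Qed.

Let lift A B (h : hom (F A) (F B)) : hom A B := sval (cid (full h)).
Let liftE A B (h : hom (F A) (F B)) : fmap F (lift h) = h.
Proof. by rewrite /lift; case: cid. Qed.

Let G1 Y Z (h : hom Y Z) : hom (G0 Y) (G0 Z) := lift (iota Z ∘ h ∘ eps Y).

Let G1_id Z : G1 (idc Z) = idc (G0 Z).
Proof. by apply: faithful; rewrite liftE compc1 iotaK fmap1. Qed.

Let G1_comp X Y Z (h : hom Y Z) (k : hom X Y) : G1 (h ∘ k) = G1 h ∘ G1 k.
Proof.
apply: faithful; rewrite fmapM !liftE !compA; congr (_ ∘ _ ∘ _).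
by rewrite -(compA _ (eps Y)) epsK compc1.
Qed.

Let G : functor D C := Functor G1_id G1_comp.

Lemma equivalence_criterion : is_equivalence F.
Proof.
exists G; split.
  exists (fun A => lift (eps (F A)) : hom (functor_comp G F A) (functor_id C A)).
  split=> [A B f|A].
    apply: faithful; rewrite /= !fmapM !liftE.
    by rewrite !compA epsK comp1c.
  exists (lift (iota (F A))); split; apply: faithful.
    by rewrite fmapM !liftE iotaK fmap1.
  by rewrite fmapM !liftE epsK fmap1.
exists eps; split=> [A B f|A]; last exact: eps_iso.
by rewrite /= liftE !compA epsK comp1c.
Qed.

End EquivalenceCriterion.

(** * Relations as sets of points *)

Section Pointwise.
Variable R : realType.
Local Notation C := (PolGrp R).
Local Notation HP := (PolGrp_regular R).
Implicit Types X Y Z : polishGroupType R.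

Definition rel_pt (X Y : C) (S : relation HP X Y) (x : X) (y : Y) : Prop :=
  exists r, polish_fun (rel_fst S) r = x /\ polish_fun (rel_snd S) r = y.

(** The chosen categorical product is opaque; its map to the concrete product is a mono by the
    universal property, hence injective. *)
Lemma prodc_inj (X Y : C) (u v : prodc HP X Y) :
  polish_fun (pr1 HP X Y) u = polish_fun (pr1 HP X Y) v ->
  polish_fun (pr2 HP X Y) u = polish_fun (pr2 HP X Y) v -> u = v.
Proof.
have mP : @continuous_morphism (prodc HP X Y) (polish_prod X Y)
    (fun u => (polish_fun (pr1 HP X Y) u, polish_fun (pr2 HP X Y) u) : X * Y).
  split=> [x y|x]; first by rewrite !polish_homM.
  by apply: cvg_pair; exact: polish_homC.
move=> h1 h2; apply: (@mono_inj R _ (polish_prod X Y) (PolishHom mP)).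
  move=> T a b /hom_eqP ab.
  by apply: prodc_ext; apply/hom_eqP => t; have [] := ab t.
by rewrite /= h1 h2.
Qed.

(** Points chosen one by one form a homomorphism, because the mono of the subobject is injective;
    [continuous_lift] makes it continuous. *)
Lemma rel_atP (X Y : C) (S : relation HP X Y) (T : C) (x : hom T X) (y : hom T Y) :
  rel_at S x y <-> forall t, rel_pt S (polish_fun x t) (polish_fun y t).
Proof.
split=> [[h eh] t|pt].
  exists (polish_fun h t); rewrite -(pairc1 HP x y).
  rewrite -[X in _ /\ _ = polish_fun X t](pairc2 HP x y).
  by rewrite -eh.
have im := mono_inj (marr_mono (m := sub_mono S)).
have /choice[h hP] := pt.
have mh t : polish_fun (marr (sub_mono S)) (h t) = polish_fun (pairc HP x y) t.
  have [h1 h2] := hP t; apply: prodc_inj.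
    by have /hom_eqP/(_ t) /= -> := pairc1 HP x y.
  by have /hom_eqP/(_ t) /= -> := pairc2 HP x y.
have hM : {morph h : s t / s * t}.
  by move=> s t; apply: im; rewrite polish_homM !mh polish_homM.
have hc : continuous h.
  apply: (@continuous_lift (T : polishGroupType R) (rel_dom S : polishGroupType R)
    (prodc HP X Y : polishGroupType R) (polish_fun (marr (sub_mono S))) h) => //.
  - exact: polish_group_space.
  - exact: polish_group_space.
  - exact: polish_hausdorff.
  - exact: polish_homC.
  - have -> : polish_fun (marr (sub_mono S)) \o h = polish_fun (pairc HP x y).
      by apply/funext => t; exact: mh.
    exact: polish_homC.
have hh : continuous_morphism h by split.
by exists (PolishHom hh); apply/hom_eqP => t; exact: mh.
Qed.

Lemma rel_pt_dom (X Y : C) (S S' : relation HP X Y) :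
  rel_at S' (rel_fst S) (rel_snd S) -> forall x y, rel_pt S x y -> rel_pt S' x y.
Proof. by move=> /rel_atP h x y [r [<- <-]]. Qed.

Lemma rel_pt_le (X Y : C) (S S' : relation HP X Y) :
  sub_le S S' <-> forall x y, rel_pt S x y -> rel_pt S' x y.
Proof.
rewrite rel_leP; split=> h.
  by apply: rel_pt_dom; apply: h; exact: rel_at_dom.
by move=> T x y /rel_atP Sxy; apply/rel_atP => t; exact: h.
Qed.

Lemma rel_pt_ext (X Y : C) (S S' : relation HP X Y) :
  (forall x y, rel_pt S x y <-> rel_pt S' x y) -> S = S'.
Proof.
by move=> E; apply: sub_le_anti; apply/rel_pt_le => x y /E.
Qed.

Lemma rel_pt_diag (X : C) (x y : X) : rel_pt (rel_diag HP X) x y <-> x = y.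
Proof.
split=> [[r [<- <-]]|<-].
  by have /rel_at_diag -> := rel_at_dom (rel_diag HP X).
have /rel_atP/(_ x) : rel_at (rel_diag HP X) (idc X) (idc X) by apply/rel_at_diag.
exact.
Qed.

Lemma rel_pt_opp (X Y : C) (S : relation HP X Y) x y :
  rel_pt (rel_opp S) y x <-> rel_pt S x y.
Proof.
split=> -[r [<- <-]].
  by have /rel_at_opp/rel_atP/(_ r) := rel_at_dom (rel_opp S).
by have /rel_at_opp/rel_atP/(_ r) := rel_at_dom S.
Qed.

(** Surjectivity of regular epis turns the local existence of a middle term into the existence of a
    middle point. *)
Lemma rel_pt_comp (X Y Z : C) (S : relation HP Y Z) (T : relation HP X Y) x z :
  rel_pt (rel_comp S T) x z <-> exists y, rel_pt T x y /\ rel_pt S y z.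
Proof.
split=> [[r [<- <-]]|[_ [[r [<- <-]] [s [sr <-]]]]].
  have /rel_at_rel_comp[T' [e [y [/regular_epi_surj se /rel_atP Ty /rel_atP Sy]]]] :=
    rel_at_dom (rel_comp S T).
  have [t <-] := se r; exists (polish_fun y t); split; [exact: Ty|exact: Sy].
have [P [p [q [pq sPQ _ _]]]] := polish_pullback (rel_snd T) (rel_fst S).
have : rel_at (rel_comp S T) (rel_fst T ∘ (p : @hom C P _)) (rel_snd S ∘ (q : @hom C P _)).
  apply/rel_at_rel_comp; exists P, (idc (P : C)), (rel_snd T ∘ (p : @hom C P _)).
  rewrite !compc1; split; first exact: regular_epi_id.
    by apply: rel_at_comp; exact: rel_at_dom.
  have -> : rel_snd T ∘ (p : @hom C P _) = rel_fst S ∘ (q : @hom C P _).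
    by apply/hom_eqP => t; exact: pq.
  by apply: rel_at_comp; exact: rel_at_dom.
have [t [<- <-]] := sPQ _ _ (esym sr).
by move=> /rel_atP/(_ t).
Qed.

Lemma rel_of_graph X Y E (p : polish_hom E X) (q : polish_hom E Y) :
  (forall e e', p e = p e' -> q e = q e' -> e = e') ->
  exists S : relation HP (X : C) (Y : C),
    forall x y, rel_pt S x y <-> exists e, p e = x /\ q e = y.
Proof.
move=> ipq; pose m := pairc HP (p : @hom C E X) (q : @hom C E Y).
have m1 e : polish_fun (pr1 HP X Y) (polish_fun m e) = p e.
  by have /hom_eqP/(_ e) := pairc1 HP (p : @hom C E X) (q : @hom C E Y).
have m2 e : polish_fun (pr2 HP X Y) (polish_fun m e) = q e.
  by have /hom_eqP/(_ e) := pairc2 HP (p : @hom C E X) (q : @hom C E Y).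
have mm : mono m.
  by apply: inj_mono => e e' ee; apply: ipq; [rewrite -!m1 ee|rewrite -!m2 ee].
pose S : relation HP (X : C) (Y : C) := subobj_of (MonoTo mm).
exists S => x y; split=> [[r [<- <-]]|[e [<- <-]]].
  have /rel_at_of[h /= /hom_eqP eh] := rel_at_dom S.
  exists (polish_fun h r); rewrite -m1 -m2 (eh r : polish_fun m (polish_fun h r) = _).
  have /hom_eqP/(_ r) /= -> := pairc1 HP (rel_fst S) (rel_snd S).
  by have /hom_eqP/(_ r) /= -> := pairc2 HP (rel_fst S) (rel_snd S).
have : rel_at S (p : @hom C E X) (q : @hom C E Y).
  by apply/rel_at_of; exists (idc (E : C)); rewrite compc1.
by move=> /rel_atP/(_ e).
Qed.

Lemma rel_ptM (X Y : C) (S : relation HP X Y) (x x' : X) (y y' : Y) :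
  rel_pt S x y -> rel_pt S x' y' -> rel_pt S (x * x') (y * y').
Proof.
move=> [r [<- <-]] [r' [<- <-]]; exists (r * r'); split; exact: polish_homM.
Qed.

Lemma rel_ptV (X Y : C) (S : relation HP X Y) (x : X) (y : Y) :
  rel_pt S x y -> rel_pt S x^-1 y^-1.
Proof.
move=> [r [<- <-]]; exists r^-1; split; apply: morphV; exact: polish_homM.
Qed.

End Pointwise.

(** Being a Polish subgroup is a proposition, so equal sets give equal covers; this yields equality
    of objects and not just isomorphism. *)
Lemma polish_cover_eq (R : realType) (G : polishGroupType R) (N N' : set G)
    (n : normal_subgroup N) (n' : normal_subgroup N') (p : polish_subgroup N)
    (p' : polish_subgroup N') : N = N' -> PolishCover n p = PolishCover n' p'.
Proof.
move=> E; move: n p n' p'; rewrite E => n p n' p'.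
by congr PolishCover; exact: Prop_irrelevance.
Qed.

Lemma normal_subgroup_set (G : groupType) (N : set G) : normal_subgroup N -> subgroup_set N.
Proof. by case. Qed.

(** The definition asks for a structure on [set_type N] itself, so the one of [K] is transported
    along the bijection [s], whose range is closed because it is everything. *)
Lemma polish_subgroup_range (R : realType) (G K : polishGroupType R) (N : set G)
    (j : polish_hom K G) : subgroup_set N -> injective j -> range j = N ->
  polish_subgroup N.
Proof.
move=> sN ij jN; pose S := subgroup_of sN.
have jex : forall x : S, exists k : K, j k = @subgroup_val G N sN x.
  move=> x; have := @subgroup_valP G N sN x.
  by rewrite -[X in X _]jN => -[k _ jk]; exists k.
have [s sP] := choice jex.
have sM : {morph s : x y / x * y}.
  by move=> x y; apply: ij; rewrite polish_homM !sP.
have si : injective s.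
  by move=> x y xy; apply: (@subgroup_val_inj _ N sN); rewrite -!sP xy.
have sr : range s = setT.
  apply/seteqP; split=> // k _.
  have Nk : N (j k) by rewrite -jN; exists k.
  by exists (subgroup_elt sN Nk) => //; apply: ij; rewrite sP.
have sc : closed (range s) by rewrite sr; exact: closedT.
pose P : polishGroupType R := induced_polish sM si sc.
exists (PolishGroup.class P).
have -> : (set_val : set_type N -> G) = j \o s by apply/funext => x; rewrite /= sP.
split=> [x y|x]; first by rewrite /= sM polish_homM.
apply: (@cvg_comp _ _ _ s j); last exact: polish_homC.
exact: (@induced_polish_continuous R _ K s sM si sc x).
Qed.

Lemma cover_inclusion (R : realType) (Y : polish_cover R) :
  exists (M : polishGroupType R) (i : M -> Y),
    [/\ continuous_morphism i, injective i & range i = @cover_sub R Y].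
Proof.
have [c ci] := cover_polish Y; exists (PolishGroup.Pack c), set_val; split=> //.
apply/seteqP; split=> [_ [x _ <-]|y Ny]; first exact: set_valP.
by exists (SigSub (mem_set Ny)).
Qed.

Section Graph.
Variable R : realType.

Lemma pc_graph (X Y : polish_cover R) (f : pc_hom X Y) :
  exists S : relation (PolGrp_regular R) (cover_group X : PolGrp R) (cover_group Y : PolGrp R),
    forall x y, rel_pt S x y <-> f (coset x) = coset y.
Proof.
have [phi [fphi bphi]] := pc_hom_borel f; have [M [i [iP ii iN]]] := cover_inclusion Y.
have fM := @pc_homM R X Y f.
pose N : set (X * Y) := [set p | f (coset p.1) = coset p.2].
have sN : subgroup_set N.
  split=> [|[a b] [c d] /= h h'|[a b] /= h]; rewrite /N /=.
  - have := morph1 fM; rewrite -(morph1 (@cosetM R X)) => ->.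
    by rewrite -(morph1 (@cosetM R Y)).
  - by rewrite (@cosetM R X) fM h h' (@cosetM R Y).
  - by rewrite (morphV (@cosetM R X)) (morphV fM) h (morphV (@cosetM R Y)).
have NP x y : N (x, y) <-> exists m, y = phi x * i m.
  rewrite /N /= fphi; split=> [/cosetP|[m ->]].
    by rewrite -iN => -[m _ mE]; exists m; rewrite mE mulVKg.
  by apply/cosetP; rewrite mulKg -iN; exists m.
have cphi := cat_cont_borel (polish_group_space Y) bphi.
have [E [p [q [ipq pqN]]]] := graph_group iP ii cphi sN NP.
have [S SP] := rel_of_graph ipq.
by exists S => x y; rewrite SP; exact: pqN.
Qed.

End Graph.

(** * The functor from the exact completion *)

Section ExToPC.
Variable R : realType.
Local Notation C := (PolGrp R).
Local Notation HP := (PolGrp_regular R).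
Local Notation ExP := (Ex HP).

Section Objects.
Variables (X : C) (S : relation HP X X).
Hypothesis eS : equivalence_rel S.

Lemma eq_pt_refl (x : X) : rel_pt S x x.
Proof. by have [/(_ (idc X))/rel_atP/(_ x)] := eS X. Qed.

(* A reflexive relation on groups is symmetric by Mal'cev's argument. *)
Lemma eq_pt_sym (x y : X) : rel_pt S x y -> rel_pt S y x.
Proof.
move=> /rel_ptV Sxy; have := rel_ptM (rel_ptM (eq_pt_refl x) Sxy) (eq_pt_refl y).
by rewrite mulgV mul1g mulgVK.
Qed.

Definition ker_rel : set X := [set x | rel_pt S x 1].

Lemma ker_relP (x y : X) : ker_rel (x^-1 * y) <-> rel_pt S x y.
Proof.
split=> [h|h].
  by have := rel_ptM (eq_pt_refl x) h; rewrite mulVKg mulg1 => /eq_pt_sym.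
by have := rel_ptM (eq_pt_refl x^-1) (eq_pt_sym h); rewrite mulVg.
Qed.

Lemma ker_rel_normal : normal_subgroup ker_rel.
Proof.
split=> [|x y|x|x g]; rewrite /ker_rel /=; first exact: eq_pt_refl.
- by move=> /rel_ptM h /h; rewrite mulg1.
- by move=> /rel_ptV; rewrite invg1.
- move=> Sx; have := rel_ptM (rel_ptM (eq_pt_refl g^-1) Sx) (eq_pt_refl g).
  by rewrite conjgE mulg1 mulVg mulgA.
Qed.

(** The pullback of the second projection of [S] along the trivial subgroup is Polish, and the first
    projection maps it injectively onto the class of 1. *)
Lemma ker_rel_polish : polish_subgroup ker_rel.
Proof.
pose I := trivial_polish_group R.
have zP : @continuous_morphism I X (fun=> 1).
  by split=> [x y|x]; [rewrite mulg1|exact: (@cst_continuous I (X : polishGroupType R) 1 x)].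
have [K [p [q [pq sPQ iPQ _]]]] := polish_pullback (rel_snd S) (PolishHom zP).
apply: (@polish_subgroup_range R X K ker_rel (polish_comp (rel_fst S) p)).
- exact/normal_subgroup_set/ker_rel_normal.
- move=> k k' /= kk; apply: iPQ; last exact: trivial_type_irr.
  apply: (mono_inj (marr_mono (m := sub_mono S))); apply: prodc_inj; first exact: kk.
  exact: etrans (pq k) (esym (pq k')).
- apply/seteqP; split=> [_ [k _ <-]|x [r [<- r1]]].
    by exists (polish_fun p k); split=> //; exact: pq.
  by have [k [<- _]] := sPQ r (1 : I) r1; exists k.
Qed.

End Objects.

Definition cover_of_ex (X : ExP) : PC R :=
  PolishCover (ker_rel_normal (ex_relP X)) (ker_rel_polish (ex_relP X)).

Lemma cover_of_ex_cosetP (X : ExP) (x y : ex_carrier X : C) :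
  coset (X := cover_of_ex X) x = coset (X := cover_of_ex X) y <-> rel_pt (ex_rel X) x y.
Proof. by rewrite cosetP; exact: (ker_relP (ex_relP X)). Qed.

Section Morphisms.
Variables (X Y : ExP) (T : ex_hom X Y).
Local Notation TT := (rel_pt (ex_hom_rel T)).

Lemma ex_hom_total x : exists y, TT x y.
Proof.
have [_ _ /rel_pt_le h _] := ex_homP T.
have /rel_pt_comp[y [Txy _]] := h _ _ (eq_pt_refl (ex_relP X) x).
by exists y.
Qed.

Lemma ex_hom_left x x' y : rel_pt (ex_rel X) x x' -> TT x' y -> TT x y.
Proof.
by have [<- _ _ _] := ex_homP T => Rxx Ty; apply/rel_pt_comp; exists x'; split=> //;
  move: Ty; have [-> _ _ _] := ex_homP T.
Qed.

Lemma ex_hom_right x y y' : TT x y -> rel_pt (ex_rel Y) y y' -> TT x y'.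
Proof.
have [_ E _ _] := ex_homP T => Ty Syy; rewrite E; apply/rel_pt_comp.
by exists y.
Qed.

Lemma ex_hom_unique x y y' : TT x y -> TT x y' -> rel_pt (ex_rel Y) y y'.
Proof.
move=> Ty Ty'; have [_ _ _ /rel_pt_le h] := ex_homP T; apply: h.
by apply/rel_pt_comp; exists x; split=> //; apply/rel_pt_opp.
Qed.

Lemma ex_hom_coset_ex (A : quotient (cover_of_ex X)) : exists B : quotient (cover_of_ex Y),
  exists x y, [/\ A = coset (X := cover_of_ex X) x, B = coset (X := cover_of_ex Y) y & TT x y].
Proof.
have [x ->] := coset_surj A; have [y Txy] := ex_hom_total x.
by exists (coset (X := cover_of_ex Y) y), x, y.
Qed.

Definition ex_hom_fun (A : quotient (cover_of_ex X)) : quotient (cover_of_ex Y) :=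
  sval (cid (ex_hom_coset_ex A)).

Lemma ex_hom_funP x y :
  ex_hom_fun (coset (X := cover_of_ex X) x) = coset (X := cover_of_ex Y) y <-> TT x y.
Proof.
rewrite /ex_hom_fun; case: cid => B /= [x' [y' [/cover_of_ex_cosetP xx ->  Txy]]].
split=> [/cover_of_ex_cosetP yy|Ty].
  exact: ex_hom_right (ex_hom_left xx Txy) yy.
apply/cover_of_ex_cosetP; exact: ex_hom_unique (ex_hom_left xx Txy) Ty.
Qed.

Lemma ex_hom_fun_morph : {morph ex_hom_fun : A B / A * B}.
Proof.
move=> A B; have [a ->] := coset_surj A; have [b ->] := coset_surj B.
have [c Tac] := ex_hom_total a; have [d Tbd] := ex_hom_total b.
rewrite (iffRL (ex_hom_funP a c) Tac) (iffRL (ex_hom_funP b d) Tbd) -!cosetM.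
by apply/ex_hom_funP; exact: rel_ptM.
Qed.

(** Totality makes the first projection of the relation a surjection, open by the open mapping
    theorem; a Borel section of it followed by the second projection is the lift. *)
Lemma ex_hom_fun_borel : borel_definable (X := cover_of_ex X) (Y := cover_of_ex Y) ex_hom_fun.
Proof.
pose p := rel_fst (ex_hom_rel T); pose q := rel_snd (ex_hom_rel T).
have sp x : exists r, polish_fun p r = x.
  by have [y [r [rx _]]] := ex_hom_total x; exists r.
have [s [sK bs]] := borel_section (polish_group_space _)
  (@polish_hausdorff R (ex_carrier X)) (@polish_homC _ _ _ p)
  (open_mapping (polish_group_space _) (polish_group_space _) (polish_homP p) sp) sp.
exists (fun x => polish_fun q (s x)); split.
  by move=> x; apply/ex_hom_funP; exists (s x); split=> //; exact: sK.
move=> B bB; apply: (bs (polish_fun q @^-1` B)).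
apply: (bB [set A | borel (polish_fun q @^-1` A)]); split.
- split=> [|A /= bA|A bA] /=.
  + by rewrite preimage_set0; apply: borel_open; exact: open0.
  + by rewrite setTD preimage_setC; exact: borel_setC.
  + by rewrite preimage_bigcup; exact: borel_bigcup.
- move=> O oO /=; apply: borel_open.
  by move/continuousP: (@polish_homC _ _ _ q); exact.
Qed.

Definition pc_of_ex_hom : pc_hom (cover_of_ex X) (cover_of_ex Y) :=
  PCHom ex_hom_fun_morph ex_hom_fun_borel.

End Morphisms.

Lemma pc_of_ex_hom_id X : pc_of_ex_hom (ex_id X) = pc_id (cover_of_ex X).
Proof.
apply: pc_hom_ext => A; have [a ->] := coset_surj A.
by apply/ex_hom_funP; exact: (eq_pt_refl (ex_relP X)).
Qed.

Lemma pc_of_ex_hom_comp X Y Z (U : ex_hom Y Z) (T : ex_hom X Y) :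
  pc_of_ex_hom (ex_comp U T) = pc_comp (pc_of_ex_hom U) (pc_of_ex_hom T).
Proof.
apply: pc_hom_ext => A; have [a ->] := coset_surj A.
have [b Tab] := ex_hom_total T a; have [c Ubc] := ex_hom_total U b.
have -> : pc_comp (pc_of_ex_hom U) (pc_of_ex_hom T) (coset (X := cover_of_ex X) a) =
    coset (X := cover_of_ex Z) c.
  by rewrite /= (iffRL (ex_hom_funP T a b) Tab); apply/ex_hom_funP.
by apply/ex_hom_funP/rel_pt_comp; exists b.
Qed.

Definition ex_to_pc : functor ExP (PC R) :=
  @Functor ExP (PC R) cover_of_ex pc_of_ex_hom pc_of_ex_hom_id
    (fun X Y Z U T => @pc_of_ex_hom_comp X Y Z U T).

Lemma ex_to_pc_faithful (X Y : ExP) (T U : hom X Y) :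
  fmap ex_to_pc T = fmap ex_to_pc U -> T = U.
Proof.
move=> E; apply: ex_hom_ext; apply: rel_pt_ext => x y.
have EE : ex_hom_fun T = ex_hom_fun U by exact: (congr1 (@pc_fun R _ _) E).
by rewrite -!ex_hom_funP EE.
Qed.

Lemma ex_to_pc_full (X Y : ExP) (g : hom (ex_to_pc X) (ex_to_pc Y)) :
  exists T : hom X Y, fmap ex_to_pc T = g.
Proof.
have [S SP] := pc_graph (g : pc_hom (cover_of_ex X) (cover_of_ex Y)).
have gx x : exists y, rel_pt S x y.
  have [y gy] := coset_surj (pc_fun (g : pc_hom (cover_of_ex X) (cover_of_ex Y))
    (coset (X := cover_of_ex X) x)).
  by exists y; apply/SP.
have exS : is_ex_hom (X := X) (Y := Y) S.
  split.
  - apply: rel_pt_ext => x y; rewrite rel_pt_comp; split.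
      by move=> [x' [/cover_of_ex_cosetP xx /SP gxy]]; apply/SP; rewrite xx.
    by move=> Sxy; exists x; split=> //; exact: (eq_pt_refl (ex_relP X)).
  - apply: rel_pt_ext => x y; rewrite rel_pt_comp; split.
      by move=> Sxy; exists y; split=> //; exact: (eq_pt_refl (ex_relP Y)).
    by move=> [y' [/SP gxy /cover_of_ex_cosetP yy]]; apply/SP; rewrite gxy.
  - apply/rel_pt_le => x x' /cover_of_ex_cosetP xx; apply/rel_pt_comp.
    have [y Sxy] := gx x; exists y; split=> //; apply/rel_pt_opp/SP.
    by rewrite -xx; apply/SP.
  - apply/rel_pt_le => y y' /rel_pt_comp[x [/rel_pt_opp/SP gy /SP gy']].
    by apply/cover_of_ex_cosetP; rewrite -gy.
exists (ExHom exS); apply: pc_hom_ext => A; have [x ->] := coset_surj A.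
have [y Sxy] := gx x; rewrite (iffLR (SP x y) Sxy).
by apply/ex_hom_funP.
Qed.

Lemma ex_to_pc_surj (Z : PC R) : exists X : ExP, ex_to_pc X = Z.
Proof.
have [S SP] := pc_graph (pc_id Z).
have eS : equivalence_rel S.
  move=> T; split=> [x|x y /rel_atP xy|x y z /rel_atP xy /rel_atP yz];
    apply/rel_atP => t; apply/SP => //=.
    by have /SP/= := xy t.
  by have /SP/= -> := xy t; have /SP := yz t.
exists (ExObj eS); case: Z S SP eS => G N nN pN S SP eS.
apply: polish_cover_eq; apply/seteqP; split=> x.
  by move=> /SP /= /cosetP /=; have [_ _ h _] := nN; rewrite mulg1 => /h; rewrite invgK.
move=> Nx; apply/SP; apply/cosetP; rewrite mulg1 /=.
by have [_ _ h _] := nN; exact: h.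
Qed.

End ExToPC.

Theorem theorem4p9 (R : realType) :
  exists (HP : is_regular (PolGrp R)) (F : functor (Ex HP) (PC R)),
    is_equivalence F /\
    forall G : PolGrp R, F (ex_embed HP G) = trivial_cover G.
Proof.
exists (PolGrp_regular R), (ex_to_pc R); split.
  apply: equivalence_criterion.
  - exact: ex_to_pc_faithful.
  - exact: ex_to_pc_full.
  (* Every cover is literally a value of the functor, so the identity serves as isomorphism. *)
  - move=> Z; have [X XZ] := ex_to_pc_surj Z; exists X; rewrite XZ.
    by exists (idc Z), (idc Z); rewrite comp1c.
move=> G; apply: polish_cover_eq; apply/seteqP; split=> x.
  by move=> /rel_pt_diag.
by move=> /= ->; apply/rel_pt_diag.
Qed.
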